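(* Let $k$ be a field of characteristic zero and $n\ge 0$ a natural number. Then the 2-rig $\overline{k\mathsf{S}}/\langle\Lambda^{n+1}\rangle$ is the free 2-rig on an object of subdimension $n$. That is, it is the representing object for the functor $\mathrm{Subdim}_n\colon 2\text{-}\mathbf{Rig}\to\mathbf{Cat}$ assigning to each 2-rig $\mathsf{R}$ the full subcategory of objects of subdimension $n$ in $\mathsf{R}$: evaluation at the generating object $x$, $A\mapsto A(x)$, gives an equivalence of categories $$2\text{-}\mathbf{Rig}\bigl(\overline{k\mathsf{S}}/\langle\Lambda^{n+1}\rangle,\mathsf{R}\bigr)\;\simeq\;\mathrm{Subdim}_n(\mathsf{R})$$ for every 2-rig $\mathsf{R}$, naturally in $\mathsf{R}$. In particular, given any 2-rig $\mathsf{R}$ containing an object $r$ of subdimension $n$, there is a map of 2-rigs $F\colon\overline{k\mathsf{S}}/\langle\Lambda^{n+1}\rangle\to\mathsf{R}$ with $F(x)=r$, unique up to a uniquely determined monoidal natural isomorphism, i.e. for any two such maps $F,G$ with $F(x)=G(x)=r$ there is exactly one monoidal natural isomorphism $F\Rightarrow G$ whose component at $x$ is $1_r$.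
   Context: A 2-rig over $k$ is a symmetric monoidal $k$-linear category (the tensor product being $k$-linear in each argument on morphisms) that is Cauchy complete, i.e. has finite biproducts (including a zero object) and all idempotents split. $2\text{-}\mathbf{Rig}$ is the 2-category whose objects are 2-rigs, whose morphisms (maps of 2-rigs) are (strong) symmetric monoidal $k$-linear functors, and whose 2-morphisms are symmetric monoidal $k$-linear natural transformations. The exterior power $\Lambda^m(y)$ of an object $y$ of a 2-rig is the object obtained by splitting the idempotent $\frac{1}{m!}\sum_{\sigma\in S_m}\mathrm{sgn}(\sigma)\,\sigma$ on $y^{\otimes m}$. An object $y$ has subdimension $n$ if $\Lambda^{n+1}(y)\cong 0$. Maps of 2-rigs preserve exterior powers, hence restrict to objects of subdimension $n$; this is the action of $\mathrm{Subdim}_n$ on morphisms. $\overline{k\mathsf{S}}$ is constructed as follows: let $\mathsf{S}$ be the free symmetric monoidal category on one object $x$ (equivalently the groupoid of finite sets and bijections under disjoint union), let $k\mathsf{S}$ be the $k$-linear symmetric monoidal category obtained by freely forming $k$-linear combinations of morphisms of $\mathsf{S}$, and let $\overline{k\mathsf{S}}$ be the Cauchy completion of $k\mathsf{S}$. It is a semisimple 2-rig (every endomorphism algebra is semisimple), and it is the free 2-rig on one object: for any 2-rig $\mathsf{R}$, evaluation at $x$ gives an equivalence $2\text{-}\mathbf{Rig}(\overline{k\mathsf{S}},\mathsf{R})\simeq\mathsf{R}$. A 2-ideal of a 2-rig $\mathsf{R}$ is a full replete subcategory (closed under isomorphism) closed under finite biproducts and retracts in $\mathsf{R}$, and under tensoring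 with arbitrary objects of $\mathsf{R}$. $\langle\Lambda^{n+1}\rangle$ is the smallest 2-ideal of $\overline{k\mathsf{S}}$ containing $\Lambda^{n+1}(x)$. For a 2-ideal $\mathsf{I}$ of a semisimple 2-rig $\mathsf{R}$, the quotient $\mathsf{R}/\mathsf{I}$ has the same objects as $\mathsf{R}$, and its morphisms are equivalence classes of morphisms of $\mathsf{R}$, where $f,g\colon a\to b$ are equivalent iff $f-g$ factors through an object of $\mathsf{I}$. It inherits a 2-rig structure from $\mathsf{R}$ such that the quotient functor $\mathsf{R}\to\mathsf{R}/\mathsf{I}$ is a map of 2-rigs. The image of $x$ in $\overline{k\mathsf{S}}/\langle\Lambda^{n+1}\rangle$ is again denoted $x$. *)

(* Defs.v *)
From HB Require Import structures.
From mathcomp Require Import all_boot all_order all_fingroup all_algebra.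
From mathcomp Require Import generic_quotient boolp.

Set Implicit Arguments.
Unset Strict Implicit.
Unset Printing Implicit Defensive.

Import GRing.Theory.
Local Open Scope ring_scope.
Local Open Scope quotient_scope.

Record cat_laws (O : Type) (H : O -> O -> Type) (id : forall a, H a a)
    (cmp : forall a b c, H b c -> H a b -> H a c) : Prop := CatLaws {
  cl_assoc : forall a b c d (h : H c d) (g : H b c) (f : H a b),
    cmp _ _ _ h (cmp _ _ _ g f) = cmp _ _ _ (cmp _ _ _ h g) f;
  cl_idl : forall a b (f : H a b), cmp _ _ _ (id b) f = f;
  cl_idr : forall a b (f : H a b), cmp _ _ _ f (id a) = f }.

Record category := Category {
  ob :> Type;
  hom : ob -> ob -> Type;
  idm : forall a, hom a a;
  ccomp : forall a b c, hom b c -> hom a b -> hom a c;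
  cat_lawsP : cat_laws idm ccomp }.
Arguments idm {_} _.
Arguments ccomp {_ _ _ _} _ _.

Record functor (C D : category) := Functor {
  fob :> C -> D;
  fmap : forall a b, hom a b -> hom (fob a) (fob b);
  fmap_id : forall a, fmap (idm a) = idm (fob a);
  fmap_comp : forall a b c (g : hom b c) (f : hom a b),
    fmap (ccomp g f) = ccomp (fmap g) (fmap f) }.

Definition fid (C : category) : functor C C :=
  @Functor C C id (fun _ _ => id) (fun _ => erefl) (fun _ _ _ _ _ => erefl).

Lemma fcomp_id_subproof (C D E : category) (G : functor D E) (F : functor C D) a :
  fmap G (fmap F (idm a)) = idm (G (F a)).
Proof. by rewrite !fmap_id. Qed.

Lemma fcomp_comp_subproof (C D E : category) (G : functor D E) (F : functor C D)
  a b c (g : hom b c) (f : hom a b) :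
  fmap G (fmap F (ccomp g f)) = ccomp (fmap G (fmap F g)) (fmap G (fmap F f)).
Proof. by rewrite !fmap_comp. Qed.

Definition fcomp (C D E : category) (G : functor D E) (F : functor C D) :
    functor C E :=
  @Functor C E (fun a => G (F a)) (fun _ _ f => fmap G (fmap F f))
    (fcomp_id_subproof G F) (@fcomp_comp_subproof _ _ _ G F).

Record nattrans (C D : category) (F G : functor C D) := NatTrans {
  ncomp :> forall a, hom (F a) (G a);
  ncomp_nat : forall a b (f : hom a b),
    ccomp (ncomp b) (fmap F f) = ccomp (fmap G f) (ncomp a) }.

Definition is_iso (C : category) (a b : C) (f : hom a b) : Prop :=
  exists g : hom b a, ccomp g f = idm a /\ ccomp f g = idm b.

Definition is_equivalence (C D : category) (F : functor C D) : Prop :=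
  exists (G : functor D C) (eta : nattrans (fid C) (fcomp G F))
         (eps : nattrans (fcomp F G) (fid D)),
    (forall a, is_iso (eta a)) /\ (forall b, is_iso (eps b)).

(* The identity of a, seen as a map to b *)
Definition id_hom (C : category) (a b : C) (e : a = b) : hom a b :=
  match e in _ = b return hom a b with erefl => idm a end.

Section FullSubcategory.
Variables (C : category) (P : C -> Prop).

Lemma fullsub_laws : @cat_laws {a : C | P a} (fun a b => hom (sval a) (sval b))
  (fun a => idm (sval a)) (fun _ _ _ g f => ccomp g f).
Proof.
by case: (cat_lawsP C) => A L R; split=> *; [apply: A | apply: L | apply: R].
Qed.

Definition fullsub : category := Category fullsub_laws.
End FullSubcategory.

Section SymmetricMonoidal.
Variables (O : Type) (H : O -> O -> Type) (id : forall a, H a a).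
Variable cmp : forall a b c, H b c -> H a b -> H a c.

Record symdata := SymData {
  tob : O -> O -> O;
  thom : forall a b c d, H a b -> H c d -> H (tob a c) (tob b d);
  mone : O;
  asc : forall a b c, H (tob (tob a b) c) (tob a (tob b c));
  asci : forall a b c, H (tob a (tob b c)) (tob (tob a b) c);
  lun : forall a, H (tob mone a) a;
  luni : forall a, H a (tob mone a);
  run : forall a, H (tob a mone) a;
  runi : forall a, H a (tob a mone);
  brd : forall a b, H (tob a b) (tob b a) }.

Variable M : symdata.
Local Notation "g ∘ f" := (cmp g f) (at level 40, left associativity).
Local Notation "a ⊗ b" := (tob M a b) (at level 38, left associativity).
Local Notation "f ⊗₁ g" := (thom M f g) (at level 38, left associativity).

Record symlaws : Prop := SymLaws {
  thom_id : forall a b, id a ⊗₁ id b = id (a ⊗ b);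
  thom_comp : forall a b c a' b' c'
    (g : H b c) (f : H a b) (g' : H b' c') (f' : H a' b'),
    (g ∘ f) ⊗₁ (g' ∘ f') = (g ⊗₁ g') ∘ (f ⊗₁ f');
  asc_nat : forall a b c a' b' c' (f : H a a') (g : H b b') (h : H c c'),
    asc M a' b' c' ∘ (f ⊗₁ g ⊗₁ h) = (f ⊗₁ (g ⊗₁ h)) ∘ asc M a b c;
  ascK : forall a b c, asci M a b c ∘ asc M a b c = id _;
  asciK : forall a b c, asc M a b c ∘ asci M a b c = id _;
  lun_nat : forall a b (f : H a b), lun M b ∘ (id _ ⊗₁ f) = f ∘ lun M a;
  lunK : forall a, luni M a ∘ lun M a = id _;
  luniK : forall a, lun M a ∘ luni M a = id _;
  run_nat : forall a b (f : H a b), run M b ∘ (f ⊗₁ id _) = f ∘ run M a;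
  runK : forall a, runi M a ∘ run M a = id _;
  runiK : forall a, run M a ∘ runi M a = id _;
  brd_nat : forall a b a' b' (f : H a a') (g : H b b'),
    brd M a' b' ∘ (f ⊗₁ g) = (g ⊗₁ f) ∘ brd M a b;
  brdK : forall a b, brd M b a ∘ brd M a b = id _;
  pentagon : forall a b c d,
    asc M a b (c ⊗ d) ∘ asc M (a ⊗ b) c d =
    (id a ⊗₁ asc M b c d) ∘ asc M a (b ⊗ c) d ∘ (asc M a b c ⊗₁ id d);
  triangle : forall a b,
    (id a ⊗₁ lun M b) ∘ asc M a (mone M) b = run M a ⊗₁ id b;
  hexagon : forall a b c,
    asc M b c a ∘ brd M a (b ⊗ c) ∘ asc M a b c =
    (id b ⊗₁ brd M a c) ∘ asc M b a c ∘ (brd M a b ⊗₁ id c) }.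
End SymmetricMonoidal.

Record linsmc (k : fieldType) := LinSMC {
  lob :> Type;
  lhom : lob -> lob -> lmodType k;
  lid : forall a, lhom a a;
  lcomp : forall a b c, lhom b c -> lhom a b -> lhom a c;
  llaws : cat_laws lid lcomp;
  lcomp_linl : forall a b c (f : lhom a b), linear (fun g : lhom b c => lcomp g f);
  lcomp_linr : forall a b c (g : lhom b c), linear (fun f : lhom a b => lcomp g f);
  ldata : symdata lhom;
  lsym : symlaws lid lcomp ldata;
  lthom_linl : forall a b c d (g : lhom c d),
    linear (fun f : lhom a b => thom ldata f g);
  lthom_linr : forall a b c d (f : lhom a b),
    linear (fun g : lhom c d => thom ldata f g) }.
Arguments lid {_ _} _.
Arguments lcomp {_ _ _ _ _} _ _.
Arguments lhom {_ _} _ _.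

Notation "g ∘ f" := (lcomp g f) (at level 40, left associativity).
Notation "a ⊗ b" := (tob (ldata _) a b) (at level 38, left associativity).
Notation "f ⊗₁ g" := (thom (ldata _) f g) (at level 38, left associativity).
Notation "'𝟙'" := (mone (ldata _)).
Notation α := (asc (ldata _)).
Notation αi := (asci (ldata _)).
Notation λl := (lun (ldata _)).
Notation λi := (luni (ldata _)).
Notation ρr := (run (ldata _)).
Notation ρi := (runi (ldata _)).
Notation β := (brd (ldata _)).

Definition cat_of (k : fieldType) (C : linsmc k) : category := Category (llaws C).

Section LinTheory.
Variables (k : fieldType) (C : linsmc k).
Implicit Types a b c d : C.

Lemma compA a b c d (h : lhom c d) (g : lhom b c) (f : lhom a b) :
  h ∘ (g ∘ f) = h ∘ g ∘ f.
Proof. exact: (cl_assoc (llaws C)). Qed.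
Lemma comp1m a b (f : lhom a b) : lid b ∘ f = f.
Proof. exact: (cl_idl (llaws C)). Qed.
Lemma compm1 a b (f : lhom a b) : f ∘ lid a = f.
Proof. exact: (cl_idr (llaws C)). Qed.
Lemma tens1 a b : lid a ⊗₁ lid b = lid (a ⊗ b).
Proof. exact: (thom_id (lsym C)). Qed.
Lemma tensM a b c a' b' c'
    (g : lhom b c) (f : lhom a b) (g' : lhom b' c') (f' : lhom a' b') :
  (g ∘ f) ⊗₁ (g' ∘ f') = (g ⊗₁ g') ∘ (f ⊗₁ f').
Proof. exact: (thom_comp (lsym C)). Qed.

Lemma comp0m a b c (f : lhom a b) : (0 : lhom b c) ∘ f = 0.
Proof.
by have := lcomp_linl f (-1) (0 : lhom b c) 0; rewrite scaler0 addr0 scaleN1r addNr.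
Qed.
Lemma compm0 a b c (f : lhom b c) : f ∘ (0 : lhom a b) = 0.
Proof.
by have := lcomp_linr f (-1) (0 : lhom a b) 0; rewrite scaler0 addr0 scaleN1r addNr.
Qed.
Lemma tens0m a b c d (f : lhom a b) : (0 : lhom c d) ⊗₁ f = 0.
Proof.
by have := lthom_linl f (-1) (0 : lhom c d) 0; rewrite scaler0 addr0 scaleN1r addNr.
Qed.
Lemma tensm0 a b c d (f : lhom a b) : f ⊗₁ (0 : lhom c d) = 0.
Proof.
by have := lthom_linr f (-1) (0 : lhom c d) 0; rewrite scaler0 addr0 scaleN1r addNr.
Qed.
Lemma compDl a b c (f : lhom a b) (g h : lhom b c) : (g + h) ∘ f = g ∘ f + h ∘ f.
Proof. by have := lcomp_linl f 1 g h; rewrite !scale1r. Qed.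
Lemma compDr a b c (f : lhom b c) (g h : lhom a b) : f ∘ (g + h) = f ∘ g + f ∘ h.
Proof. by have := lcomp_linr f 1 g h; rewrite !scale1r. Qed.
Lemma tensDl a b c d (f : lhom a b) (g h : lhom c d) :
  (g + h) ⊗₁ f = g ⊗₁ f + h ⊗₁ f.
Proof. by have := lthom_linl f 1 g h; rewrite !scale1r. Qed.
Lemma tensDr a b c d (f : lhom a b) (g h : lhom c d) :
  f ⊗₁ (g + h) = f ⊗₁ g + f ⊗₁ h.
Proof. by have := lthom_linr f 1 g h; rewrite !scale1r. Qed.
Lemma compZl a b c (f : lhom a b) x (g : lhom b c) : (x *: g) ∘ f = x *: (g ∘ f).
Proof. by have := lcomp_linl f x g 0; rewrite !addr0 comp0m addr0. Qed.
Lemma compZr a b c (f : lhom b c) x (g : lhom a b) : f ∘ (x *: g) = x *: (f ∘ g).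
Proof. by have := lcomp_linr f x g 0; rewrite !addr0 compm0 addr0. Qed.
Lemma tensZl a b c d (f : lhom a b) x (g : lhom c d) :
  (x *: g) ⊗₁ f = x *: (g ⊗₁ f).
Proof. by have := lthom_linl f x g 0; rewrite !addr0 tens0m addr0. Qed.
Lemma tensZr a b c d (f : lhom a b) x (g : lhom c d) :
  f ⊗₁ (x *: g) = x *: (f ⊗₁ g).
Proof. by have := lthom_linr f x g 0; rewrite !addr0 tensm0 addr0. Qed.
Lemma compNl a b c (f : lhom a b) (g : lhom b c) : (- g) ∘ f = - (g ∘ f).
Proof. by rewrite -scaleN1r compZl scaleN1r. Qed.
Lemma compNr a b c (f : lhom b c) (g : lhom a b) : f ∘ (- g) = - (f ∘ g).
Proof. by rewrite -scaleN1r compZr scaleN1r. Qed.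
Lemma tensNl a b c d (f : lhom a b) (g : lhom c d) : (- g) ⊗₁ f = - (g ⊗₁ f).
Proof. by rewrite -scaleN1r tensZl scaleN1r. Qed.
Lemma tensNr a b c d (f : lhom a b) (g : lhom c d) : f ⊗₁ (- g) = - (f ⊗₁ g).
Proof. by rewrite -scaleN1r tensZr scaleN1r. Qed.
Lemma comp_suml a b c (I : finType) (P : pred I) (F : I -> lhom b c) (f : lhom a b) :
  (\sum_(i | P i) F i) ∘ f = \sum_(i | P i) F i ∘ f.
Proof. by apply: (big_morph (fun g => g ∘ f)) => [g h|]; rewrite ?compDl ?comp0m. Qed.
Lemma comp_sumr a b c (I : finType) (P : pred I) (F : I -> lhom a b) (f : lhom b c) :
  f ∘ (\sum_(i | P i) F i) = \sum_(i | P i) f ∘ F i.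
Proof. by apply: (big_morph (fun g => f ∘ g)) => [g h|]; rewrite ?compDr ?compm0. Qed.
Lemma tens_suml a b c d (I : finType) (P : pred I) (F : I -> lhom c d) (f : lhom a b) :
  (\sum_(i | P i) F i) ⊗₁ f = \sum_(i | P i) F i ⊗₁ f.
Proof. by apply: (big_morph (fun g => g ⊗₁ f)) => [g h|]; rewrite ?tensDl ?tens0m. Qed.
Lemma tens_sumr a b c d (I : finType) (P : pred I) (F : I -> lhom c d) (f : lhom a b) :
  f ⊗₁ (\sum_(i | P i) F i) = \sum_(i | P i) f ⊗₁ F i.
Proof. by apply: (big_morph (fun g => f ⊗₁ g)) => [g h|]; rewrite ?tensDr ?tensm0. Qed.

Definition liso a b (f : lhom a b) : Prop :=
  exists g : lhom b a, g ∘ f = lid a /\ f ∘ g = lid b.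

Lemma liso_comp a b c (g : lhom b c) (f : lhom a b) :
  liso g -> liso f -> liso (g ∘ f).
Proof.
move=> [g' [g1 g2]] [f' [f1 f2]]; exists (f' ∘ g'); split.
  by rewrite compA -(compA f') g1 compm1.
by rewrite compA -(compA g) f2 compm1.
Qed.
Lemma liso_id a : liso (lid a).
Proof. by exists (lid a); rewrite compm1. Qed.
Lemma liso_tens a b c d (f : lhom a b) (g : lhom c d) :
  liso f -> liso g -> liso (f ⊗₁ g).
Proof.
move=> [f' [f1 f2]] [g' [g1 g2]]; exists (f' ⊗₁ g').
by rewrite -!tensM f1 f2 g1 g2 !tens1.
Qed.

Definition is_zero_ob a : Prop :=
  (forall b (f : lhom a b), f = 0) /\ (forall b (f : lhom b a), f = 0).

Definition is_biproduct a b c : Prop :=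
  exists (i1 : lhom a c) (i2 : lhom b c) (p1 : lhom c a) (p2 : lhom c b),
  [/\ p1 ∘ i1 = lid a, p2 ∘ i2 = lid b, p1 ∘ i2 = 0, p2 ∘ i1 = 0
    & i1 ∘ p1 + i2 ∘ p2 = lid c].

Definition is_splitting a (e : lhom a a) b : Prop :=
  exists (i : lhom b a) (p : lhom a b), p ∘ i = lid b /\ i ∘ p = e.

Definition is_retract a b : Prop :=
  exists (i : lhom a b) (p : lhom b a), p ∘ i = lid a.

Definition cauchy_complete : Prop :=
  [/\ exists z, is_zero_ob z,
      forall a b, exists c, is_biproduct a b c
    & forall a (e : lhom a a), e ∘ e = e -> exists b, is_splitting e b].
End LinTheory.
Arguments is_zero_ob {k C} a.

Record two_rig (k : fieldType) := TwoRig {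
  two_rig_smc :> linsmc k;
  two_rigP : cauchy_complete two_rig_smc }.

Section ExteriorPower.
Variables (k : fieldType) (C : linsmc k).

Fixpoint tpow (y : C) (m : nat) : C :=
  if m is m'.+1 then y ⊗ tpow y m' else 𝟙.

Definition swap12 (y z : C) : lhom (y ⊗ (y ⊗ z)) (y ⊗ (y ⊗ z)) :=
  α y y z ∘ (β y y ⊗₁ lid z) ∘ αi y y z.

(* Moves the first tensor factor to position j (counted from 0), keeping the
   order of the other ones. *)
Fixpoint tmove (y : C) (m j : nat) : lhom (tpow y m.+1) (tpow y m.+1) :=
  match m, j with
  | m'.+1, j'.+1 => (lid y ⊗₁ tmove y m' j') ∘ swap12 y (tpow y m')
  | _, _ => lid _
  end.
End ExteriorPower.

(* The permutation of the last m indices, read in 'I_m, that remains of s after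
   deleting 0 from its domain and s 0 from its codomain. *)
Section PermTail.
Variables (m : nat) (s : 'S_m.+1).

Definition perm_tail_fun (i : 'I_m) : 'I_m :=
  odflt i (unlift (s ord0) (s (lift ord0 i))).

Lemma perm_tail_lift i : lift (s ord0) (perm_tail_fun i) = s (lift ord0 i).
Proof.
rewrite /perm_tail_fun; case: unliftP => [j -> //|/perm_inj].
by move/eqP; rewrite eq_sym (negbTE (neq_lift _ _)).
Qed.

Lemma perm_tail_inj : injective perm_tail_fun.
Proof.
move=> i j e; apply: (@lift_inj _ ord0); apply: (@perm_inj _ s).
by rewrite -!perm_tail_lift e.
Qed.

Definition perm_tail : 'S_m := perm perm_tail_inj.
End PermTail.

Section ExteriorPower2.
Variables (k : fieldType) (C : linsmc k).

(* The action of s on y^m: the i-th tensor factor is moved to position s i. *)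
Fixpoint tperm_act (y : C) (m : nat) : 'S_m -> lhom (tpow y m) (tpow y m) :=
  match m return 'S_m -> lhom (tpow y m) (tpow y m) with
  | 0 => fun _ => lid _
  | m'.+1 => fun s => tmove y m' (s ord0) ∘ (lid y ⊗₁ tperm_act y (perm_tail s))
  end.

Definition antisym (y : C) (m : nat) : lhom (tpow y m) (tpow y m) :=
  (m`!%:R)^-1 *: \sum_(s : 'S_m) (-1) ^+ s *: tperm_act y s.

(* Exterior powers are determined up to isomorphism only, so that they are given
   by a predicate: L is the object of some splitting of the antisymmetrizer. *)
Definition is_ext_power (m : nat) (y L : C) : Prop := is_splitting (antisym y m) L.

Definition subdim (n : nat) (y : C) : Prop :=
  exists L, is_ext_power n.+1 y L /\ is_zero_ob L.
End ExteriorPower2.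

Section SMFunctors.
Variable k : fieldType.

(* For 2-rigs C and D these are the maps of 2-rigs: biproducts and splittings of
   idempotents are preserved by every k-linear functor. *)
Record smfunctor (C D : linsmc k) := SMFunctor {
  sob :> C -> D;
  smap : forall a b, lhom a b -> lhom (sob a) (sob b);
  smap_id : forall a, smap (lid a) = lid (sob a);
  smap_comp : forall a b c (g : lhom b c) (f : lhom a b),
    smap (g ∘ f) = smap g ∘ smap f;
  smap_lin : forall a b, linear (@smap a b);
  smu : forall a b, lhom (sob a ⊗ sob b) (sob (a ⊗ b));
  seps : lhom 𝟙 (sob 𝟙);
  smu_iso : forall a b, liso (smu a b);
  seps_iso : liso seps;
  smu_nat : forall a b a' b' (f : lhom a a') (g : lhom b b'),
    smu a' b' ∘ (smap f ⊗₁ smap g) = smap (f ⊗₁ g) ∘ smu a b;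
  smu_asc : forall a b c,
    smap (α a b c) ∘ smu (a ⊗ b) c ∘ (smu a b ⊗₁ lid (sob c)) =
    smu a (b ⊗ c) ∘ (lid (sob a) ⊗₁ smu b c) ∘ α (sob a) (sob b) (sob c);
  smu_lun : forall a,
    smap (λl a) ∘ smu 𝟙 a ∘ (seps ⊗₁ lid (sob a)) = λl (sob a);
  smu_run : forall a,
    smap (ρr a) ∘ smu a 𝟙 ∘ (lid (sob a) ⊗₁ seps) = ρr (sob a);
  smu_brd : forall a b, smap (β a b) ∘ smu a b = smu b a ∘ β (sob a) (sob b) }.

Record monnat (C D : linsmc k) (F G : smfunctor C D) := MonNat {
  mcomp :> forall a, lhom (F a) (G a);
  mcomp_nat : forall a b (f : lhom a b), mcomp b ∘ smap F f = smap G f ∘ mcomp a;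
  mcomp_mu : forall a b,
    mcomp (a ⊗ b) ∘ smu F a b = smu G a b ∘ (mcomp a ⊗₁ mcomp b);
  mcomp_eps : mcomp 𝟙 ∘ seps F = seps G }.

Lemma monnat_eq (C D : linsmc k) (F G : smfunctor C D) (s t : monnat F G) :
  (forall a, s a = t a) -> s = t.
Proof.
case: s t => [s s1 s2 s3] [t t1 t2 t3] /= E.
have {E} E : s = t by apply: functional_extensionality_dep.
subst t.
by rewrite (Prop_irrelevance s1 t1) (Prop_irrelevance s2 t2) (Prop_irrelevance s3 t3).
Qed.

Section HomCategory.
Variables C D : linsmc k.

Definition monnat_id (F : smfunctor C D) : monnat F F.
Proof.
exists (fun a => lid (F a)).
- by move=> a b f; rewrite comp1m compm1.
- by move=> a b; rewrite comp1m tens1 compm1.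
- by rewrite comp1m.
Defined.

Definition monnat_comp (F G H : smfunctor C D) (t : monnat G H) (s : monnat F G) :
  monnat F H.
Proof.
exists (fun a => t a ∘ s a).
- by move=> a b f; rewrite -compA mcomp_nat !compA mcomp_nat.
- by move=> a b; rewrite tensM -compA mcomp_mu !compA mcomp_mu.
- by rewrite -compA !mcomp_eps.
Defined.

Lemma smcat_laws : cat_laws monnat_id monnat_comp.
Proof.
split=> [F G H K h g f|F G f|F G f]; apply: monnat_eq => a /=.
- exact: compA.
- exact: comp1m.
- exact: compm1.
Qed.

(* The hom-category of symmetric monoidal k-linear functors; for 2-rigs C and D
   it is the hom-category 2-Rig(C, D). *)
Definition smcat : category := Category smcat_laws.
End HomCategory.

Definition smcomp (C D E : linsmc k) (G : smfunctor D E) (F : smfunctor C D) :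
  smfunctor C E.
Proof.
refine (@SMFunctor C E (fun a => G (F a)) (fun _ _ f => smap G (smap F f))
  _ _ _ (fun a b => smap G (smu F a b) ∘ smu G (F a) (F b))
  (smap G (seps F) ∘ seps G) _ _ _ _ _ _ _).
- by move=> a; rewrite !smap_id.
- by move=> a b c g f; rewrite !smap_comp.
- by move=> a b x f g; rewrite !smap_lin.
- move=> a b; apply: liso_comp; last exact: smu_iso.
  have [f [f1 f2]] := smu_iso F a b.
  by exists (smap G f); rewrite -!smap_comp f1 f2 !smap_id.
- apply: liso_comp; last exact: seps_iso.
  have [f [f1 f2]] := seps_iso F.
  by exists (smap G f); rewrite -!smap_comp f1 f2 !smap_id.
- move=> a b a' b' f g.
  by rewrite -compA smu_nat !compA -!smap_comp smu_nat.
- move=> a b c.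
  have eL : (smap G (smu F a b) ∘ smu G (F a) (F b)) ⊗₁ lid (G (F c)) =
      (smap G (smu F a b) ⊗₁ smap G (lid (F c))) ∘ (smu G (F a) (F b) ⊗₁ lid _).
    by rewrite -tensM smap_id comp1m.
  have eR : lid (G (F a)) ⊗₁ (smap G (smu F b c) ∘ smu G (F b) (F c)) =
      (smap G (lid (F a)) ⊗₁ smap G (smu F b c)) ∘ (lid _ ⊗₁ smu G (F b) (F c)).
    by rewrite -tensM smap_id comp1m.
  rewrite eL eR -!compA (compA (smu G _ _) (smap G _ ⊗₁ _)) smu_nat -!compA.
  rewrite (compA (smu G _ _) (smap G _ ⊗₁ _)) smu_nat -!compA.
  have h := smu_asc G (F a) (F b) (F c); rewrite -!compA in h; rewrite -h {h}.
  by rewrite !compA -!smap_comp smu_asc.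
- move=> a.
  rewrite -[lid (G (F a))](comp1m (lid _)) tensM.
  rewrite -{1}(smap_id G) -!compA (compA (smu G _ _) (smap G _ ⊗₁ _)) smu_nat.
  by rewrite !compA -!smap_comp smu_lun smu_lun.
- move=> a.
  rewrite -[lid (G (F a))](comp1m (lid _)) tensM.
  rewrite -{1}(smap_id G) -!compA (compA (smu G _ _) (_ ⊗₁ smap G _)) smu_nat.
  by rewrite !compA -!smap_comp smu_run smu_run.
- by move=> a b; rewrite compA -smap_comp smu_brd smap_comp -!compA smu_brd.
Defined.

Definition whisker_post (C D E : linsmc k) (G : smfunctor D E)
  (F F' : smfunctor C D) (s : monnat F F') : monnat (smcomp G F) (smcomp G F').
Proof.
exists (fun a => smap G (s a)).
- by move=> a b f /=; rewrite -!smap_comp mcomp_nat.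
- move=> a b /=.
  by rewrite !compA -smap_comp mcomp_mu smap_comp -!compA smu_nat.
- by rewrite /= compA -smap_comp mcomp_eps.
Defined.

Definition whisker_pre (C D E : linsmc k) (G G' : smfunctor D E)
  (s : monnat G G') (F : smfunctor C D) : monnat (smcomp G F) (smcomp G' F).
Proof.
exists (fun a => s (F a)).
- by move=> a b f /=; rewrite mcomp_nat.
- by move=> a b /=; rewrite compA mcomp_nat -!compA mcomp_mu.
- by rewrite /= compA mcomp_nat -compA mcomp_eps.
Defined.

Lemma smap0 (C D : linsmc k) (F : smfunctor C D) a b : smap F (0 : lhom a b) = 0.
Proof.
by have := smap_lin F (-1) (0 : lhom a b) 0; rewrite scaler0 addr0 scaleN1r addNr.
Qed.
Lemma smapD (C D : linsmc k) (F : smfunctor C D) a b (f g : lhom a b) :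
  smap F (f + g) = smap F f + smap F g.
Proof. by have := smap_lin F 1 f g; rewrite !scale1r. Qed.
Lemma smapZ (C D : linsmc k) (F : smfunctor C D) a b x (f : lhom a b) :
  smap F (x *: f) = x *: smap F f.
Proof. by have := smap_lin F x f 0; rewrite !addr0 smap0 addr0. Qed.
Lemma smap_sum (C D : linsmc k) (F : smfunctor C D) a b (I : finType)
    (f : I -> lhom a b) : smap F (\sum_i f i) = \sum_i smap F (f i).
Proof. by apply: (big_morph (fun g => smap F g)) => [g h|]; rewrite ?smapD ?smap0. Qed.

(* Symmetric monoidal k-linear functors preserve exterior powers, hence objects
   of subdimension n. *)
Section Preservation.
Variables (C D : linsmc k) (F : smfunctor C D).

Fixpoint tpow_cmp (y : C) (m : nat) : lhom (tpow (F y) m) (F (tpow y m)) :=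
  match m with
  | 0 => seps F
  | m'.+1 => smu F y (tpow y m') ∘ (lid (F y) ⊗₁ tpow_cmp y m')
  end.

Lemma tpow_cmp_iso y m : liso (tpow_cmp y m).
Proof.
elim: m => [|m IH] /=; first exact: seps_iso.
by apply: liso_comp; [exact: smu_iso | apply: liso_tens => //; exact: liso_id].
Qed.

Lemma smap_tensr (y : C) a b (f : lhom a b) :
  smap F (lid y ⊗₁ f) ∘ smu F y a = smu F y b ∘ (lid (F y) ⊗₁ smap F f).
Proof. by rewrite -smu_nat smap_id. Qed.

Lemma tens_comp1 (y : D) a b c (g : lhom b c) (f : lhom a b) :
  lid y ⊗₁ (g ∘ f) = (lid y ⊗₁ g) ∘ (lid y ⊗₁ f).
Proof. by rewrite -tensM comp1m. Qed.

Lemma asci_nat a b c a' b' c' (f : lhom a a') (g : lhom b b') (h : lhom (c : D) c') :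
  αi a' b' c' ∘ (f ⊗₁ (g ⊗₁ h)) = (f ⊗₁ g ⊗₁ h) ∘ αi a b c.
Proof.
rewrite -[RHS]comp1m -(ascK (lsym D)) -!compA; congr (_ ∘ _).
by rewrite !compA (asc_nat (lsym D)) -!compA (asciK (lsym D)) compm1.
Qed.

Lemma swap12_nat (y : D) a b (f : lhom a b) :
  swap12 y b ∘ (lid y ⊗₁ (lid y ⊗₁ f)) = (lid y ⊗₁ (lid y ⊗₁ f)) ∘ swap12 y a.
Proof.
rewrite /swap12 -compA asci_nat tens1 !compA -(asc_nat (lsym D)) tens1 -!compA.
by congr (_ ∘ _); rewrite !compA -!tensM !comp1m !compm1.
Qed.

Let cmp3 (y z : C) : lhom (F y ⊗ (F y ⊗ F z)) (F (y ⊗ (y ⊗ z))) :=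
  smu F y (y ⊗ z) ∘ (lid (F y) ⊗₁ smu F y z).

Lemma smap_swap12 (y z : C) :
  smap F (swap12 y z) ∘ cmp3 y z = cmp3 y z ∘ swap12 (F y) (F z).
Proof.
have h1 : smap F (αi y y z) ∘ cmp3 y z =
    smu F (y ⊗ y) z ∘ (smu F y y ⊗₁ lid (F z)) ∘ αi _ _ _.
  rewrite -[LHS]compm1 -(asciK (lsym D)) !compA; congr (_ ∘ _).
  rewrite /cmp3 -!compA (compA (smu _ _ _)) -smu_asc !compA -smap_comp.
  by rewrite (ascK (lsym C)) smap_id comp1m.
rewrite /swap12 !smap_comp -!compA h1 /cmp3 -smap_id.
rewrite !compA -smu_asc -!compA; congr (_ ∘ _).
rewrite !compA -smu_nat smap_id -!compA; congr (_ ∘ _).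
by rewrite !compA -!tensM smu_brd.
Qed.

Lemma smap_tmove (y : C) m j :
  smap F (tmove y m j) ∘ tpow_cmp y m.+1 = tpow_cmp y m.+1 ∘ tmove (F y) m j.
Proof.
have tmoveS (E : linsmc k) (z : E) m' j' : tmove z m'.+1 j'.+1 =
    (lid z ⊗₁ tmove z m' j') ∘ swap12 z (tpow z m') by [].
have cmpS m' : tpow_cmp y m'.+1 = smu F y (tpow y m') ∘ (lid (F y) ⊗₁ tpow_cmp y m').
  by [].
have tmove0 (E : linsmc k) (z : E) m' : tmove z m' 0 = lid _ by case: m'.
have tmove_0 (E : linsmc k) (z : E) j' : tmove z 0 j' = lid _ by [].
elim: m j => [|m IH] j; first by rewrite !tmove_0 smap_id comp1m compm1.
case: j => [|j]; first by rewrite !tmove0 smap_id comp1m compm1.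
rewrite !tmoveS.
have e : tpow_cmp y m.+2 = cmp3 y (tpow y m) ∘ (lid _ ⊗₁ (lid _ ⊗₁ tpow_cmp y m)).
  by rewrite /cmp3 -compA -tens_comp1.
rewrite smap_comp -compA {1}e (compA (smap F (swap12 _ _))) smap_swap12.
rewrite -(compA (cmp3 _ _)) swap12_nat (compA (cmp3 _ _)) -e.
rewrite compA [RHS]compA; congr (_ ∘ _).
rewrite (cmpS m.+1) compA smap_tensr -!compA; congr (_ ∘ _).
by rewrite -!tens_comp1 IH.
Qed.

Lemma smap_tperm (y : C) m (s : 'S_m) :
  smap F (tperm_act y s) ∘ tpow_cmp y m = tpow_cmp y m ∘ tperm_act (F y) s.
Proof.
elim: m s => [|m IH] s /=; first by rewrite smap_id comp1m compm1.
rewrite !compA -[smu _ _ _ ∘ _]/(tpow_cmp y m.+1) -smap_tmove smap_comp -!compA.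
by congr (_ ∘ _); rewrite !compA smap_tensr -!compA -!tens_comp1 IH.
Qed.

Lemma smap_antisym (y : C) m :
  smap F (antisym y m) ∘ tpow_cmp y m = tpow_cmp y m ∘ antisym (F y) m.
Proof.
rewrite /antisym smapZ smap_sum compZl compZr comp_suml comp_sumr; congr (_ *: _).
by apply: eq_bigr => s _; rewrite smapZ compZl compZr smap_tperm.
Qed.

Lemma smap_ext_power m (y L : C) : is_ext_power m y L -> is_ext_power m (F y) (F L).
Proof.
move=> [i [p [pi ip]]]; have [c [c1 c2]] := tpow_cmp_iso y m.
exists (c ∘ smap F i), (smap F p ∘ tpow_cmp y m); split.
  by rewrite compA -(compA (smap F p)) c2 compm1 -smap_comp pi smap_id.
rewrite compA -(compA c) -smap_comp ip -compA smap_antisym compA c1.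
by rewrite comp1m.
Qed.

Lemma smap_zero_ob (z : C) : is_zero_ob z -> is_zero_ob (F z).
Proof.
move=> [z1 _]; have e : lid (F z) = 0 by rewrite -smap_id (z1 _ (lid z)) smap0.
split=> b f; first by rewrite -[f]compm1 e compm0.
by rewrite -[f]comp1m e comp0m.
Qed.

Lemma smap_subdim n (y : C) : subdim n y -> subdim n (F y).
Proof.
by move=> [L [hL zL]]; exists (F L); split; [exact: smap_ext_power | exact: smap_zero_ob].
Qed.
End Preservation.
End SMFunctors.

Section Subdim.
Variables (k : fieldType) (n : nat).

Definition Subdim (R : linsmc k) : category :=
  @fullsub (cat_of R) (fun y : R => subdim n y).

Definition Subdim_map (R R' : linsmc k) (G : smfunctor R R') :
    functor (Subdim R) (Subdim R') :=
  @Functor (Subdim R) (Subdim R')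
    (fun y => exist (fun y : R' => subdim n y) (G (sval y)) (smap_subdim G (svalP y)))
    (fun _ _ f => smap G f)
    (fun y => smap_id G (sval y))
    (fun _ _ _ g f => smap_comp G g f).

Definition Subdim_map2 (R R' : linsmc k) (G G' : smfunctor R R') (s : monnat G G') :
    nattrans (Subdim_map G) (Subdim_map G') :=
  @NatTrans _ _ (Subdim_map G) (Subdim_map G') (fun y => s (sval y))
    (fun _ _ f => mcomp_nat s f).

Definition postcomp (Q R R' : linsmc k) (G : smfunctor R R') :
  functor (smcat Q R) (smcat Q R').
Proof.
refine (@Functor (smcat Q R) (smcat Q R') (fun F => smcomp G F)
  (fun _ _ s => whisker_post G s) _ _).
- by move=> F; apply: monnat_eq => a /=; rewrite smap_id.
- by move=> F F' F'' t s; apply: monnat_eq => a /=; rewrite smap_comp.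
Defined.

Definition ev_subdim (Q : linsmc k) (x : Q) (hx : subdim n x) (R : linsmc k) :
    functor (smcat Q R) (Subdim R) :=
  @Functor (smcat Q R) (Subdim R)
    (fun F : smfunctor Q R => exist (fun y : R => subdim n y) (F x) (smap_subdim F hx))
    (fun _ _ s => mcomp s x)
    (fun _ => erefl)
    (fun _ _ _ _ _ => erefl).
End Subdim.

(* The free symmetric monoidal category on one object is realized as the groupoid
   of finite types and bijections under disjoint union, the generator being the
   one-point type. *)

Section FinBijections.

Definition bij_pred (A B : finType) (p : {ffun A -> B} * {ffun B -> A}) : bool :=
  [forall a, p.2 (p.1 a) == a] && [forall b, p.1 (p.2 b) == b].

Definition fbij (A B : finType) : finType := {p | @bij_pred A B p}.

Implicit Types A B C D : finType.

Definition fw A B (f : fbij A B) : A -> B := (sval f).1.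
Definition bw A B (f : fbij A B) : B -> A := (sval f).2.

Lemma fwK A B (f : fbij A B) : cancel (fw f) (bw f).
Proof. by move=> a; case/andP: (svalP f) => /forallP/(_ a)/eqP. Qed.
Lemma bwK A B (f : fbij A B) : cancel (bw f) (fw f).
Proof. by move=> a; case/andP: (svalP f) => _ /forallP/(_ a)/eqP. Qed.

Lemma fbij_eq A B (f g : fbij A B) : fw f =1 fw g -> f = g.
Proof.
move=> e; apply: val_inj; case: f g e (fwK f) (bwK f) (fwK g) (bwK g).
move=> [f f'] /= pf [[g g'] /= pg]; rewrite /fw /bw /= => e f1 f2 g1 g2.
congr pair; apply/ffunP => a //.
by rewrite -{1}[a]g2 -e f1.
Qed.

Lemma mk_fbij_subproof A B (f : A -> B) (g : B -> A) :
  cancel f g -> cancel g f -> bij_pred (finfun f, finfun g).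
Proof. by move=> fK gK; apply/andP; split; apply/forallP=> x; rewrite !ffunE ?fK ?gK. Qed.

Definition mk_fbij A B (f : A -> B) (g : B -> A) (fK : cancel f g) (gK : cancel g f) :
  fbij A B := exist _ (finfun f, finfun g) (mk_fbij_subproof fK gK).

Lemma mk_fbijE A B f g fK gK : fw (@mk_fbij A B f g fK gK) =1 f.
Proof. by move=> a; rewrite /fw /= ffunE. Qed.

Definition fbij_id A : fbij A A := @mk_fbij A A id id (fun _ => erefl) (fun _ => erefl).

Definition fbij_comp A B C (g : fbij B C) (f : fbij A B) : fbij A C :=
  mk_fbij (can_comp (fwK g) (fwK f)) (can_comp (bwK f) (bwK g)).

Lemma fbij_laws : cat_laws fbij_id fbij_comp.
Proof.
by split=> *; apply: fbij_eq => a; rewrite !mk_fbijE //= !mk_fbijE.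
Qed.

Definition sum_map (A B C D : Type) (f : A -> B) (g : C -> D) (s : A + C) : B + D :=
  match s with inl a => inl (f a) | inr c => inr (g c) end.

Lemma sum_mapK (A B C D : Type) (f : A -> B) (g : C -> D) f' g' :
  cancel f f' -> cancel g g' -> cancel (sum_map f g) (sum_map f' g').
Proof. by move=> fK gK [a|c] /=; rewrite ?fK ?gK. Qed.

Definition sumA (A B C : Type) (s : A + B + C) : A + (B + C) :=
  match s with inl (inl a) => inl a | inl (inr b) => inr (inl b) | inr c => inr (inr c) end.
Definition sumAi (A B C : Type) (s : A + (B + C)) : A + B + C :=
  match s with inl a => inl (inl a) | inr (inl b) => inl (inr b) | inr (inr c) => inr c end.
Definition sumC (A B : Type) (s : A + B) : B + A :=
  match s with inl a => inr a | inr b => inl b end.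
Definition sum0l (A : Type) (s : void + A) : A :=
  match s with inl v => match v with end | inr a => a end.
Definition sum0r (A : Type) (s : A + void) : A :=
  match s with inr v => match v with end | inl a => a end.

Lemma sumAK A B C : cancel (@sumA A B C) (@sumAi A B C).
Proof. by case=> [[]|]. Qed.
Lemma sumAiK A B C : cancel (@sumAi A B C) (@sumA A B C).
Proof. by case=> [|[]]. Qed.
Lemma sumCK A B : cancel (@sumC A B) (@sumC B A).
Proof. by case. Qed.
Lemma sum0lK A : cancel (@sum0l A) inr.
Proof. by case=> [[]|]. Qed.
Lemma sum0rK A : cancel (@sum0r A) inl.
Proof. by case=> [|[]]. Qed.

Definition fsum A B : finType := (A + B)%type.
Definition fvoid : finType := void.

Definition fbij_data : symdata fbij := {|
  tob := fsum;
  thom := fun A B C D f g => @mk_fbij (fsum A C) (fsum B D) _ _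
    (sum_mapK (fwK f) (fwK g)) (sum_mapK (bwK f) (bwK g));
  mone := fvoid;
  asc := fun A B C => @mk_fbij (fsum (fsum A B) C) (fsum A (fsum B C)) _ _
    (@sumAK A B C) (@sumAiK A B C);
  asci := fun A B C => @mk_fbij (fsum A (fsum B C)) (fsum (fsum A B) C) _ _
    (@sumAiK A B C) (@sumAK A B C);
  lun := fun A => @mk_fbij (fsum fvoid A) A _ inr (@sum0lK A) (fun _ => erefl);
  luni := fun A => @mk_fbij A (fsum fvoid A) inr _ (fun _ => erefl) (@sum0lK A);
  run := fun A => @mk_fbij (fsum A fvoid) A _ inl (@sum0rK A) (fun _ => erefl);
  runi := fun A => @mk_fbij A (fsum A fvoid) inl _ (fun _ => erefl) (@sum0rK A);
  brd := fun A B => @mk_fbij (fsum A B) (fsum B A) _ _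
    (@sumCK A B) (@sumCK B A) |}.

Lemma fbij_symlaws : symlaws fbij_id fbij_comp fbij_data.
Proof.
have E := mk_fbijE; split=> *; apply: fbij_eq => s.
all: rewrite /= ?E /= ?E /= ?E /= ?E /= ?E /=.
all: by [| case: s => [[[]|]|[|[]]] *; rewrite /= ?E /= ?E
  | case: s => [[[|]|]|] *; rewrite /= ?E /= ?E | case: s => [[|]|] *; rewrite /= ?E /= ?E
  | case: s => [|] *; rewrite /= ?E /= ?E | case: s => [|[|]] *; rewrite /= ?E /= ?E
  | case: s => [[]|] *; rewrite /= ?E /= ?E | case: s => [|[]] *; rewrite /= ?E /= ?E].
Qed.
End FinBijections.

Section FreeModule.
Variable k : fieldType.

Definition freemod (X : finType) : lmodType k := {ffun X -> k^o}.

Definition basis (X : finType) (x : X) : freemod X := [ffun y => (y == x)%:R].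

Definition bilin (X Y Z : finType) (h : X -> Y -> Z) (v : freemod X) (w : freemod Y) :
  freemod Z := \sum_x \sum_y (v x * w y) *: basis (h x y).

Variables X Y Z : finType.
Implicit Types (v : freemod X) (w : freemod Y) (h : X -> Y -> Z).

Lemma free_sum v : v = \sum_x (v x : k) *: basis x.
Proof.
apply/ffunP => y; rewrite sum_ffunE (bigD1 y) //= big1 => [|x xy].
  by rewrite !ffunE eqxx addr0 [_ *: _]mulr1.
by rewrite !ffunE eq_sym (negbTE xy) [_ *: _]mulr0.
Qed.

Lemma free_ind (P : freemod X -> Prop) : P 0 -> (forall x, P (basis x)) ->
  (forall c v u, P v -> P u -> P (c *: v + u)) -> forall v, P v.
Proof.
move=> P0 Pb Pl v; rewrite (free_sum v).
by elim/big_rec: _ => // x u _; apply: Pl.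
Qed.

Lemma bilin_linl h w : linear (fun v => bilin h v w).
Proof.
move=> c u v; rewrite /bilin scaler_sumr -big_split; apply: eq_bigr => x _ /=.
rewrite scaler_sumr -big_split; apply: eq_bigr => y _ /=.
by rewrite !ffunE scalerA -scalerDl mulrDl mulrA.
Qed.

Lemma bilin_linr h v : linear (fun w => bilin h v w).
Proof.
move=> c u w; rewrite /bilin scaler_sumr -big_split; apply: eq_bigr => x _ /=.
rewrite scaler_sumr -big_split; apply: eq_bigr => y _ /=.
by rewrite !ffunE scalerA -scalerDl mulrDr mulrCA.
Qed.

Lemma bilin0l h w : bilin h 0 w = 0.
Proof. by rewrite /bilin big1 // => x _; rewrite big1 // => y _; rewrite ffunE mul0r scale0r. Qed.
Lemma bilin0r h v : bilin h v 0 = 0.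
Proof. by rewrite /bilin big1 // => x _; rewrite big1 // => y _; rewrite ffunE mulr0 scale0r. Qed.

Lemma bilin_basis h x y : bilin h (basis x) (basis y) = basis (h x y).
Proof.
rewrite /bilin (bigD1 x) //= [X in _ + X]big1 => [|x' /negbTE x'x]; last first.
  by rewrite big1 // => y' _; rewrite !ffunE x'x mul0r scale0r.
rewrite (bigD1 y) //= [X in _ + X + _]big1 => [|y' /negbTE y'y]; last first.
  by rewrite !ffunE y'y mulr0 scale0r.
by rewrite !ffunE !eqxx mulr1 scale1r !addr0.
Qed.
End FreeModule.

Ltac free_elim v :=
  elim/free_ind: v => [|v|? ? ? ? ?];
  [ by rewrite ?(bilin0l, bilin0r)
  | | rewrite ?(bilin_linl, bilin_linr); by congr (_ *: _ + _) ].

Section Linearization.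
Variables (k : fieldType) (O : Type) (H : O -> O -> finType).
Variables (id : forall a, H a a) (cmp : forall a b c, H b c -> H a b -> H a c).
Hypothesis laws : cat_laws id cmp.
Variable M : symdata H.
Hypothesis sym : symlaws id cmp M.

Definition lin_hom a b : lmodType k := freemod k (H a b).
Definition lin_id a : lin_hom a a := basis k (id a).
Definition lin_comp a b c (g : lin_hom b c) (f : lin_hom a b) : lin_hom a c :=
  bilin (@cmp a b c) g f.
Definition lin_data : symdata lin_hom := {|
  tob := tob M;
  thom := fun a b c d f g => bilin (thom M (a := a) (b := b) (c := c) (d := d)) f g;
  mone := mone M;
  asc := fun a b c => basis k (asc M a b c);
  asci := fun a b c => basis k (asci M a b c);
  lun := fun a => basis k (lun M a);
  luni := fun a => basis k (luni M a);
  run := fun a => basis k (run M a);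
  runi := fun a => basis k (runi M a);
  brd := fun a b => basis k (brd M a b) |}.

Lemma lin_laws : cat_laws lin_id lin_comp.
Proof.
case: laws => A L R; split; rewrite /lin_comp /lin_id.
- move=> a b c d h g f; free_elim f; free_elim g; free_elim h.
  by rewrite !bilin_basis A.
- by move=> a b f; free_elim f; rewrite bilin_basis L.
- by move=> a b f; free_elim f; rewrite bilin_basis R.
Qed.

Lemma lin_symlaws : symlaws lin_id lin_comp lin_data.
Proof.
case: sym => L1 L2 L3 L4 L5 L6 L7 L8 L9 L10 L11 L12 L13 L14 L15 L16.
split; rewrite /lin_comp /lin_id /=.
- by move=> *; rewrite !bilin_basis L1.
- move=> a b c a' b' c' g f g' f'; free_elim f; free_elim g; free_elim f'; free_elim g'.
  by rewrite !bilin_basis L2.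
- move=> a b c a' b' c' f g h; free_elim f; free_elim g; free_elim h.
  by rewrite !bilin_basis L3.
- by move=> *; rewrite !bilin_basis L4.
- by move=> *; rewrite !bilin_basis L5.
- by move=> a b f; free_elim f; rewrite !bilin_basis L6.
- by move=> *; rewrite !bilin_basis L7.
- by move=> *; rewrite !bilin_basis L8.
- by move=> a b f; free_elim f; rewrite !bilin_basis L9.
- by move=> *; rewrite !bilin_basis L10.
- by move=> *; rewrite !bilin_basis L11.
- move=> a b a' b' f g; free_elim f; free_elim g; by rewrite !bilin_basis L12.
- by move=> *; rewrite !bilin_basis L13.
- by move=> *; rewrite !bilin_basis L14.
- by move=> *; rewrite !bilin_basis L15.
- by move=> *; rewrite !bilin_basis L16.
Qed.

Definition linearization : linsmc k :=
  @LinSMC k O lin_hom lin_id lin_comp lin_laws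
    (fun _ _ _ f => bilin_linl _ f) (fun _ _ _ g => bilin_linr _ g)
    lin_data lin_symlaws
    (fun _ _ _ _ g => bilin_linl _ g) (fun _ _ _ _ f => bilin_linr _ f).
End Linearization.

Definition kS (k : fieldType) : linsmc k := linearization k fbij_laws fbij_symlaws.

Section DependentProduct.
Variables (k : fieldType) (I : finType) (V : I -> lmodType k).

Definition dprod : Type := {dffun forall i, V i}.
HB.instance Definition _ := Choice.on dprod.
Implicit Types f g : dprod.

Definition dprod_mk (F : forall i, V i) : dprod := finfun F.
Definition dprod_add f g : dprod := dprod_mk (fun i => f i + g i).
Definition dprod_zero : dprod := dprod_mk (fun i => 0).
Definition dprod_opp f : dprod := dprod_mk (fun i => - f i).
Definition dprod_scale (c : k) f : dprod := dprod_mk (fun i => c *: f i).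

Lemma dprod_mkE F i : dprod_mk F i = F i.
Proof. exact: ffunE. Qed.
Lemma dprodP f g : (forall i, f i = g i) -> f = g.
Proof. by move=> e; apply/ffunP. Qed.

Fact dprod_addA : associative dprod_add.
Proof. by move=> f g h; apply: dprodP => i; rewrite !dprod_mkE addrA. Qed.
Fact dprod_addC : commutative dprod_add.
Proof. by move=> f g; apply: dprodP => i; rewrite !dprod_mkE addrC. Qed.
Fact dprod_add0 : left_id dprod_zero dprod_add.
Proof. by move=> f; apply: dprodP => i; rewrite !dprod_mkE add0r. Qed.
Fact dprod_addN : left_inverse dprod_zero dprod_opp dprod_add.
Proof. by move=> f; apply: dprodP => i; rewrite !dprod_mkE addNr. Qed.
HB.instance Definition _ :=
  GRing.isZmodule.Build dprod dprod_addA dprod_addC dprod_add0 dprod_addN.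

Fact dprod_scaleA b c f : dprod_scale b (dprod_scale c f) = dprod_scale (b * c) f.
Proof. by apply: dprodP => i; rewrite !dprod_mkE scalerA. Qed.
Fact dprod_scale1 : left_id 1 dprod_scale.
Proof. by move=> f; apply: dprodP => i; rewrite !dprod_mkE scale1r. Qed.
Fact dprod_scaleDr : right_distributive dprod_scale +%R.
Proof. by move=> c f g; apply: dprodP => i; rewrite !dprod_mkE scalerDr. Qed.
Fact dprod_scaleDl f : {morph dprod_scale^~ f : b c / b + c}.
Proof. by move=> b c; apply: dprodP => i; rewrite !dprod_mkE scalerDl. Qed.
HB.instance Definition _ := GRing.Zmodule_isLmodule.Build k dprod
  dprod_scaleA dprod_scale1 dprod_scaleDr dprod_scaleDl.

Lemma dprodDE f g i : (f + g) i = f i + g i.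
Proof. exact: dprod_mkE. Qed.
Lemma dprodZE c f i : (c *: f) i = c *: f i.
Proof. exact: dprod_mkE. Qed.
Lemma dprod0E i : (0 : dprod) i = 0.
Proof. exact: dprod_mkE. Qed.
End DependentProduct.

(* The additive completion has finite families of objects as objects and matrices
   of morphisms as morphisms; the tensor product of families is indexed by pairs. *)

Section AdditiveCompletion.
Variables (k : fieldType) (C : linsmc k).

Record fam := Fam { idx : finType; fam_ob :> idx -> C }.
Implicit Types A B D E : fam.

Definition mat (A B : fam) : lmodType k :=
  dprod (fun p : idx A * idx B => lhom (A p.1) (B p.2)).
Arguments mat : simpl never.

Definition mat_mk (A B : fam) (F : forall i j, lhom (A i) (B j)) : mat A B :=
  dprod_mk (fun p => F p.1 p.2).
Definition ent (A B : fam) (f : mat A B) i j : lhom (A i) (B j) := f (i, j).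

Lemma mat_mkE A B F i j : ent (@mat_mk A B F) i j = F i j.
Proof. by rewrite /ent ffunE. Qed.
Lemma matP A B (f g : mat A B) : (forall i j, ent f i j = ent g i j) -> f = g.
Proof. by move=> e; apply: dprodP => -[i j]; apply: e. Qed.
Lemma ent_lin A B (f g : mat A B) c i j : ent (c *: f + g) i j = c *: ent f i j + ent g i j.
Proof. by rewrite /ent dprodDE dprodZE. Qed.

Definition mat_comp (A B D : fam) (g : mat B D) (f : mat A B) : mat A D :=
  mat_mk (fun i l => \sum_j ent g j l ∘ ent f i j).

(* The monomial matrix whose row j has the single entry s j, in column phi j *)
Definition mono (A B : fam) (phi : idx B -> idx A)
    (s : forall j, lhom (A (phi j)) (B j)) : mat A B :=
  mat_mk (fun i j =>
    match phi j =P i with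
    | ReflectT e => match e in _ = i return lhom (A i) (B j) with erefl => s j end
    | ReflectF _ => 0
    end).

Definition mat_id (A : fam) : mat A A := mono (fun i => lid (A i)).

Lemma mono_hit A B phi s j : ent (@mono A B phi s) (phi j) j = s j.
Proof. by rewrite mat_mkE; case: eqP => // e; rewrite (eq_axiomK e). Qed.
Lemma mono_miss A B phi s i j : phi j != i -> ent (@mono A B phi s) i j = 0.
Proof. by rewrite mat_mkE; case: eqP. Qed.

Lemma mono_compl A B D phi s (f : mat D A) i j :
  ent (mat_comp (@mono A B phi s) f) i j = s j ∘ ent f i (phi j).
Proof.
rewrite mat_mkE (bigD1 (phi j)) //= mono_hit big1 ?addr0 // => l ne.
by rewrite mono_miss ?comp0m // eq_sym.
Qed.
Lemma mono_compr A B D phi s (f : mat B D) j l : injective phi ->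
  ent (mat_comp f (@mono A B phi s)) (phi j) l = ent f j l ∘ s j.
Proof.
move=> inj; rewrite mat_mkE (bigD1 j) //= mono_hit big1 ?addr0 // => j' ne.
by rewrite mono_miss ?compm0 // (inj_eq inj).
Qed.

Lemma mono_eq A B phi s psi t :
  (forall j, existT (fun i => lhom (A i) (B j)) (phi j) (s j)
             = existT (fun i => lhom (A i) (B j)) (psi j) (t j)) ->
  @mono A B phi s = @mono A B psi t.
Proof.
move=> e; apply: matP => i j; rewrite !mat_mkE.
pose G (u : {i : idx A & lhom (A i) (B j)}) : lhom (A i) (B j) :=
  match tag u =P i with
  | ReflectT e => match e in _ = i return lhom (A i) (B j) with erefl => tagged u end
  | ReflectF _ => 0
  end.
exact: (congr1 G (e j)).
Qed.

Lemma mat_laws : cat_laws mat_id mat_comp.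
Proof.
split=> [A B D E h g f|A B f|A B f]; apply: matP => i j.
- rewrite !mat_mkE.
  under eq_bigr do rewrite mat_mkE comp_sumr.
  under [RHS]eq_bigr do rewrite mat_mkE comp_suml.
  rewrite exchange_big /=; apply: eq_bigr => l _; apply: eq_bigr => l' _.
  by rewrite compA.
- by rewrite mono_compl comp1m.
- by rewrite (@mono_compr _ _ _ id) // compm1.
Qed.

Lemma mat_comp_linl A B D (f : mat A B) : linear (fun g : mat B D => mat_comp g f).
Proof.
move=> c g h; apply: matP => i j; rewrite ent_lin !mat_mkE scaler_sumr -big_split.
by apply: eq_bigr => l _; rewrite ent_lin /= compDl compZl.
Qed.
Lemma mat_comp_linr A B D (g : mat B D) : linear (fun f : mat A B => mat_comp g f).
Proof.
move=> c f h; apply: matP => i j; rewrite ent_lin !mat_mkE scaler_sumr -big_split.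
by apply: eq_bigr => l _; rewrite ent_lin /= compDr compZr.
Qed.

Definition fprod (I J : finType) : finType := (I * J)%type.
Definition funit : finType := unit.

Definition mat_tob (A B : fam) : fam :=
  @Fam (fprod (idx A) (idx B)) (fun p => A p.1 ⊗ B p.2).
Definition mat_thom (A B D E : fam) (f : mat A B) (g : mat D E) :
    mat (mat_tob A D) (mat_tob B E) :=
  @mat_mk (mat_tob A D) (mat_tob B E)
    (fun i j => ent f i.1 j.1 ⊗₁ ent g i.2 j.2).
Lemma mat_thomE A B D E (f : mat A B) (g : mat D E) i i' j j' :
  ent (mat_thom f g) (i, i') (j, j') = ent f i j ⊗₁ ent g i' j'.
Proof. by rewrite mat_mkE. Qed.
Definition mat_one : fam := @Fam funit (fun _ => 𝟙).

Definition mat_data : symdata mat := {|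
  tob := mat_tob;
  thom := mat_thom;
  mone := mat_one;
  asc := fun A B D => @mono (mat_tob (mat_tob A B) D) (mat_tob A (mat_tob B D))
    (fun p => ((p.1, p.2.1), p.2.2)) (fun p => α (A p.1) (B p.2.1) (D p.2.2));
  asci := fun A B D => @mono (mat_tob A (mat_tob B D)) (mat_tob (mat_tob A B) D)
    (fun p => (p.1.1, (p.1.2, p.2))) (fun p => αi (A p.1.1) (B p.1.2) (D p.2));
  lun := fun A => @mono (mat_tob mat_one A) A (fun i => (tt, i)) (fun i => λl (A i));
  luni := fun A => @mono A (mat_tob mat_one A) (fun p => p.2) (fun p => λi (A p.2));
  run := fun A => @mono (mat_tob A mat_one) A (fun i => (i, tt)) (fun i => ρr (A i));
  runi := fun A => @mono A (mat_tob A mat_one) (fun p => p.1) (fun p => ρi (A p.1));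
  brd := fun A B => @mono (mat_tob A B) (mat_tob B A) (fun p => (p.2, p.1))
    (fun p => β (A p.2) (B p.1)) |}.

Lemma mono_comp A B D phi s psi t :
  mat_comp (@mono B D psi t) (@mono A B phi s) =
  @mono A D (fun j => phi (psi j)) (fun j => t j ∘ s (psi j)).
Proof.
apply: matP => i j; rewrite mono_compl.
have [e|ne] := (phi (psi j) =P i); last first.
  by rewrite !mono_miss ?compm0 //; apply/eqP.
by case: i / e; rewrite mono_hit (@mono_hit _ _ (fun j => phi (psi j))).
Qed.

Lemma mono_tens A B D E phi s psi t :
  mat_thom (@mono A B phi s) (@mono D E psi t) =
  @mono (mat_tob A D) (mat_tob B E) (fun p => (phi p.1, psi p.2))
    (fun p => s p.1 ⊗₁ t p.2).
Proof.
apply: matP => -[i i'] [j j']; rewrite mat_mkE /=.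
have [e|ne] := (phi j =P i); last first.
  rewrite mono_miss ?tens0m; last exact/eqP.
  by rewrite mono_miss //=; apply/eqP => -[].
have [e'|ne] := (psi j' =P i'); last first.
  rewrite [X in _ ⊗₁ X]mono_miss ?tensm0; last exact/eqP.
  by rewrite mono_miss //=; apply/eqP => -[].
case: i / e; case: i' / e'; rewrite !mono_hit.
exact/esym/(@mono_hit (mat_tob A D) (mat_tob B E) (fun p => (phi p.1, psi p.2)) _ (j, j')).
Qed.

Lemma mat_symlaws : symlaws mat_id mat_comp mat_data.
Proof.
case: (lsym C) => L1 L2 L3 L4 L5 L6 L7 L8 L9 L10 L11 L12 L13 L14 L15 L16.
split; rewrite /mat_id /=.
- move=> A B; rewrite mono_tens; apply: (@mono_eq (mat_tob A B) (mat_tob A B)) => -[i j] /=.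
  by rewrite /= L1.
- move=> A B D A' B' D' g f g' f'; apply: (@matP (mat_tob A A') (mat_tob D D')) => -[i i'] [j j'].
  rewrite !mat_mkE /= tens_suml.
  rewrite [RHS](eq_bigr (fun p => (ent g p.1 j ∘ ent f i p.1) ⊗₁
    (ent g' p.2 j' ∘ ent f' i' p.2))) => [|p _]; last by rewrite !mat_mkE /= L2.
  rewrite -(pair_bigA _ (fun p q => (ent g p j ∘ ent f i p) ⊗₁
    (ent g' q j' ∘ ent f' i' q))) /=.
  by apply: eq_bigr => l _; rewrite tens_sumr.
- move=> A B D A' B' D' f g h; apply: (@matP (mat_tob (mat_tob A B) D) (mat_tob A' (mat_tob B' D'))) => -[[i1 i2] i3] [j1 [j2 j3]].
  rewrite mono_compl /= !mat_thomE L3.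
  set phi := fun p : idx A * (idx B * idx D) => ((p.1, p.2.1), p.2.2).
  rewrite -[(i1, i2, i3)]/(phi (i1, (i2, i3))).
  rewrite (@mono_compr (mat_tob (mat_tob A B) D) (mat_tob A (mat_tob B D)) _ phi).
    by rewrite !mat_thomE.
  by move=> [? [? ?]] [? [? ?]] [-> -> ->].
- move=> A B D; rewrite mono_comp; apply: (@mono_eq (mat_tob (mat_tob A B) D) (mat_tob (mat_tob A B) D)) => -[[i j] l].
  by rewrite /= L4.
- move=> A B D; rewrite mono_comp; apply: (@mono_eq (mat_tob A (mat_tob B D)) (mat_tob A (mat_tob B D))) => -[i [j l]].
  by rewrite /= L5.
- move=> A B f; apply: (@matP (mat_tob mat_one A) B) => -[[] i] j; rewrite mono_compl mat_thomE.
  rewrite (@mono_hit mat_one mat_one id) L6.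
  set phi := fun i : idx A => (tt, i); rewrite -[(tt, i)]/(phi i).
  by rewrite (@mono_compr (mat_tob mat_one A) A _ phi) // => ? ? [].
- move=> A; rewrite mono_comp; apply: (@mono_eq (mat_tob mat_one A) (mat_tob mat_one A)) => -[[] i].
  by rewrite /= L7.
- move=> A; rewrite mono_comp; apply: (@mono_eq A A) => i.
  by rewrite /= L8.
- move=> A B f; apply: (@matP (mat_tob A mat_one) B) => -[i []] j; rewrite mono_compl mat_thomE.
  rewrite (@mono_hit mat_one mat_one id) L9.
  set phi := fun i : idx A => (i, tt); rewrite -[(i, tt)]/(phi i).
  by rewrite (@mono_compr (mat_tob A mat_one) A _ phi) // => ? ? [].
- move=> A; rewrite mono_comp; apply: (@mono_eq (mat_tob A mat_one) (mat_tob A mat_one)) => -[i []].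
  by rewrite /= L10.
- move=> A; rewrite mono_comp; apply: (@mono_eq A A) => i.
  by rewrite /= L11.
- move=> A B A' B' f g; apply: (@matP (mat_tob A B) (mat_tob B' A')) => -[i i'] [j j'].
  rewrite mono_compl mat_thomE /= L12.
  set phi := fun p : idx B * idx A => (p.2, p.1).
  rewrite -[(i, i')]/(phi (i', i)).
  rewrite (@mono_compr (mat_tob A B) (mat_tob B A) _ phi) ?mat_thomE //.
  by move=> [? ?] [? ?] [-> ->].
- move=> A B; rewrite mono_comp; apply: (@mono_eq (mat_tob A B) (mat_tob A B)) => -[i j].
  by rewrite /= L13.
- move=> A B D E; rewrite !mono_tens !mono_comp; apply: (@mono_eq (mat_tob (mat_tob (mat_tob A B) D) E) (mat_tob A (mat_tob B (mat_tob D E)))) => -[i [j [l m]]].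
  by rewrite /= L14.
- move=> A B; rewrite !mono_tens !mono_comp; apply: (@mono_eq (mat_tob (mat_tob A mat_one) B) (mat_tob A B)) => -[i j].
  by rewrite /= L15.
- move=> A B D; rewrite !mono_tens !mono_comp; apply: (@mono_eq (mat_tob (mat_tob A B) D) (mat_tob B (mat_tob D A))) => -[i [j l]].
  by rewrite /= L16.
Qed.

Lemma mat_thom_linl A B D E (g : mat D E) :
  linear (fun f : mat A B => mat_thom f g).
Proof.
move=> c f h; apply: matP => i j.
by rewrite ent_lin !mat_mkE ent_lin tensDl tensZl.
Qed.
Lemma mat_thom_linr A B D E (f : mat A B) :
  linear (fun g : mat D E => mat_thom f g).
Proof.
move=> c g h; apply: matP => i j.
by rewrite ent_lin !mat_mkE ent_lin tensDr tensZr.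
Qed.

Definition additive_completion : linsmc k :=
  @LinSMC k fam mat mat_id mat_comp mat_laws mat_comp_linl mat_comp_linr
    mat_data mat_symlaws mat_thom_linl mat_thom_linr.

Definition fam0 : fam := @Fam (void : finType) (fun v => match v with end).

Lemma fam0_zero : @is_zero_ob k additive_completion fam0.
Proof. by split=> A f; [apply: matP => -[] | apply: matP => i []]. Qed.

Definition fam_sum (A B : fam) : fam :=
  @Fam ((idx A + idx B)%type : finType)
    (fun s => match s with inl i => A i | inr j => B j end).

Lemma ent0 A B i j : ent (0 : mat A B) i j = 0.
Proof. by rewrite /ent dprod0E. Qed.
Lemma entD A B (f g : mat A B) i j : ent (f + g) i j = ent f i j + ent g i j.
Proof. by rewrite /ent dprodDE. Qed.

Lemma fam_sum_biproduct A B : @is_biproduct k additive_completion A B (fam_sum A B).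
Proof.
pose S := fam_sum A B.
pose i1 : mat A S := @mat_mk A S (fun i s =>
  match s return lhom (A i) (S s) with inl i' => ent (mat_id A) i i' | inr _ => 0 end).
pose i2 : mat B S := @mat_mk B S (fun i s =>
  match s return lhom (B i) (S s) with inr i' => ent (mat_id B) i i' | inl _ => 0 end).
pose p1 : mat S A := @mono S A inl (fun i => lid (A i)).
pose p2 : mat S B := @mono S B inr (fun i => lid (B i)).
have i11 i j : ent i1 i (inl j) = ent (mat_id A) i j by rewrite mat_mkE.
have i12 i j : ent i1 i (inr j) = 0 by rewrite mat_mkE.
have i21 i j : ent i2 i (inl j) = 0 by rewrite mat_mkE.
have i22 i j : ent i2 i (inr j) = ent (mat_id B) i j by rewrite mat_mkE.
have inj1 : injective (inl : idx A -> idx S) by move=> ? ? [].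
have inj2 : injective (inr : idx B -> idx S) by move=> ? ? [].
have c1l i s : ent (mat_comp i1 p1) (inl i) s = ent i1 i s.
  by rewrite (@mono_compr S A _ inl) // compm1.
have c1r i s : ent (mat_comp i1 p1) (inr i) s = 0.
  by rewrite mat_mkE big1 // => j _; rewrite (@mono_miss S A inl) ?compm0.
have c2r i s : ent (mat_comp i2 p2) (inr i) s = ent i2 i s.
  by rewrite (@mono_compr S B _ inr) // compm1.
have c2l i s : ent (mat_comp i2 p2) (inl i) s = 0.
  by rewrite mat_mkE big1 // => j _; rewrite (@mono_miss S B inr) ?compm0.
exists i1, i2, p1, p2; split; apply: matP.
- by move=> i j; rewrite mono_compl comp1m i11.
- by move=> i j; rewrite mono_compl comp1m i22.
- by move=> i j; rewrite mono_compl i21 compm0 ent0.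
- by move=> i j; rewrite mono_compl i12 compm0 ent0.
- move=> [i|i] [j|j]; rewrite entD ?(c1l, c1r, c2l, c2r) ?(i11, i12, i21, i22).
  + rewrite addr0; have [->|ne] := (j =P i).
      by rewrite (@mono_hit A A id) (@mono_hit S S id).
    by rewrite !(@mono_miss _ _ id) //; apply/eqP => // -[].
  + by rewrite addr0 (@mono_miss S S id).
  + by rewrite add0r (@mono_miss S S id).
  + rewrite add0r; have [->|ne] := (j =P i).
      by rewrite (@mono_hit B B id) (@mono_hit S S id).
    by rewrite !(@mono_miss _ _ id) //; apply/eqP => // -[].
Qed.
End AdditiveCompletion.

Section KaroubiHom.
Variables (k : fieldType) (C : linsmc k) (a b : C) (ea : lhom a a) (eb : lhom b b).

Definition kar_pred : {pred lhom a b} := fun f => (eb ∘ f == f) && (f ∘ ea == f).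

Lemma kar_closed : GRing.submod_closed kar_pred.
Proof.
split=> [|c f g /andP[/eqP f1 /eqP f2] /andP[/eqP g1 /eqP g2]].
  by apply/andP; rewrite compm0 comp0m.
by apply/andP; rewrite lcomp_linl lcomp_linr f1 f2 g1 g2.
Qed.
HB.instance Definition _ := GRing.isSubmodClosed.Build k (lhom a b) kar_pred kar_closed.

Definition kar_sub : Type := {f : lhom a b | f \in kar_pred}.
HB.instance Definition _ := [isSub of kar_sub for (@sval (lhom a b) (fun f => f \in kar_pred))].
HB.instance Definition _ := [Choice of kar_sub by <:].
HB.instance Definition _ := [SubChoice_isSubLmodule of kar_sub by <:].
End KaroubiHom.

Section Karoubi.
Variables (k : fieldType) (C : linsmc k).

Record kar := Kar { kob : C; kid : lhom kob kob; kidK : kid ∘ kid = kid }.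
Implicit Types A B D E : kar.

Definition khom A B : lmodType k := kar_sub (kid A) (kid B).
Arguments khom : simpl never.

Definition kval A B (f : khom A B) : lhom (kob A) (kob B) := val f.

Lemma kval_inj A B : injective (@kval A B).
Proof. exact: val_inj. Qed.
Lemma kval_lin A B : linear (@kval A B).
Proof. exact: (linearP (\val : kar_sub (kid A) (kid B) -> _)). Qed.
Lemma kvall A B (f : khom A B) : kid B ∘ kval f = kval f.
Proof. by have /andP[/eqP] := valP f. Qed.
Lemma kvalr A B (f : khom A B) : kval f ∘ kid A = kval f.
Proof. by have /andP[_ /eqP] := valP f. Qed.

(* The morphism of retracts induced by f *)
Lemma kmk_subproof A B (f : lhom (kob A) (kob B)) :
  kid B ∘ f ∘ kid A \in kar_pred (kid A) (kid B).
Proof. by apply/andP; rewrite !compA kidK -!compA kidK. Qed.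
Definition kmk A B (f : lhom (kob A) (kob B)) : khom A B :=
  exist _ (kid B ∘ f ∘ kid A) (kmk_subproof f).
Lemma kmkE A B f : kval (@kmk A B f) = kid B ∘ f ∘ kid A.
Proof. by []. Qed.
Lemma kmk_val A B (f : khom A B) : kmk (kval f) = f.
Proof. by apply: kval_inj; rewrite kmkE kvall kvalr. Qed.

Definition k_id A : khom A A := kmk (lid (kob A)).
Definition k_comp A B D (g : khom B D) (f : khom A B) : khom A D :=
  kmk (kval g ∘ kval f).
Lemma k_idE A : kval (k_id A) = kid A.
Proof. by rewrite kmkE compm1 kidK. Qed.
Lemma k_compE A B D (g : khom B D) (f : khom A B) : kval (k_comp g f) = kval g ∘ kval f.
Proof. by rewrite kmkE compA kvall -compA kvalr. Qed.

Lemma k_laws : cat_laws k_id k_comp.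
Proof.
split=> *; apply: kval_inj; rewrite !k_compE.
- exact: compA.
- by rewrite k_idE kvall.
- by rewrite k_idE kvalr.
Qed.

Lemma k_comp_linl A B D (f : khom A B) : linear (fun g : khom B D => k_comp g f).
Proof.
by move=> c g h; apply: kval_inj; rewrite !(k_compE, kval_lin) lcomp_linl.
Qed.
Lemma k_comp_linr A B D (g : khom B D) : linear (fun f : khom A B => k_comp g f).
Proof.
by move=> c f h; apply: kval_inj; rewrite !(k_compE, kval_lin) lcomp_linr.
Qed.

Lemma k_tob_subproof A B : (kid A ⊗₁ kid B) ∘ (kid A ⊗₁ kid B) = kid A ⊗₁ kid B.
Proof. by rewrite -tensM !kidK. Qed.
Definition k_tob A B : kar := Kar (k_tob_subproof A B).
Definition k_one : kar := Kar (comp1m (lid (𝟙 : C))).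
Definition k_thom A B D E (f : khom A B) (g : khom D E) :
    khom (k_tob A D) (k_tob B E) :=
  @kmk (k_tob A D) (k_tob B E) (kval f ⊗₁ kval g).
Lemma k_thomE A B D E (f : khom A B) (g : khom D E) :
  kval (k_thom f g) = kval f ⊗₁ kval g.
Proof. by rewrite kmkE -!tensM !kvall !kvalr. Qed.

Definition k_data : symdata khom := {|
  tob := k_tob;
  thom := k_thom;
  mone := k_one;
  asc := fun A B D => @kmk (k_tob (k_tob A B) D) (k_tob A (k_tob B D)) (α _ _ _);
  asci := fun A B D => @kmk (k_tob A (k_tob B D)) (k_tob (k_tob A B) D) (αi _ _ _);
  lun := fun A => @kmk (k_tob k_one A) A (λl _);
  luni := fun A => @kmk A (k_tob k_one A) (λi _);
  run := fun A => @kmk (k_tob A k_one) A (ρr _);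
  runi := fun A => @kmk A (k_tob A k_one) (ρi _);
  brd := fun A B => @kmk (k_tob A B) (k_tob B A) (β _ _) |}.

Definition kcomm A B (f : lhom (kob A) (kob B)) := kid B ∘ f = f ∘ kid A.

Lemma kcomm_id A : kcomm (A := A) (B := A) (lid _).
Proof. by rewrite /kcomm comp1m compm1. Qed.
Lemma kmk_comp A B D g f : kcomm (A := A) (B := B) f ->
  k_comp (@kmk B D g) (@kmk A B f) = kmk (g ∘ f).
Proof.
move=> c; apply: kval_inj; rewrite k_compE !kmkE c -!compA (compA (kid B)) c.
by rewrite -!compA !kidK.
Qed.
Lemma kmk_tens A B D E f g :
  k_thom (@kmk A B f) (@kmk D E g) = @kmk (k_tob A D) (k_tob B E) (f ⊗₁ g).
Proof. by apply: kval_inj; rewrite k_thomE !kmkE !tensM. Qed.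

Lemma kasc A B D : kcomm (A := k_tob (k_tob A B) D) (B := k_tob A (k_tob B D)) (α _ _ _).
Proof. by rewrite /kcomm (asc_nat (lsym C)). Qed.
Lemma klun A : kcomm (A := k_tob k_one A) (B := A) (λl _).
Proof. by rewrite /kcomm (lun_nat (lsym C)). Qed.
Lemma krun A : kcomm (A := k_tob A k_one) (B := A) (ρr _).
Proof. by rewrite /kcomm (run_nat (lsym C)). Qed.
Lemma kbrd A B : kcomm (A := k_tob A B) (B := k_tob B A) (β _ _).
Proof. by rewrite /kcomm (brd_nat (lsym C)). Qed.

Lemma k_inv A B f g : kcomm (A := A) (B := B) f -> g ∘ f = lid _ ->
  k_comp (@kmk B A g) (@kmk A B f) = k_id A.
Proof. by move=> c gf; rewrite kmk_comp // gf. Qed.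

Lemma k_inv' A B f g : kcomm (A := A) (B := B) f -> g ∘ f = lid _ -> f ∘ g = lid _ ->
  k_comp (@kmk A B f) (@kmk B A g) = k_id B.
Proof.
move=> c gf fg; apply: kval_inj; rewrite k_compE k_idE !kmkE.
rewrite c -!compA (compA (kid A)) kidK !compA -(compA f) kidK -c -(compA (kid B)) fg.
by rewrite compm1 kidK.
Qed.

Lemma k_nat A B A' B' (s : lhom (kob A) (kob B)) (s' : lhom (kob A') (kob B'))
    (f : khom A A') (g : khom B B') :
  s' ∘ kval f = kval g ∘ s -> k_comp (kmk s') f = k_comp g (kmk s).
Proof.
move=> e; apply: kval_inj; rewrite !k_compE !kmkE.
by rewrite -!compA kvall e !compA kvall kvalr -e -compA kvalr.
Qed.

Lemma k_symlaws : symlaws k_id k_comp k_data.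
Proof.
have cT A B D E f g : kcomm (A := A) (B := B) f -> kcomm (A := D) (B := E) g ->
    kcomm (A := k_tob A D) (B := k_tob B E) (f ⊗₁ g).
  by rewrite /kcomm => cf cg; rewrite -!tensM cf cg.
have cC A B D f g : kcomm (A := A) (B := B) f -> kcomm (A := B) (B := D) g ->
    kcomm (A := A) (B := D) (g ∘ f).
  by rewrite /kcomm => cf cg; rewrite compA cg -!compA cf.
case: (lsym C) => L1 L2 L3 L4 L5 L6 L7 L8 L9 L10 L11 L12 L13 L14 L15 L16.
split; cbn [k_data tob thom asc asci lun luni run runi brd mone].
- by move=> A B; apply: kval_inj; rewrite k_thomE !k_idE.
- by move=> *; apply: kval_inj; rewrite !(k_thomE, k_compE) tensM.
- by move=> *; apply: k_nat; rewrite !k_thomE L3.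
- by move=> *; apply: k_inv; [exact: kasc | exact: L4].
- by move=> *; apply: k_inv'; [exact: kasc | exact: L4 | exact: L5].
- by move=> A B f; apply: k_nat; rewrite k_thomE k_idE L6.
- by move=> *; apply: k_inv; [exact: klun | exact: L7].
- by move=> *; apply: k_inv'; [exact: klun | exact: L7 | exact: L8].
- by move=> A B f; apply: k_nat; rewrite k_thomE k_idE L9.
- by move=> *; apply: k_inv; [exact: krun | exact: L10].
- by move=> *; apply: k_inv'; [exact: krun | exact: L10 | exact: L11].
- by move=> *; apply: k_nat; rewrite !k_thomE L12.
- by move=> *; apply: k_inv; [exact: kbrd | exact: L13].
- move=> A B D E; rewrite !kmk_tens !kmk_comp; try exact: kasc.
  + by rewrite L14.
  + by apply: cT; [exact: kasc | exact: kcomm_id].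
- move=> A B; rewrite !kmk_tens !kmk_comp; try exact: kasc.
  by rewrite L15.
- move=> A B D; rewrite !kmk_tens !kmk_comp; try by [exact: kasc | exact: kbrd].
  + by rewrite L16.
  + by apply: cT; [exact: kbrd | exact: kcomm_id].
Qed.

Lemma k_thom_linl A B D E (g : khom D E) : linear (fun f : khom A B => k_thom f g).
Proof.
by move=> c f h; apply: kval_inj; rewrite !(k_thomE, kval_lin) lthom_linl.
Qed.
Lemma k_thom_linr A B D E (f : khom A B) : linear (fun g : khom D E => k_thom f g).
Proof.
by move=> c g h; apply: kval_inj; rewrite !(k_thomE, kval_lin) lthom_linr.
Qed.

Definition idempotent_completion : linsmc k :=
  @LinSMC k kar khom k_id k_comp k_laws k_comp_linl k_comp_linr
    k_data k_symlaws k_thom_linl k_thom_linr.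
Local Notation K := idempotent_completion.

Lemma kval0 A B : kval (0 : khom A B) = 0.
Proof. by have := kval_lin (-1) (0 : khom A B) 0; rewrite scaler0 addr0 scaleN1r addNr. Qed.

Lemma kar_split (A : K) (e : lhom A A) : e ∘ e = e -> exists B : K, is_splitting e B.
Proof.
move=> ee; have eE : kval e ∘ kval e = kval e by rewrite -k_compE [k_comp _ _]ee.
pose B := Kar eE.
exists B, (@kmk B A (kval e)), (@kmk A B (kval e)).
by split; apply: kval_inj; rewrite k_compE ?k_idE !kmkE /= ?kvall ?kvalr !eE ?kvalr ?kvall ?eE.
Qed.

Lemma kar_zero (z : C) : is_zero_ob z -> exists z' : K, is_zero_ob z'.
Proof.
move=> [z1 z2]; exists (Kar (comp1m (lid z))).
by split=> A f; apply: kval_inj; rewrite kval0; [apply: z1 | apply: z2].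
Qed.

Lemma kar_biproduct : (forall a b : C, exists c, is_biproduct a b c) ->
  forall A B : K, exists D : K, is_biproduct A B D.
Proof.
move=> H A B; have [c [i1 [i2 [p1 [p2 [h11 h22 h12 h21 h]]]]]] := H (kob A) (kob B).
pose e := i1 ∘ kid A ∘ p1 + i2 ∘ kid B ∘ p2.
have eE : e ∘ e = e.
  rewrite /e compDl !compDr -!compA (compA p1 i1) (compA p1 i2) (compA p2 i1) (compA p2 i2).
  rewrite h11 h22 h12 h21 !comp0m !compm0 !comp1m addr0 add0r.
  by rewrite (compA (kid A)) (compA (kid B)) !kidK.
pose D := Kar eE.
exists D, (@kmk A D i1), (@kmk B D i2), (@kmk D A p1), (@kmk D B p2).
have ei1 : e ∘ i1 = i1 ∘ kid A.
  by rewrite /e compDl -!compA h11 h21 !compm0 addr0 compm1.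
have ei2 : e ∘ i2 = i2 ∘ kid B.
  by rewrite /e compDl -!compA h12 h22 !compm0 add0r compm1.
have p1e : p1 ∘ e = kid A ∘ p1.
  by rewrite /e compDr !compA h11 h12 !comp0m addr0 comp1m.
have p2e : p2 ∘ e = kid B ∘ p2.
  by rewrite /e compDr !compA h21 h22 !comp0m add0r comp1m.
have c1 : kcomm (A := A) (B := D) i1 by [].
have c2 : kcomm (A := B) (B := D) i2 by [].
split.
- by rewrite [LHS]kmk_comp // h11.
- by rewrite [LHS]kmk_comp // h22.
- by rewrite [LHS]kmk_comp // h12; apply: kval_inj; rewrite kmkE compm0 comp0m kval0.
- by rewrite [LHS]kmk_comp // h21; apply: kval_inj; rewrite kmkE compm0 comp0m kval0.
- have c3 : kcomm (A := D) (B := A) p1 by rewrite /kcomm /= p1e.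
  have c4 : kcomm (A := D) (B := B) p2 by rewrite /kcomm /= p2e.
  apply: kval_inj; rewrite -[X in X + _]scale1r [LHS]kval_lin scale1r.
  rewrite (congr1 (@kval _ _) (kmk_comp (D := D) i1 c3)).
  rewrite (congr1 (@kval _ _) (kmk_comp (D := D) i2 c4)).
  by rewrite !kmkE -compDl -compDr h [RHS]k_idE compm1 eE.
Qed.
End Karoubi.

(* Freely adding finite biproducts, then splittings of idempotents *)
Definition cauchy (k : fieldType) (C : linsmc k) : linsmc k :=
  idempotent_completion (additive_completion C).

Lemma cauchyP (k : fieldType) (C : linsmc k) : cauchy_complete (cauchy C).
Proof.
split; first exact: kar_zero (fam0_zero C).
  by apply: kar_biproduct => A B; exists (fam_sum A B); apply: fam_sum_biproduct.
exact: kar_split.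
Qed.

Definition kSbar (k : fieldType) : two_rig k := TwoRig (cauchyP (kS k)).

(* The one-member family on the one-point set, with the identity idempotent *)
Definition kSbar_x (k : fieldType) : kSbar k :=
  Kar (comp1m (lid (@Fam k (kS k) funit (fun _ => funit) : additive_completion (kS k)))).

Section QuotientModule.
Variables (k : fieldType) (V : lmodType k) (N : V -> Prop).
Hypotheses (N0 : N 0) (Nlin : forall c f g, N f -> N g -> N (c *: f + g)).

Definition qrel : rel V := fun f g => `[< N (f - g) >].

Lemma N_opp f : N f -> N (- f).
Proof. by move=> h; have := Nlin (-1) h N0; rewrite scaleN1r addr0. Qed.
Lemma N_add f g : N f -> N g -> N (f + g).
Proof. by move=> h h'; have := Nlin 1 h h'; rewrite scale1r. Qed.

Lemma qrel_refl : reflexive qrel.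
Proof. by move=> f; apply/asboolP; rewrite subrr. Qed.
Lemma qrel_sym : symmetric qrel.
Proof. by move=> f g; apply/asboolP/asboolP => /N_opp; rewrite opprB. Qed.
Lemma qrel_trans : transitive qrel.
Proof.
by move=> g f h /asboolP fg /asboolP gh; apply/asboolP; have := N_add fg gh;
  rewrite addrA subrK.
Qed.
Definition qequiv : equiv_rel V := EquivRel qrel qrel_refl qrel_sym qrel_trans.

Definition quotmod : Type := {eq_quot qequiv}.
HB.instance Definition _ := Choice.on quotmod.
HB.instance Definition _ := Quotient.on quotmod.

Definition qpi (f : V) : quotmod := \pi_({eq_quot qequiv})  f.
Definition qrepr (x : quotmod) : V := repr (x : {eq_quot qequiv}).

Lemma qpi_repr x : qpi (qrepr x) = x.
Proof. exact: reprK. Qed.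
Lemma qpiP f g : qpi f = qpi g <-> N (f - g).
Proof.
split=> [/eqmodP/asboolP //|h]; apply/eqmodP; exact/asboolP.
Qed.
Lemma qrepr_pi f : N (qrepr (qpi f) - f).
Proof. by apply/qpiP; rewrite qpi_repr. Qed.

Definition quot_add (x y : quotmod) : quotmod := qpi (qrepr x + qrepr y).
Definition quot_opp (x : quotmod) : quotmod := qpi (- qrepr x).
Definition quot_scale (c : k) (x : quotmod) : quotmod := qpi (c *: qrepr x).

Lemma qpi_add f g : quot_add (qpi f) (qpi g) = qpi (f + g).
Proof.
by apply/qpiP; rewrite opprD addrACA; apply: N_add; apply: qrepr_pi.
Qed.
Lemma qpi_opp f : quot_opp (qpi f) = qpi (- f).
Proof. by apply/qpiP; rewrite -opprD; apply/N_opp/qrepr_pi. Qed.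
Lemma qpi_scale c f : quot_scale c (qpi f) = qpi (c *: f).
Proof.
by apply/qpiP; rewrite -scalerBr -[_ *: _]addr0; apply: Nlin => //; apply: qrepr_pi.
Qed.

Fact quot_addA : associative quot_add.
Proof.
move=> x y z; rewrite -(qpi_repr x) -(qpi_repr y) -(qpi_repr z).
by rewrite !qpi_add addrA.
Qed.
Fact quot_addC : commutative quot_add.
Proof. by move=> x y; rewrite -(qpi_repr x) -(qpi_repr y) !qpi_add addrC. Qed.
Fact quot_add0 : left_id (qpi 0) quot_add.
Proof. by move=> x; rewrite -(qpi_repr x) qpi_add add0r. Qed.
Fact quot_addN : left_inverse (qpi 0) quot_opp quot_add.
Proof. by move=> x; rewrite -(qpi_repr x) qpi_opp qpi_add addNr. Qed.
HB.instance Definition _ :=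
  GRing.isZmodule.Build quotmod quot_addA quot_addC quot_add0 quot_addN.

Fact quot_scaleA b c x : quot_scale b (quot_scale c x) = quot_scale (b * c) x.
Proof. by rewrite -(qpi_repr x) !qpi_scale scalerA. Qed.
Fact quot_scale1 : left_id 1 quot_scale.
Proof. by move=> x; rewrite -(qpi_repr x) qpi_scale scale1r. Qed.
Fact quot_scaleDr : right_distributive quot_scale +%R.
Proof.
move=> c x y; rewrite -(qpi_repr x) -(qpi_repr y).
by rewrite [_ + _]qpi_add !qpi_scale [RHS]qpi_add scalerDr.
Qed.
Fact quot_scaleDl x : {morph quot_scale^~ x : b c / b + c}.
Proof.
by move=> b c; rewrite -(qpi_repr x) !qpi_scale [RHS]qpi_add scalerDl.
Qed.
HB.instance Definition _ := GRing.Zmodule_isLmodule.Build k quotmod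
  quot_scaleA quot_scale1 quot_scaleDr quot_scaleDl.

Lemma qpi_lin : linear qpi.
Proof. by move=> c f g; rewrite [_ *: qpi f]qpi_scale [RHS]qpi_add. Qed.
End QuotientModule.

Record two_ideal (k : fieldType) (R : two_rig k) := TwoIdeal {
  in_ideal :> R -> Prop;
  ideal_iso : forall a b (f : lhom a b), liso f -> in_ideal a -> in_ideal b;
  ideal_zero : forall z : R, is_zero_ob z -> in_ideal z;
  ideal_biproduct : forall a b c : R,
    is_biproduct a b c -> in_ideal a -> in_ideal b -> in_ideal c;
  ideal_retract : forall a b : R, is_retract a b -> in_ideal b -> in_ideal a;
  ideal_tensl : forall a b : R, in_ideal a -> in_ideal (b ⊗ a);
  ideal_tensr : forall a b : R, in_ideal a -> in_ideal (a ⊗ b) }.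

Section GeneratedIdeal.
Variables (k : fieldType) (R : two_rig k) (S : R -> Prop).

(* The smallest 2-ideal containing the objects in S *)
Definition ideal_gen : two_ideal R.
Proof.
exists (fun a => forall I : two_ideal R, (forall s, S s -> I s) -> I a).
- by move=> a b f isof ha I SI; apply: (ideal_iso isof); apply: ha.
- by move=> z z0 I _; apply: ideal_zero.
- by move=> a b c abc ha hb I SI; apply: (ideal_biproduct abc); [apply: ha | apply: hb].
- by move=> a b ab hb I SI; apply: (ideal_retract ab); apply: hb.
- by move=> a b ha I SI; apply: ideal_tensl; apply: ha.
- by move=> a b ha I SI; apply: ideal_tensr; apply: ha.
Defined.
End GeneratedIdeal.

Section Quotient.
Variables (k : fieldType) (R : two_rig k) (I : two_ideal R).

Definition factors a b (f : lhom (a : R) b) : Prop :=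
  exists (c : R) (v : lhom c b) (u : lhom a c), I c /\ f = v ∘ u.

Lemma factors0 a b : factors (0 : lhom a b).
Proof.
have [z zz] : exists z : R, is_zero_ob z by case: (two_rigP R).
by exists z, 0, 0; split; [exact: ideal_zero | rewrite comp0m].
Qed.

Lemma factors_lin a b c (f g : lhom a b) : factors f -> factors g -> factors (c *: f + g).
Proof.
move=> [x [v [u [xI ->]]]] [y [v' [u' [yI ->]]]].
have [_ /(_ x y)[d bd] _] := two_rigP R.
have [i1 [i2 [p1 [p2 [h11 h22 h12 h21 h]]]]] := bd.
exists d, (c *: (v ∘ p1) + v' ∘ p2), (i1 ∘ u + i2 ∘ u'); split.
  exact: ideal_biproduct bd xI yI.
rewrite compDl !compDr !compZl -!compA.
rewrite (compA p1 i1) (compA p1 i2) (compA p2 i1) (compA p2 i2) h11 h22 h12 h21.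
by rewrite !comp0m !comp1m !compm0 scaler0 addr0 add0r.
Qed.

Lemma factors_compl a b c (g : lhom b c) (f : lhom a b) : factors f -> factors (g ∘ f).
Proof. by move=> [x [v [u [xI ->]]]]; exists x, (g ∘ v), u; rewrite compA. Qed.
Lemma factors_compr a b c (g : lhom b c) (f : lhom a b) : factors g -> factors (g ∘ f).
Proof. by move=> [x [v [u [xI ->]]]]; exists x, v, (u ∘ f); rewrite compA. Qed.
Lemma factors_tensl a b c d (f : lhom a b) (g : lhom c d) : factors f -> factors (f ⊗₁ g).
Proof.
move=> [x [v [u [xI ->]]]]; exists (x ⊗ d), (v ⊗₁ lid d), (u ⊗₁ g).
by rewrite -tensM comp1m; split => //; exact: ideal_tensr.
Qed.
Lemma factors_tensr a b c d (f : lhom a b) (g : lhom c d) : factors g -> factors (f ⊗₁ g).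
Proof.
move=> [x [v [u [xI ->]]]]; exists (b ⊗ x), (lid b ⊗₁ v), (f ⊗₁ u).
by rewrite -tensM comp1m; split => //; exact: ideal_tensl.
Qed.

(* The objects of the quotient are those of R, and two parallel maps are
   identified when their difference factors through an object of I. This makes
   sense for every 2-rig R; idempotents split in the quotient as soon as the
   endomorphism algebras of R are finite-dimensional (quotient_cauchy below). *)
Definition qhom (a b : R) : lmodType k := quotmod (factors0 a b) (@factors_lin a b).
Definition qp a b (f : lhom a b) : qhom a b := qpi (factors0 a b) (@factors_lin a b) f.
Definition qr a b (f : qhom a b) : lhom a b := qrepr f.

Lemma qr_ex a b (x : qhom a b) : exists f, x = qp f.
Proof. by exists (qr x); rewrite /qp /qr qpi_repr. Qed.
Lemma qpE a b (f g : lhom a b) : qp f = qp g <-> factors (f - g).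
Proof. exact: qpiP. Qed.
Lemma qp_lin a b : linear (@qp a b).
Proof. exact: qpi_lin. Qed.
Lemma qr_qp a b (f : lhom a b) : factors (qr (qp f) - f).
Proof. exact: qrepr_pi. Qed.

Definition q_comp a b c (g : qhom b c) (f : qhom a b) : qhom a c := qp (qr g ∘ qr f).
Definition q_thom a b c d (f : qhom a b) (g : qhom c d) : qhom (a ⊗ c) (b ⊗ d) :=
  qp (qr f ⊗₁ qr g).

Lemma q_compE a b c (g : lhom b c) (f : lhom a b) : q_comp (qp g) (qp f) = qp (g ∘ f).
Proof.
apply/qpE.
have -> : qr (qp g) ∘ qr (qp f) - g ∘ f =
    1 *: ((qr (qp g) - g) ∘ qr (qp f)) + g ∘ (qr (qp f) - f).
  by rewrite scale1r compDl compDr compNl compNr addrA subrK.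
by apply: factors_lin; [apply: factors_compr | apply: factors_compl]; apply: qr_qp.
Qed.
Lemma q_thomE a b c d (f : lhom a b) (g : lhom c d) : q_thom (qp f) (qp g) = qp (f ⊗₁ g).
Proof.
apply/qpE.
have -> : qr (qp f) ⊗₁ qr (qp g) - f ⊗₁ g =
    1 *: ((qr (qp f) - f) ⊗₁ qr (qp g)) + f ⊗₁ (qr (qp g) - g).
  by rewrite scale1r tensDl tensDr tensNl tensNr addrA subrK.
by apply: factors_lin; [apply: factors_tensl | apply: factors_tensr]; apply: qr_qp.
Qed.

Definition q_id (a : R) : qhom a a := qp (lid a).

Definition q_data : symdata qhom := {|
  tob := tob (ldata R);
  thom := q_thom;
  mone := mone (ldata R);
  asc := fun a b c => qp (α a b c);
  asci := fun a b c => qp (αi a b c);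
  lun := fun a => qp (λl a);
  luni := fun a => qp (λi a);
  run := fun a => qp (ρr a);
  runi := fun a => qp (ρi a);
  brd := fun a b => qp (β a b) |}.

Lemma q_laws : cat_laws q_id q_comp.
Proof.
split=> [a b c d h g f|a b f|a b f]; have [f' ->] := qr_ex f.
- by have [h' ->] := qr_ex h; have [g' ->] := qr_ex g; rewrite !q_compE compA.
- by rewrite q_compE comp1m.
- by rewrite q_compE compm1.
Qed.

Lemma q_symlaws : symlaws q_id q_comp q_data.
Proof.
case: (lsym R) => L1 L2 L3 L4 L5 L6 L7 L8 L9 L10 L11 L12 L13 L14 L15 L16.
split; cbn [q_data tob thom asc asci lun luni run runi brd mone]; rewrite /q_id.
- by move=> *; rewrite q_thomE L1.
- move=> a b c a' b' c' g f g' f'; have [x ->] := qr_ex g; have [y ->] := qr_ex f.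
  have [z ->] := qr_ex g'; have [t ->] := qr_ex f'.
  by rewrite !(q_thomE, q_compE) L2.
- move=> a b c a' b' c' f g h; have [x ->] := qr_ex f; have [y ->] := qr_ex g.
  by have [z ->] := qr_ex h; rewrite !(q_thomE, q_compE) L3.
- by move=> *; rewrite q_compE L4.
- by move=> *; rewrite q_compE L5.
- by move=> a b f; have [x ->] := qr_ex f; rewrite !(q_thomE, q_compE) L6.
- by move=> *; rewrite q_compE L7.
- by move=> *; rewrite q_compE L8.
- by move=> a b f; have [x ->] := qr_ex f; rewrite !(q_thomE, q_compE) L9.
- by move=> *; rewrite q_compE L10.
- by move=> *; rewrite q_compE L11.
- move=> a b a' b' f g; have [x ->] := qr_ex f; have [y ->] := qr_ex g.
  by rewrite !(q_thomE, q_compE) L12.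
- by move=> *; rewrite q_compE L13.
- by move=> *; rewrite !(q_thomE, q_compE) L14.
- by move=> *; rewrite !(q_thomE, q_compE) L15.
- by move=> *; rewrite !(q_thomE, q_compE) L16.
Qed.

Lemma q_comp_linl a b c (f : qhom a b) : linear (fun g : qhom b c => q_comp g f).
Proof.
move=> x g h; have [f' ->] := qr_ex f; have [g' ->] := qr_ex g; have [h' ->] := qr_ex h.
by rewrite -qp_lin !q_compE -qp_lin lcomp_linl.
Qed.
Lemma q_comp_linr a b c (g : qhom b c) : linear (fun f : qhom a b => q_comp g f).
Proof.
move=> x f h; have [f' ->] := qr_ex f; have [g' ->] := qr_ex g; have [h' ->] := qr_ex h.
by rewrite -qp_lin !q_compE -qp_lin lcomp_linr.
Qed.
Lemma q_thom_linl a b c d (g : qhom c d) : linear (fun f : qhom a b => q_thom f g).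
Proof.
move=> x f h; have [f' ->] := qr_ex f; have [g' ->] := qr_ex g; have [h' ->] := qr_ex h.
by rewrite -qp_lin !q_thomE -qp_lin lthom_linl.
Qed.
Lemma q_thom_linr a b c d (f : qhom a b) : linear (fun g : qhom c d => q_thom f g).
Proof.
move=> x g h; have [f' ->] := qr_ex f; have [g' ->] := qr_ex g; have [h' ->] := qr_ex h.
by rewrite -qp_lin !q_thomE -qp_lin lthom_linr.
Qed.

Definition quotient : linsmc k :=
  @LinSMC k R qhom q_id q_comp q_laws q_comp_linl q_comp_linr
    q_data q_symlaws q_thom_linl q_thom_linr.

Lemma qp0 a b : qp (0 : lhom a b) = 0.
Proof. by []. Qed.

Lemma quotient_zero : exists z : quotient, is_zero_ob z.
Proof.
have [[z [z1 z2]] _ _] := two_rigP R; exists z.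
by split=> b f; have [g ->] := qr_ex f; rewrite ?(z1 _ g) ?(z2 _ g).
Qed.

Lemma quotient_biproduct (a b : quotient) : exists c, is_biproduct a b c.
Proof.
have [_ /(_ a b)[c [i1 [i2 [p1 [p2 [h11 h22 h12 h21 h]]]]]] _] := two_rigP R.
exists c, (qp i1), (qp i2), (qp p1), (qp p2).
split; rewrite ?[_ ∘ _]q_compE ?h11 ?h22 ?h12 ?h21 //.
rewrite [X in _ + X]q_compE -[X in X + _]scale1r.
by rewrite -[LHS](qp_lin 1) scale1r h.
Qed.
End Quotient.

(* Idempotents lift along quotients of 2-rigs with finite-dimensional
   endomorphism algebras. *)

Definition findim (k : fieldType) (V : lmodType k) : Prop :=
  exists (T : finType) (phi : V -> T -> k),
    (forall t, linear (fun v => phi v t : k^o)) /\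
    (forall v, (forall t, phi v t = 0) -> v = 0).

Lemma findim_dep (k : fieldType) (V : lmodType k) : findim V ->
  forall x : nat -> V, exists (r m : nat) (c : nat -> k),
    x r = \sum_(i < m) c i *: x (r.+1 + i)%N.
Proof.
move=> [T [phi [lin inj]]] x; pose N := #|T|.
pose M : 'M[k]_(N.+1, N) := \matrix_(i, j) phi (x i) (enum_val j).
have ME l t : M l (enum_rank t) = phi (x l) t by rewrite mxE enum_rankK.
have K0 : kermx M != 0.
  rewrite kermx_eq0 /row_free neq_ltn; apply/orP; left.
  by rewrite ltnS; exact: rank_leq_col.
have [i [j Kij]] : exists i j, kermx M i j != 0.
  have /rowV0Pn[v /submxP[D ->] nz] := K0.
  apply/not_existsP => /= h; case/negP: nz; apply/eqP.
  suff -> : kermx M = 0 by rewrite mulmx0.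
  apply/matrixP => i j; rewrite [RHS]mxE; apply/eqP/negP => /negP Kij.
  by case: (h i); exists j.
pose w (l : nat) : k := kermx M i (inord l).
have sum0 : \sum_(0 <= l < N.+1) w l *: x l = 0.
  apply: inj => t; rewrite big_mkord.
  have phi0 : phi 0 t = 0.
    by have := lin t (-1) 0 0; rewrite scaler0 addr0 => e; rewrite {1}e scaleN1r addNr.
  have -> : phi (\sum_(l < N.+1) w l *: x l) t = \sum_(l < N.+1) w l * phi (x l) t.
    elim/big_rec2: _ => // l y1 y2 _ <-.
    exact: lin.
  have := mulmx_ker M => /matrixP/(_ i (enum_rank t)); rewrite !mxE => e0.
  rewrite -[RHS]e0; by apply: eq_bigr => l _; rewrite ME /w inord_val.
case: (@arg_minnP _ j (fun l => kermx M i l != 0) (fun l : 'I_N.+1 => (l : nat)) Kij).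
move=> r wr rmin.
have wr' : w r != 0 by rewrite /w inord_val.
exists r, (N - r)%N, (fun l => - (w r)^-1 * w (r.+1 + l)%N).
move: sum0; rewrite (@big_cat_nat _ _ _ r) //=; last exact: ltnW.
rewrite big_nat big1 ?add0r; last first.
  move=> l /andP[_ lr]; apply/eqP; rewrite scaler_eq0; apply/orP; left.
  have lN : (l < N.+1)%N by rewrite (ltn_trans lr).
  apply: contraLR lr => wl; rewrite -leqNgt.
  by have := rmin (Ordinal lN); apply; rewrite -[Ordinal lN]inord_val.
rewrite big_ltn // => /eqP; rewrite addr_eq0 => /eqP e.
have -> : x r = (w r)^-1 *: (w r *: x r) by rewrite scalerA mulVf // scale1r.
rewrite e -{1}[r.+1]add0n big_addn big_mkord subSS scalerN -scaleNr scaler_sumr.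
by apply: eq_bigr => l _; rewrite scalerA addnC.
Qed.

Section LiftIdempotent.
Variables (k : fieldType) (R : linsmc k).
Variables (a : R) (f : lhom a a).

Fixpoint epow (m : nat) : lhom a a := if m is m'.+1 then f ∘ epow m' else lid a.

Lemma epowD m m' : epow (m + m') = epow m ∘ epow m'.
Proof. by elim: m => [|m IH] /=; rewrite ?comp1m // IH compA. Qed.

Lemma epow_comm q m : f ∘ q = q ∘ f -> epow m ∘ q = q ∘ epow m.
Proof.
move=> c; elim: m => [|m IH] /=; first by rewrite comp1m compm1.
by rewrite -compA IH !compA c.
Qed.

Lemma epow_pi_regular : findim (lhom a a) ->
  exists (m : nat) (q : lhom a a),
    [/\ (0 < m)%N, epow (m + m) ∘ q = epow m & f ∘ q = q ∘ f].
Proof.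
move=> fd; have [r [n [c e]]] := findim_dep fd epow.
pose q := \sum_(i < n) c i *: epow i.
have qf : f ∘ q = q ∘ f.
  rewrite /q comp_sumr comp_suml; apply: eq_bigr => i _.
  by rewrite compZl compZr (@epow_comm f).
have eq1 : epow r = epow r.+1 ∘ q.
  rewrite e /q comp_sumr; apply: eq_bigr => i _.
  by rewrite compZr epowD.
pose p := fix p j := if j is j'.+1 then q ∘ p j' else lid a.
have pf j : f ∘ p j = p j ∘ f.
  elim: j => [|j IH] /=; first by rewrite comp1m compm1.
  by rewrite compA qf -!compA IH.
have eqj j : epow r.+1 = epow (r.+1 + j) ∘ p j.
  elim: j => [|j IH]; first by rewrite addn0 compm1.
  rewrite IH -[p j.+1]/(q ∘ p j) compA; congr (_ ∘ p j).
  have -> : (r.+1 + j = j.+1 + r)%N by rewrite addSnnS addnC.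
  by rewrite (addnC r.+1 j.+1) (epowD _ r) (epowD _ r.+1) -compA -eq1.
exists r.+1, (p r.+1); split => //.
Qed.
End LiftIdempotent.

Section QuotientSplit.
Variables (k : fieldType) (R : two_rig k) (I : two_ideal R).
Hypothesis fd : forall a : R, findim (lhom a a).

Lemma lift_idempotent (a : R) (x : qhom I a a) : q_comp x x = x ->
  exists2 e : lhom a a, e ∘ e = e & qp I e = x.
Proof.
have [f ->] := qr_ex x; rewrite q_compE => ff.
have [m [q [m0 mq fq]]] := epow_pi_regular f (fd a).
have pwE j : (0 < j)%N -> qp I (epow f j) = qp I f.
  elim: j => // -[|j] IH _; first by rewrite /= compm1.
  by rewrite -[epow f j.+2]/(f ∘ epow f j.+1) -q_compE IH // q_compE.
exists (epow f m ∘ q).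
  rewrite -compA (compA q) -(epow_comm m fq) !compA -epowD mq //.
rewrite -q_compE pwE // -[in LHS](pwE (m + m)%N) ?addn_gt0 ?m0 //.
by rewrite q_compE mq pwE.
Qed.

Lemma quotient_cauchy : cauchy_complete (quotient I).
Proof.
split; [exact: quotient_zero | exact: quotient_biproduct |].
move=> a x /lift_idempotent[e ee <-].
have [_ _ /(_ a e ee)[b [i [p [pi ip]]]]] := two_rigP R.
exists b, (qp I i), (qp I p).
by split; rewrite [LHS]q_compE ?pi ?ip.
Qed.
End QuotientSplit.

Lemma kSbar_findim (k : fieldType) (A B : kSbar k) : findim (lhom A B).
Proof.
pose a : fam (kS k) := kob A; pose b : fam (kS k) := kob B.
pose T : finType := {p : idx a * idx b & fbij (a p.1) (b p.2)}.
pose entry (f : mat a b) i j : freemod k (fbij (a i) (b j)) := ent f i j.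
exists T, (fun (f : khom A B) (t : T) =>
  entry (kval f) (tag t).1 (tag t).2 (tagged t)).
split=> [[[i j] s] c f g /=|f f0].
  by rewrite /entry kval_lin ent_lin !ffunE.
apply: kval_inj; rewrite kval0; apply: (@matP _ _ a b) => i j; rewrite ent0.
apply/ffunP => s; rewrite [RHS]ffunE.
exact: (f0 (Tagged (fun p : idx a * idx b => fbij (a p.1) (b p.2)) (i := (i, j)) s)).
Qed.

(* The quotient of the free 2-rig on one object by the 2-ideal generated by the
   exterior power of degree n + 1 of its generator *)
Definition ext_ideal (k : fieldType) (n : nat) : two_ideal (kSbar k) :=
  ideal_gen (is_ext_power n.+1 (kSbar_x k)).

Definition free_subdim (k : fieldType) (n : nat) : two_rig k :=
  TwoRig (quotient_cauchy (ext_ideal k n) (fun A => @kSbar_findim k A A)).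

Definition free_subdim_x (k : fieldType) (n : nat) : free_subdim k n := kSbar_x k.

(* Main.v *)
(* A map of 2-rigs out of kSbar is built from an object r in three steps.  The
   symmetric groups act on the tensor powers of r, and the action is compatible
   with concatenation of powers (coherence); sending a finite type A to the
   #|A|-th tensor power therefore gives a symmetric monoidal functor on kS.  It
   extends to the Cauchy completion by splitting, for each matrix idempotent, the
   idempotent that it induces on a biproduct in the target.  When r has
   subdimension n, the objects sent to zero form a 2-ideal that contains the
   exterior power of degree n + 1 of x, so the map descends to the quotient.
   Conversely every object of the quotient is a retract of a finite sum of tensor
   powers of x, and the maps between these powers are spanned by permutations.
   A monoidal transformation is hence determined by its component at x, which can
   be arbitrary because f ⊗ ... ⊗ f commutes with permutations: evaluation at x is
   fully faithful. *)
From mathcomp Require Import all_boot all_order all_fingroup all_algebra.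
From mathcomp Require Import boolp zify.
Require Import Defs.

Set Implicit Arguments.
Unset Strict Implicit.
Unset Printing Implicit Defensive.

Import GRing.Theory.
Local Open Scope ring_scope.

(** * Coherence in symmetric monoidal categories *)

(** Coherence is proved by computing with positions. A permutation acts by recursion: what remains
    of it after deleting 0 acts on the last factors, and then factor 0 is inserted at its place.
    Multiplicativity rests on one relation between two successive insertions, whose induction step
    is the Yang-Baxter equation. Powers such as [tpow r (m + n)] and [tpow r (n + m)] are equal only
    up to a proof; the action of [id] between them stands for the transport. Since [enum_rank] on a
    sum need not concatenate the two enumerations, the tensor comparison includes a renumbering, and
    the monoidal laws become equalities between composites of renumberings with the same ends. The
    functor built in this way sends x to an object isomorphic to r, whereas F(x) = r is asked as an
    equality; hence the transport along isomorphisms. Characteristic zero makes (n + 1)! invertible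
    and thereby the antisymmetrizer idempotent, so that the exterior power exists in the completion
    and becomes zero in the quotient. *)

Section Coherence.
Variables (k : fieldType) (C : linsmc k).
Implicit Types a b c d z w : C.

(** Composites associate to the left, so that [g ∘ f] is not a subterm of [x ∘ g ∘ f]; rewriting
    with [compKl] or [compKl3] applies an equation there. *)
Lemma compKl a b c d (g : lhom b c) (f : lhom a b) (h : lhom a c) (x : lhom c d) :
  g ∘ f = h -> x ∘ g ∘ f = x ∘ h.
Proof. by move=> <-; rewrite compA. Qed.

Lemma compKl3 a b c d z (h : lhom c d) (g : lhom b c) (f : lhom a b) (m : lhom a d)
    (x : lhom d z) : h ∘ g ∘ f = m -> x ∘ h ∘ g ∘ f = x ∘ m.
Proof. by move=> <-; rewrite !compA. Qed.

Lemma comp_epi a b c (e : lhom a b) (g h : lhom b c) : liso e -> g ∘ e = h ∘ e -> g = h.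
Proof. by move=> [e' [_ ee]] gh; rewrite -[g]compm1 -[h]compm1 -ee !compA gh. Qed.

Lemma comp_mono a b c (e : lhom b c) (g h : lhom a b) : liso e -> e ∘ g = e ∘ h -> g = h.
Proof. by move=> [e' [ee _]] gh; rewrite -[g]comp1m -[h]comp1m -ee -!compA gh. Qed.

Lemma tensl_comp a b c z (g : lhom b c) (f : lhom a b) :
  (g ∘ f) ⊗₁ lid z = (g ⊗₁ lid z) ∘ (f ⊗₁ lid z).
Proof. by rewrite -tensM comp1m. Qed.
Lemma tensr_comp a b c z (g : lhom b c) (f : lhom a b) :
  lid z ⊗₁ (g ∘ f) = (lid z ⊗₁ g) ∘ (lid z ⊗₁ f).
Proof. by rewrite -tensM comp1m. Qed.
Lemma tens_lr a b c d (f : lhom a b) (g : lhom c d) :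
  (f ⊗₁ lid d) ∘ (lid a ⊗₁ g) = f ⊗₁ g.
Proof. by rewrite -tensM comp1m compm1. Qed.

Lemma αnat a b c a' b' c' (f : lhom a a') (g : lhom b b') (h : lhom c c') :
  α a' b' c' ∘ (f ⊗₁ g ⊗₁ h) = (f ⊗₁ (g ⊗₁ h)) ∘ α a b c.
Proof. exact: (asc_nat (lsym C)). Qed.
Lemma αK a b c : αi a b c ∘ α a b c = lid _.
Proof. exact: (ascK (lsym C)). Qed.
Lemma αiK a b c : α a b c ∘ αi a b c = lid _.
Proof. exact: (asciK (lsym C)). Qed.
Lemma λnat a b (f : lhom a b) : λl b ∘ (lid 𝟙 ⊗₁ f) = f ∘ λl a.
Proof. exact: (lun_nat (lsym C)). Qed.
Lemma ρnat a b (f : lhom a b) : ρr b ∘ (f ⊗₁ lid 𝟙) = f ∘ ρr a.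
Proof. exact: (run_nat (lsym C)). Qed.
Lemma βnat a b a' b' (f : lhom a a') (g : lhom b b') :
  β a' b' ∘ (f ⊗₁ g) = (g ⊗₁ f) ∘ β a b.
Proof. exact: (brd_nat (lsym C)). Qed.
Lemma βK a b : β b a ∘ β a b = lid _.
Proof. exact: (brdK (lsym C)). Qed.

Lemma α_iso a b c : liso (α a b c).
Proof. by exists (αi a b c); rewrite αK αiK. Qed.
Lemma λ_iso a : liso (λl a).
Proof. by exists (λi a); rewrite (lunK (lsym C)) (luniK (lsym C)). Qed.
Lemma ρ_iso a : liso (ρr a).
Proof. by exists (ρi a); rewrite (runK (lsym C)) (runiK (lsym C)). Qed.
Lemma β_iso a b : liso (β a b).
Proof. by exists (β b a); rewrite !βK. Qed.

Lemma pent a b c d : (lid a ⊗₁ α b c d) ∘ α a (b ⊗ c) d ∘ (α a b c ⊗₁ lid d) =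
  α a b (c ⊗ d) ∘ α (a ⊗ b) c d.
Proof. by rewrite (pentagon (lsym C)). Qed.
Lemma tri a b : (lid a ⊗₁ λl b) ∘ α a 𝟙 b = ρr a ⊗₁ lid b.
Proof. exact: (triangle (lsym C)). Qed.
Lemma hexa a b c : α b c a ∘ β a (b ⊗ c) ∘ α a b c =
  (lid b ⊗₁ β a c) ∘ α b a c ∘ (β a b ⊗₁ lid c).
Proof. exact: (hexagon (lsym C)). Qed.

Lemma unit_tens_inj a b (f g : lhom a b) : lid 𝟙 ⊗₁ f = lid 𝟙 ⊗₁ g -> f = g.
Proof. by move=> e; apply: (comp_epi (λ_iso _)); rewrite -!λnat e. Qed.
Lemma tens_unit_inj a b (f g : lhom a b) : f ⊗₁ lid 𝟙 = g ⊗₁ lid 𝟙 -> f = g.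
Proof. by move=> e; apply: (comp_epi (ρ_iso _)); rewrite -!ρnat e. Qed.

(** Kelly's argument: tensoring with the unit is faithful and [α] is invertible, so that the
    pentagon and the triangle suffice after tensoring with [𝟙]. *)
Lemma λ_tens a b : λl (a ⊗ b) ∘ α 𝟙 a b = λl a ⊗₁ lid b.
Proof.
apply: unit_tens_inj; apply: (comp_epi (α_iso 𝟙 (𝟙 ⊗ a) b)).
apply: (comp_epi (liso_tens (α_iso 𝟙 𝟙 a) (liso_id b))).
rewrite tensr_comp (compKl3 _ (pent _ _ _ _)) compA tri.
by rewrite -αnat -(compA (α _ _ _)) -tensl_comp tri αnat tens1.
Qed.

Lemma ρ_tens a b : (lid a ⊗₁ ρr b) ∘ α a b 𝟙 = ρr (a ⊗ b).
Proof.
apply: tens_unit_inj; apply: (comp_mono (α_iso a b 𝟙)).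
rewrite tensl_comp compA αnat -tri tensr_comp -2!compA (compA _ _ (α a b 𝟙 ⊗₁ _)) pent.
by rewrite -tri -tens1 !compA αnat.
Qed.

(** The hexagon at [a, 𝟙, 𝟙], followed by the left unitor, gives the identity tensored with [𝟙], up
    to an invertible braiding. *)
Lemma λβ a : λl a ∘ β a 𝟙 = ρr a.
Proof.
apply: tens_unit_inj; apply: (comp_mono (β_iso a 𝟙)).
have h := congr1 (fun f => λl _ ∘ f) (hexa a 𝟙 𝟙).
rewrite !compA λ_tens -βnat λnat (compKl _ (λ_tens _ _)) -(compA _ _ (α _ _ _)) tri in h.
by rewrite h tensl_comp !compA.
Qed.

Lemma ρβ a : ρr a ∘ β 𝟙 a = λl a.
Proof. by rewrite -λβ -compA βK compm1. Qed.

Lemma λρ1 : λl 𝟙 = ρr 𝟙 :> lhom (𝟙 ⊗ 𝟙) (𝟙 : C).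
Proof.
apply: tens_unit_inj; rewrite -tri -λ_tens; congr (_ ∘ _).
by apply: (comp_mono (λ_iso 𝟙)); rewrite λnat.
Qed.

(* The braiding of the first two factors.  It is locked because rewriting with
   compA would otherwise unfold it in search of a composite; the same holds for
   the other locked definitions below. *)
Definition sw a b z : lhom (a ⊗ (b ⊗ z)) (b ⊗ (a ⊗ z)) :=
  locked (α b a z ∘ (β a b ⊗₁ lid z) ∘ αi a b z).

Lemma swE a b z : sw a b z ∘ α a b z = α b a z ∘ (β a b ⊗₁ lid z).
Proof. by rewrite /sw -lock (compKl _ (αK _ _ _)) compm1. Qed.

Lemma swap12E a z : swap12 a z = sw a a z.
Proof. by rewrite /sw -lock. Qed.

Lemma sw_nat a b z a' b' z' (f : lhom a a') (g : lhom b b') (h : lhom z z') :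
  sw a' b' z' ∘ (f ⊗₁ (g ⊗₁ h)) = (g ⊗₁ (f ⊗₁ h)) ∘ sw a b z.
Proof.
apply: (comp_epi (α_iso _ _ _)).
rewrite -compA -αnat compA swE -!compA swE !compA -αnat -!compA; congr (_ ∘ _).
by rewrite -!tensM βnat comp1m compm1.
Qed.

Lemma swK a b z : sw b a z ∘ sw a b z = lid _.
Proof.
apply: (comp_epi (α_iso _ _ _)).
by rewrite -compA swE compA swE -compA -tensl_comp βK tens1 compm1 comp1m.
Qed.

Lemma sw_hexa a b c z :
  α b c (a ⊗ z) ∘ sw a (b ⊗ c) z =
  (lid b ⊗₁ sw a c z) ∘ sw a b (c ⊗ z) ∘ (lid a ⊗₁ α b c z).
Proof.
apply: (comp_epi (α_iso a (b ⊗ c) z)).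
apply: (comp_epi (liso_tens (α_iso a b c) (liso_id z))).
rewrite (compKl _ (swE _ _ _)) compA -pent (compKl3 _ (pent _ _ _ _)).
rewrite !compA (compKl _ (swE _ _ _)).
rewrite -!(compA (_ ∘ α b (c ⊗ a) z)) -!tensl_comp compA hexa !tensl_comp !compA.
rewrite (compKl _ (αnat _ _ _)) compA -tensr_comp -swE tensr_comp.
rewrite (compKl3 _ (pent _ _ _ _)).
by rewrite -tens1 -[in RHS](compA _ (_ ⊗₁ (_ ⊗₁ _))) -αnat !compA.
Qed.

Lemma sw_αr a b z w :
  (lid b ⊗₁ α a z w) ∘ α b (a ⊗ z) w ∘ (sw a b z ⊗₁ lid w) =
  sw a b (z ⊗ w) ∘ (lid a ⊗₁ α b z w) ∘ α a (b ⊗ z) w.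
Proof.
apply: (comp_epi (liso_tens (α_iso a b z) (liso_id w))).
rewrite (compKl3 _ (pent _ _ _ _)) compA swE.
rewrite -!compA -tensl_comp swE tensl_comp !compA pent.
by rewrite -tens1 -!compA αnat.
Qed.

(** By [sw_hexa] both sides move [a] past [b ⊗ c]; exchanging [b] and [c] before or after is the
    naturality of [sw]. *)
Lemma sw_YB a b c z :
  sw b c (a ⊗ z) ∘ (lid b ⊗₁ sw a c z) ∘ sw a b (c ⊗ z) =
  (lid c ⊗₁ sw a b z) ∘ sw a c (b ⊗ z) ∘ (lid a ⊗₁ sw b c z).
Proof.
apply: (comp_epi (liso_tens (liso_id a) (α_iso b c z))).
rewrite -2!(compA (sw b c _)) -sw_hexa compA swE.
rewrite -(compA _ (lid a ⊗₁ _)) -tensr_comp swE tensr_comp compA -sw_hexa.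
by rewrite -[RHS]compA sw_nat tens1 compA.
Qed.

(** The second hexagon: since the braiding is a symmetry, it comes from inverting the first. *)
Lemma β_tensl a b c :
  β (a ⊗ b) c = sw a c b ∘ (lid a ⊗₁ β b c) ∘ α a b c.
Proof.
apply: (comp_mono (β_iso c (a ⊗ b))); rewrite βK.
apply: (comp_mono (α_iso a b c)); rewrite compm1.
rewrite /sw -lock !compA hexa (compKl _ (esym (tensl_comp _ _ _))) βK tens1 compm1.
by rewrite (compKl _ (αiK _ _ _)) compm1 -tensr_comp βK tens1 comp1m.
Qed.

Lemma λ_sw a z : λl (a ⊗ z) ∘ sw a 𝟙 z = lid a ⊗₁ λl z.
Proof.
apply: (comp_epi (α_iso _ _ _)).
by rewrite tri -compA swE compA λ_tens -tensl_comp λβ.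
Qed.
End Coherence.

(** * The action of permutations on tensor powers *)

(** Permutations are functions on [nat] whose values below m alone count: block sums and deletions
    involve no casts, and their identities are left to [lia]. *)
Definition perm_lt (m : nat) (f : nat -> nat) : Prop :=
  (forall i, i < m -> f i < m)%N /\
  (forall i j, i < m -> j < m -> f i = f j -> i = j)%N.

(* The map of {0, ..., m-1} that remains of f after deleting 0 from the domain
   and f 0 from the codomain *)
Definition tail_fun (f : nat -> nat) (i : nat) : nat := unbump (f 0%N) (f i.+1).

Lemma perm_lt_neq m f i j :
  perm_lt m f -> (i < m)%N -> (j < m)%N -> i <> j -> f i <> f j.
Proof. by move=> [_ f2] im jm ij /(f2 _ _ im jm). Qed.

Lemma perm_lt_tail m f : perm_lt m.+1 f -> perm_lt m (tail_fun f).
Proof.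
move=> pf; have [f1 f2] := pf; have f0 : (f 0%N < m.+1)%N by apply: f1.
have fS i : (i < m)%N -> (f i.+1 < m.+1)%N /\ f i.+1 <> f 0%N.
  by move=> im; split; [apply: f1 | apply: (perm_lt_neq pf)].
rewrite /tail_fun /unbump; split=> [i /fS|i j im jm]; first by lia.
by move: (fS i im) (fS j jm) => *; suff [] : i.+1 = j.+1 by []; apply: f2; lia.
Qed.

Section TensorPowers.
Variables (k : fieldType) (C : linsmc k) (r : C).
Local Notation P := (tpow r).

Definition tinsert m j : lhom (P m.+1) (P m.+1) := locked (tmove r m j).

Lemma tinsert0 m : tinsert m 0%N = lid _.
Proof. by rewrite /tinsert -lock; case: m. Qed.
Lemma tinsertS m j : tinsert m.+1 j.+1 = (lid r ⊗₁ tinsert m j) ∘ sw r r (P m).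
Proof. by rewrite /tinsert -!lock -swap12E. Qed.

Lemma swr_nat m n (f : lhom (P m) (P n)) :
  sw r r _ ∘ (lid r ⊗₁ (lid r ⊗₁ f)) = (lid r ⊗₁ (lid r ⊗₁ f)) ∘ sw r r _.
Proof. exact: sw_nat. Qed.

(** Two factors may be inserted in either order: the second one ends at [bump a b], and the first
    one has index [unbump (bump a b) a] among the others. The induction step is [sw_YB]. *)
Lemma tinsertC m a b : (a <= m.+1)%N -> (b <= m)%N ->
  tinsert m.+1 a ∘ (lid r ⊗₁ tinsert m b) =
  tinsert m.+1 (bump a b) ∘ (lid r ⊗₁ tinsert m (unbump (bump a b) a)) ∘ sw r r (P m).
Proof.
elim: m a b => [|m IH] [|a] [|b] am bm //; rewrite ?tinsert0.
- by rewrite -[bump 0 0]/1%N tinsertS !tinsert0 !tens1 !comp1m ?compm1 swK.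
- by rewrite !tens1 !comp1m compm1 /unbump /= subn1 tinsertS.
- by rewrite -[bump 0 0]/1%N tinsertS !tinsert0 !tens1 !comp1m ?compm1 swK.
- by rewrite -[bump 0 b.+1]/b.+2 tens1 comp1m compm1 [in RHS]tinsertS -compA swK compm1.
- by rewrite !tens1 comp1m compm1 /unbump /= subn1 tinsertS.
rewrite (_ : bump a.+1 b.+1 = (bump a b).+1); last by rewrite /bump; lia.
rewrite (_ : unbump _ a.+1 = (unbump (bump a b) a).+1); last by rewrite /unbump /bump; lia.
rewrite !tinsertS !tensr_comp !compA (compKl _ (swr_nat (tinsert m b))) compA -tensr_comp IH //.
rewrite !tensr_comp (compKl _ (swr_nat (tinsert m _))) compA.
by rewrite -!compA; do 2!congr (_ ∘ _); rewrite !compA sw_YB.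
Qed.

(** Unequal lengths give the zero map, a default for which naturality statements such as [smap_tact]
    and [fpow_tact] hold for all m and n. *)
Fixpoint tact_rec (m n : nat) (f : nat -> nat) : lhom (P m) (P n) :=
  match m, n with
  | 0, 0 => lid _
  | m'.+1, n'.+1 => tinsert n' (f 0%N) ∘ (lid r ⊗₁ tact_rec m' n' (tail_fun f))
  | _, _ => 0
  end.

(* The action of the permutation f of {0, ..., m-1}, for n = m; keeping two
   indices avoids transports along equalities between them. *)
Definition tact m n (f : nat -> nat) : lhom (P m) (P n) := locked (tact_rec m n f).

Lemma tact00 f : tact 0%N 0%N f = lid _.
Proof. by rewrite /tact -lock. Qed.
Lemma tactSS m n f :
  tact m.+1 n.+1 f = tinsert n (f 0%N) ∘ (lid r ⊗₁ tact m n (tail_fun f)).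
Proof. by rewrite /tact -!lock. Qed.

Lemma tact_neq m n f : m != n -> tact m n f = 0.
Proof.
elim: m n f => [|m IH] [|n] f //; try by rewrite /tact -lock.
by rewrite eqSS => mn; rewrite tactSS IH // tensm0 compm0.
Qed.

Lemma tact_ext m n f g : (forall i, (i < m)%N -> f i = g i) -> tact m n f = tact m n g.
Proof.
elim: m n f g => [|m IH] [|n] f g e; rewrite ?tact00 //; try by rewrite !tact_neq.
by rewrite !tactSS e // (IH _ _ (tail_fun g)) // => i im; rewrite /tail_fun !e.
Qed.

Lemma tact_id m f : (forall i, (i < m)%N -> f i = i) -> tact m m f = lid _.
Proof.
elim: m f => [|m IH] f e; first exact: tact00.
rewrite tactSS e // tinsert0 comp1m IH ?tens1 // => i im.
by rewrite /tail_fun !e // /unbump /= subn1.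
Qed.

Lemma tact_iso m n : m = n -> liso (tact m n id).
Proof. by move=> ->; rewrite tact_id //; apply: liso_id. Qed.

Lemma tactSS0 m n f : f 0%N = 0%N ->
  tact m.+1 n.+1 f = lid r ⊗₁ tact m n (fun i => (f i.+1).-1).
Proof.
move=> f0; rewrite tactSS f0 tinsert0 comp1m; congr (_ ⊗₁ _); apply: tact_ext => i _.
by rewrite /tail_fun f0 /unbump; lia.
Qed.

(** By [tinsertC], the insertion of factor 0 at [f 0] trades places with that of the moved factor at
    [f j]. What is left of [f] has j deleted from its domain and [f j] from its codomain. *)
Lemma tact_tinsert m f j : perm_lt m.+1 f -> (j <= m)%N ->
  tact m.+1 m.+1 f ∘ tinsert m j =
  tinsert m (f j) ∘ (lid r ⊗₁ tact m m (unbump (f j) \o f \o bump j)).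
Proof.
elim: m f j => [|m IH] f [|j] pf // jm; try by rewrite tinsert0 compm1 tactSS.
rewrite tactSS tinsertS compA -(compA (tinsert _ _)) -tensr_comp IH //; last exact: perm_lt_tail.
have [f1 f2] := pf; have ne : f j.+1 <> f 0%N by apply: (perm_lt_neq pf).
rewrite tensr_comp compA tinsertC; [|exact: f1|]; last first.
  by have := perm_lt_tail pf; case=> + _; apply.
have -> : bump (f 0%N) (tail_fun f j) = f j.+1.
  by rewrite /tail_fun /unbump /bump; lia.
rewrite -!compA; congr (_ ∘ _); rewrite -swr_nat (compA (sw _ _ _)) swK comp1m.
rewrite -tensr_comp; congr (_ ⊗₁ _); rewrite tactSS.
congr (_ ∘ (_ ⊗₁ _)); apply: tact_ext => i im; rewrite /tail_fun /=.
have bS : bump j.+1 i.+1 = (bump j i).+1 by rewrite /bump; lia.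
rewrite bS -[bump j.+1 0%N]/0%N; have bm : (bump j i < m.+1)%N by rewrite /bump; lia.
have n0 : f (bump j i).+1 <> f 0%N by apply: (perm_lt_neq pf).
have nj : f (bump j i).+1 <> f j.+1.
  by apply: (perm_lt_neq pf) => //; rewrite /bump; lia.
by move: ne n0 nj; rewrite /unbump; lia.
Qed.

(** Induction on the length: [tact_tinsert] carries [g] past the outer insertion of [f], which
    leaves a composite on one factor fewer. *)
Lemma tact_comp m n p f g : m = n -> n = p -> perm_lt m f -> perm_lt m g ->
  tact n p g ∘ tact m n f = tact m p (g \o f).
Proof.
move=> -> ->; elim: p f g {m n} => [|m IH] f g pf pg; first by rewrite !tact00 comp1m.
have f0 : (f 0%N <= m)%N by case: pf => + _; apply.
rewrite (tactSS m m f) compA tact_tinsert // -compA -tensr_comp IH; last 2 first.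
- exact: perm_lt_tail.
- have bm i : (i < m)%N -> (bump (f 0%N) i < m.+1)%N by rewrite /bump; lia.
  have ne i : (i < m)%N -> g (bump (f 0%N) i) <> g (f 0%N).
    by move=> im; apply: (perm_lt_neq pg (bm _ im)) => //; rewrite /bump; lia.
  have [g1 g2] := pg; split=> [i im|i j im jm] /=.
    by move: (g1 _ (bm _ im)) (g1 _ f0) (ne i im); rewrite /unbump; lia.
  move: (ne i im) (ne j jm) (g2 _ _ (bm _ im) (bm _ jm)).
  by rewrite /unbump /bump; lia.
rewrite tactSS; congr (_ ∘ (_ ⊗₁ _)); apply: tact_ext => i im.
rewrite /tail_fun /=; congr (unbump _ (g _)).
have : f i.+1 <> f 0%N by apply: (perm_lt_neq pf).
by rewrite /unbump /bump; lia.
Qed.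

Lemma tperm_actE m (s : 'S_m) (f : nat -> nat) : (forall i : 'I_m, f i = s i) ->
  tperm_act r s = tact m m f.
Proof.
elim: m s f => [|m IH] s f e; first by rewrite tact00.
rewrite tactSS [LHS]/= -(e ord0) /tinsert -lock (IH _ (tail_fun f)) // => i.
rewrite /tail_fun (e ord0) -[i.+1]/(lift ord0 i : nat) e -perm_tail_lift /=.
by rewrite bumpK permE.
Qed.

Lemma tperm_act_comp m (s t : 'S_m) :
  tperm_act r t ∘ tperm_act r s = tperm_act r (s * t)%g.
Proof.
pose F (u : 'S_m) i := if insub i is Some j then val (u j) else 0%N.
have FE u (i : 'I_m) : F u i = u i by rewrite /F valK.
have pF u : perm_lt m (F u).
  split=> [i im|i j im jm]; rewrite -[i]/(val (Ordinal im)); first by rewrite FE.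
  by rewrite -[j]/(val (Ordinal jm)) !FE => /val_inj/perm_inj ->.
rewrite (tperm_actE (FE s)) (tperm_actE (FE t)) tact_comp //; apply/esym/tperm_actE.
by move=> i; rewrite /= !FE permM.
Qed.

Lemma antisym_idem m : m`!%:R != 0 :> k -> antisym r m ∘ antisym r m = antisym r m.
Proof.
move=> m0; rewrite /antisym compZl compZr; congr (_ *: _).
rewrite comp_suml; under eq_bigr => t _.
  (* Replacing s by s t⁻¹ turns the product of two signed permutations into the single term of s, so
     that each t contributes the same sum. *)
  rewrite compZl comp_sumr scaler_sumr (reindex_inj (mulIg t^-1%g)) /=.
  under eq_bigr => s _.
    rewrite compZr scalerA tperm_act_comp mulgKV odd_permM odd_permV.
    rewrite signr_addb mulrCA -signr_addb addbb mulr1; over.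
  over.
by rewrite sumr_const card_Sn -scaler_nat scalerA mulVf // scale1r.
Qed.
End TensorPowers.

(** * Concatenation of tensor powers *)

Section TensorPowerSum.
Variables (k : fieldType) (C : linsmc k) (r : C).
Local Notation P := (tpow r).
Local Notation tinsert := (tinsert r).
Local Notation tact := (tact r).

Fixpoint tcat_rec m n : lhom (P m ⊗ P n) (P (m + n)) :=
  match m return lhom (P m ⊗ P n) (P (m + n)) with
  | 0 => λl (P n)
  | m'.+1 => (lid r ⊗₁ tcat_rec m' n) ∘ α r (P m') (P n)
  end.
Definition tcat m n : lhom (P m ⊗ P n) (P (m + n)) := locked (tcat_rec m n).

Lemma tcat0 n : tcat 0%N n = λl (P n).
Proof. by rewrite /tcat -lock. Qed.
Lemma tcatS m n : tcat m.+1 n = (lid r ⊗₁ tcat m n) ∘ α r (P m) (P n).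
Proof. by rewrite /tcat -!lock. Qed.

Lemma tcat_iso m n : liso (tcat m n).
Proof.
elim: m => [|m IH]; first by rewrite tcat0; apply: λ_iso.
rewrite tcatS; apply: liso_comp (α_iso _ _ _).
exact: liso_tens (liso_id _) IH.
Qed.

Lemma tcatSSE m n :
  tcat m.+2 n = (lid r ⊗₁ (lid r ⊗₁ tcat m n)) ∘ (lid r ⊗₁ α r (P m) (P n)) ∘ α r (P m.+1) (P n).
Proof. by rewrite tcatS tcatS tensr_comp. Qed.

Lemma tcat_tinsert m n j : (j <= m)%N ->
  tcat m.+1 n ∘ (tinsert m j ⊗₁ lid (P n)) = tinsert (m + n) j ∘ tcat m.+1 n.
Proof.
elim: m j => [|m IH] [|j] // jm; try by rewrite !tinsert0 tens1 compm1 comp1m.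
have -> : tinsert (m.+1 + n) j.+1 = (lid r ⊗₁ tinsert (m + n) j) ∘ sw r r (P (m + n)) by apply: tinsertS.
rewrite tinsertS tensl_comp compA {1}tcatS (compKl _ (αnat _ _ _)) compA -tensr_comp IH //.
rewrite tensr_comp -!compA; congr (_ ∘ _); rewrite tcatSSE !compA.
rewrite sw_nat -!compA; rewrite [in RHS](compA (sw _ _ _)) -sw_αr !compA.
by rewrite tcatS tensr_comp.
Qed.

Definition sum_fun (m m' : nat) (f g : nat -> nat) (i : nat) : nat :=
  if (i < m)%N then f i else (m' + g (i - m))%N.

Lemma tcat_tact m n f g : perm_lt m f ->
  tcat m n ∘ (tact m m f ⊗₁ tact n n g) = tact (m + n) (m + n) (sum_fun m m f g) ∘ tcat m n.
Proof.
elim: m f => [|m IH] f pf.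
  rewrite tact00 tcat0 λnat; congr (_ ∘ _); apply: tact_ext => i _.
  by rewrite /sum_fun subn0.
have -> : tact (m.+1 + n) (m.+1 + n) (sum_fun m.+1 m.+1 f g) =
    tinsert (m + n) (f 0%N) ∘
      (lid r ⊗₁ tact (m + n) (m + n) (tail_fun (sum_fun m.+1 m.+1 f g))).
  exact: tactSS.
have f0 : (f 0%N <= m)%N by have [+ _] := pf; apply.
rewrite tactSS -[tact n n g]comp1m tensM compA tcat_tinsert // -!compA; congr (_ ∘ _).
rewrite tcatS -compA αnat !compA -!tensr_comp IH; last exact: perm_lt_tail.
congr ((_ ⊗₁ (_ ∘ _)) ∘ _); apply: tact_ext => i im.
rewrite /tail_fun /sum_fun ltnS leq0n subSS [(i.+1 < m.+1)%N]ltnS.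
by case: ltnP => // mi; rewrite /unbump; lia.
Qed.

Lemma tcat_asc m n p :
  tact (m + n + p) (m + (n + p)) id ∘ tcat (m + n) p ∘ (tcat m n ⊗₁ lid (P p)) =
  tcat m (n + p) ∘ (lid (P m) ⊗₁ tcat n p) ∘ α (P m) (P n) (P p).
Proof.
elim: m => [|m IH].
  by rewrite [tact _ _ _]tact_id // comp1m !tcat0 λnat -compA λ_tens.
have -> : tact (m.+1 + n + p) (m.+1 + (n + p)) id = lid r ⊗₁ tact (m + n + p) (m + (n + p)) id.
  rewrite -[LHS]/(tact (m + n + p).+1 (m + (n + p)).+1 id) tactSS0 //.
have -> : tcat (m.+1 + n) p = (lid r ⊗₁ tcat (m + n) p) ∘ α r (P (m + n)) (P p).
  exact: tcatS.
rewrite !tcatS tensl_comp !compA -tensr_comp (compKl _ (αnat _ _ _)) compA -tensr_comp IH.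
rewrite !tensr_comp (compKl3 _ (pent _ _ _ _)) compA.
by rewrite -!compA; congr (_ ∘ _); rewrite !compA -tens1 αnat.
Qed.

Lemma tcat_run m : tact (m + 0) m id ∘ tcat m 0%N = ρr (P m).
Proof.
elim: m => [|m IH]; first by rewrite [tact _ _ _]tact_id // comp1m tcat0 λρ1.
rewrite -[tact _ _ _]/(tact (m + 0).+1 m.+1 id) tactSS0 // tcatS compA -tensr_comp.
by rewrite (IH : tact _ _ (fun i => i) ∘ _ = _) ρ_tens.
Qed.

(** Moving one factor past a block of n factors inserts it at position n; the block is peeled with
    [sw_hexa]. *)
Lemma tcat_sw m n :
  tact (n + m.+1) (n + m).+1 id ∘ tcat n m.+1 ∘ sw r (P n) (P m) =
  tinsert (n + m) n ∘ (lid r ⊗₁ tcat n m).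
Proof.
elim: n => [|n IH]; first by rewrite [tact _ _ _]tact_id // tinsert0 !comp1m !tcat0 λ_sw.
have -> : tact (n.+1 + m.+1) (n.+1 + m).+1 id = lid r ⊗₁ tact (n + m.+1) (n + m).+1 id.
  by rewrite -[LHS]/(tact (n + m.+1).+1 (n + m).+2 id) tactSS0.
have -> : tinsert (n.+1 + m) n.+1 = (lid r ⊗₁ tinsert (n + m) n) ∘ sw r r (P (n + m)) by apply: tinsertS.
rewrite !tcatS !compA -tensr_comp (compKl _ (sw_hexa _ _ _ _)) !compA -tensr_comp IH.
by rewrite !tensr_comp (compKl _ (esym (sw_nat _ _ _))) !compA.
Qed.

(** The braiding of powers is the block transposition: [β_tensl] peels off one factor, which
    [tcat_sw] inserts after the n factors of the other block. *)
Lemma tcat_brd m n :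
  tact (m + n) (n + m) (fun i => if (i < m)%N then (n + i)%N else (i - m)%N) ∘ tcat m n =
  tcat n m ∘ β (P m) (P n).
Proof.
elim: m => [|m IH].
  rewrite tcat0 -ρβ -tcat_run !compA tact_comp ?addn0 //; last first.
    by split=> [i|i j] /=; rewrite !subn0.
  by rewrite [tact _ _ _]tact_id ?comp1m // => i _ /=; rewrite subn0.
have tid : tact (n + m.+1) (n + m).+1 id ∘ tact (n + m).+1 (n + m.+1) id = lid _.
  by rewrite tact_comp ?addnS // tact_id.
have tid' : tact (n + m).+1 (n + m.+1) id ∘ tact (n + m.+1) (n + m).+1 id = lid _.
  by rewrite tact_comp ?addnS // tact_id.
rewrite β_tensl !compA.
apply: (@comp_mono _ _ _ _ _ (tact (n + m.+1) (n + m).+1 id)).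
  by exists (tact (n + m).+1 (n + m.+1) id).
rewrite !compA tcat_sw tact_comp ?addnS //; last 2 first.
- by lia.
- split=> [i im|i j im jm]; first by case: (ltnP i m.+1); lia.
  by case: (ltnP i m.+1); case: (ltnP j m.+1); lia.
set F := _ \o _.
have -> : tact (m.+1 + n) (n + m).+1 F =
    tinsert (n + m) n ∘ (lid r ⊗₁ tact (m + n) (n + m) (tail_fun F)).
  by rewrite -[LHS]/(tact (m + n).+1 (n + m).+1 F) tactSS /F /= addn0.
rewrite tcatS -!compA; congr (_ ∘ _); rewrite !compA -!tensr_comp -IH.
congr ((_ ⊗₁ (_ ∘ _)) ∘ _); apply: tact_ext => i im.
have {}im : (i < m + n)%N by exact: im.
rewrite /F /tail_fun /= addn0 ltnS subSS.
by case: ltnP => mi; rewrite /unbump; lia.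
Qed.
End TensorPowerSum.

(** * Tensor powers indexed by finite types *)

Section Numberings.
Implicit Types A B : finType.

Definition numbering A (m : nat) (e : A -> nat) : Prop :=
  [/\ forall a, (e a < m)%N, injective e & forall i, (i < m)%N -> exists a, e a = i].

Definition code A (a : A) : nat := enum_rank a.

Lemma code_numbering A : numbering #|A| (@code A).
Proof.
split=> [a|a b /val_inj/enum_rank_inj //|i im]; first exact: ltn_ord.
by exists (enum_val (Ordinal im)); rewrite /code enum_valK.
Qed.

Lemma numbering_card A m e : @numbering A m e -> m = #|A|.
Proof.
move=> [e1 e2 e3]; rewrite -[LHS]card_ord; apply/esym.
apply: (@bij_eq_card _ _ (fun a => Ordinal (e1 a))); apply: inj_card_bij.
  by move=> a b /(congr1 val)/e2.
rewrite -(card_codom (f := fun a => Ordinal (e1 a))); last by move=> a b /(congr1 val)/e2.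
apply: subset_leq_card; apply/subsetP => i _; apply/codomP.
by have [a ea] := e3 i (ltn_ord i); exists a; apply: val_inj.
Qed.

Lemma numbering_bij A B m e (f : fbij A B) : numbering m e -> numbering m (e \o fw f).
Proof.
move=> [e1 e2 e3]; split=> [a|a b /e2/(can_inj (fwK f)) //|i /e3[b <-]]; first exact: e1.
by exists (bw f b); rewrite /= bwK.
Qed.

Definition csum (A B : Type) m (e : A -> nat) (d : B -> nat) (s : A + B) : nat :=
  match s with inl a => e a | inr b => (m + d b)%N end.

Lemma csum_numbering A B m n (e : A -> nat) (d : B -> nat) :
  numbering m e -> numbering n d -> @numbering (fsum A B) (m + n) (csum m e d).
Proof.
move=> [e1 e2 e3] [d1 d2 d3]; split.
- by case=> [a|b] /=; [have := e1 a | have := d1 b]; lia.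
- move=> [a|b] [a'|b'] /=; first by move/e2 ->.
  + by have := e1 a; lia.
  + by have := e1 a'; lia.
  + by move/addnI/d2 ->.
- move=> i im; have [/e3[a <-]|mi] := ltnP i m; first by exists (inl a).
  have /d3[b bi] : (i - m < n)%N by lia.
  by exists (inr b); rewrite /= bi; lia.
Qed.

Lemma numbering_perm A m e e' f : @numbering A m e -> numbering m e' ->
  (forall a, f (e a) = e' a) -> perm_lt m f.
Proof.
move=> [_ _ e3] [e1' e2' _] fe; split=> [i /e3[a <-]|i j /e3[a <-] /e3[b <-]].
  by rewrite fe.
by rewrite !fe => /e2' ->.
Qed.
End Numberings.

Section SumBijections.
Implicit Types A B D : finType.

Definition fs_map A B A' B' (f : fbij A A') (g : fbij B B') :
  fbij (fsum A B) (fsum A' B') := thom fbij_data f g.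
Definition fs_asc A B D : fbij (fsum (fsum A B) D) (fsum A (fsum B D)) :=
  asc fbij_data A B D.
Definition fs_lun A : fbij (fsum fvoid A) A := lun fbij_data A.
Definition fs_run A : fbij (fsum A fvoid) A := run fbij_data A.
Definition fs_brd A B : fbij (fsum A B) (fsum B A) := brd fbij_data A B.

Lemma csum_map A B A' B' (f : fbij A A') (g : fbij B B') m (e : A' -> nat) (d : B' -> nat) :
  csum m (e \o fw f) (d \o fw g) = csum m e d \o fw (fs_map f g).
Proof.
by apply: functional_extensionality_dep => -[a|b]; rewrite /= mk_fbijE.
Qed.
End SumBijections.

Section Renumbering.
Variables (k : fieldType) (C : linsmc k) (r : C).
Local Notation P := (tpow r).
Local Notation tact := (tact r).
Local Notation tcat := (tcat r).
Implicit Types A B : finType.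

(* Moves the factor numbered e a to position e' a; the default value 0 plays no
   role when e is a numbering of A by 0, ..., m-1. *)
Definition renum A m n (e e' : A -> nat) : lhom (P m) (P n) :=
  locked (tact m n (fun i => if [pick a | e a == i] is Some a then e' a else 0%N)).

Lemma renumE A m n e e' f : numbering m e -> (forall a, f (e a) = e' a) ->
  @renum A m n e e' = tact m n f.
Proof.
move=> [_ e2 e3] fe; rewrite /renum -lock; apply: tact_ext => i /e3[a <-]; rewrite fe.
by case: pickP => [b /eqP/e2 ->|/(_ a)/eqP].
Qed.

Lemma renum_fun A m n e (e' : A -> nat) : numbering m e ->
  exists2 f, forall a, f (e a) = e' a & renum m n e e' = tact m n f.
Proof.
move=> ne; rewrite /renum -lock; eexists; last reflexivity.
by move=> a /=; case: pickP ne => [b /eqP eb [_ /(_ _ _ eb) -> //]|/(_ a)/eqP].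
Qed.

Lemma renum_id A m (e : A -> nat) : numbering m e -> renum m m e e = lid _.
Proof. by move=> ne; rewrite (renumE _ (f := id)) // tact_id. Qed.

(** A composite of renumberings depends on its two end numberings alone; the laws of [tpow_mu]
    reduce to this once the concatenation laws are applied. *)
Lemma renum_comp A m n p (e e' e'' : A -> nat) :
  numbering m e -> numbering n e' -> numbering p e'' ->
  renum n p e' e'' ∘ renum m n e e' = renum m p e e''.
Proof.
move=> h h' h''; have [f fe ->] := renum_fun n e' h; have [g ge ->] := renum_fun p e'' h'.
have mn : m = n by rewrite (numbering_card h) (numbering_card h').
have np : n = p by rewrite (numbering_card h') (numbering_card h'').
rewrite tact_comp //.
- by rewrite (renumE _ (f := g \o f)) // => a /=; rewrite fe ge.
- by move: mn h' np => <- h' _; apply: numbering_perm h h' fe.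
- by move: mn np h' h'' => -> <- h' h''; apply: numbering_perm h' h'' ge.
Qed.

Lemma renum_bij A B m n (e e' : B -> nat) (f : fbij A B) : numbering m e ->
  renum m n (e \o fw f) (e' \o fw f) = renum m n e e'.
Proof.
move=> h; have [g ge ->] := renum_fun n e' h; apply: renumE; first exact: numbering_bij.
by move=> a /=; rewrite ge.
Qed.

Lemma tcat_renum A B m m' n n' (e e' : A -> nat) (d d' : B -> nat) :
  numbering m e -> numbering m' e' -> numbering n d -> numbering n' d' ->
  tcat m' n' ∘ (renum m m' e e' ⊗₁ renum n n' d d') =
  @renum (fsum A B) (m + n) (m' + n') (csum m e d) (csum m' e' d') ∘ tcat m n.
Proof.
move=> he he' hd hd'.
have mm' : m' = m by rewrite (numbering_card he) (numbering_card he').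
have nn' : n' = n by rewrite (numbering_card hd) (numbering_card hd').
subst m' n'; have [f fe ->] := renum_fun m e' he; have [g ge ->] := renum_fun n d' hd.
rewrite tcat_tact; last exact: numbering_perm he he' fe.
congr (_ ∘ _); apply/esym/renumE; first exact: csum_numbering.
move=> [a|b]; rewrite /sum_fun /=; first by case: he => -> _ _; rewrite fe.
by rewrite ltnNge leq_addr /= addKn ge.
Qed.

Definition tpow_map A B (f : fbij A B) : lhom (P #|A|) (P #|B|) :=
  renum #|A| #|B| (@code A) (@code B \o fw f).

Definition tpow_mu A B : lhom (P #|A| ⊗ P #|B|) (P #|fsum A B|) :=
  @renum (fsum A B) (#|A| + #|B|) #|fsum A B| (csum #|A| (@code A) (@code B))
    (@code (fsum A B)) ∘ tcat #|A| #|B|.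

Definition vnum (v : fvoid) : nat := match v with end.

Lemma vnum_numbering : numbering 0 vnum.
Proof. by split=> [[]|[]|]. Qed.

Definition tpow_eps : lhom 𝟙 (P #|fvoid|) := renum 0 #|fvoid| vnum (@code fvoid).

Lemma renum_iso A m n (e e' : A -> nat) : numbering m e -> numbering n e' ->
  liso (renum m n e e').
Proof. by move=> h h'; exists (renum n m e' e); rewrite !renum_comp ?renum_id. Qed.

Ltac num := repeat first [exact: code_numbering | exact: vnum_numbering
  | apply: csum_numbering | apply: numbering_bij].
Local Hint Extern 0 (numbering _ _) => num : core.

Lemma tpow_map_id A : tpow_map (fbij_id A) = lid _.
Proof.
rewrite /tpow_map (renumE _ (f := id)) ?tact_id // => a.
by rewrite /= mk_fbijE.
Qed.

Lemma tpow_map_comp A B D (g : fbij B D) (f : fbij A B) :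
  tpow_map (fbij_comp g f) = tpow_map g ∘ tpow_map f.
Proof.
rewrite /tpow_map -(renum_bij _ _ f) // renum_comp //.
by congr renum; apply: functional_extensionality_dep => a; rewrite /= mk_fbijE.
Qed.

Lemma tpow_mu_iso A B : liso (tpow_mu A B).
Proof.
rewrite /tpow_mu; apply: liso_comp; last exact: tcat_iso.
exact: (renum_iso (csum_numbering (code_numbering A) (code_numbering B))
  (code_numbering (fsum A B))).
Qed.

Lemma tpow_eps_iso : liso tpow_eps.
Proof. exact: (renum_iso vnum_numbering (code_numbering fvoid)). Qed.

Lemma tpow_mu_nat A B A' B' (f : fbij A A') (g : fbij B B') :
  tpow_mu A' B' ∘ (tpow_map f ⊗₁ tpow_map g) = tpow_map (fs_map f g) ∘ tpow_mu A B.
Proof.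
rewrite /tpow_mu /tpow_map -compA tcat_renum // !compA; congr (_ ∘ _).
rewrite -(renum_bij _ (@code (fsum A' B')) (fs_map f g)) // csum_map renum_comp //.
by rewrite renum_comp.
Qed.

Lemma tpow_mu_asc A B D :
  tpow_map (fs_asc A B D) ∘ tpow_mu (fsum A B) D ∘ (tpow_mu A B ⊗₁ lid _) =
  tpow_mu A (fsum B D) ∘ (lid _ ⊗₁ tpow_mu B D) ∘ α _ _ _.
Proof.
rewrite /tpow_mu /tpow_map tensl_comp tensr_comp !compA.
rewrite -{1}(renum_id (code_numbering D)) -{1}(renum_id (code_numbering A)).
rewrite (compKl _ (tcat_renum _ _ _ _)) // (compKl _ (tcat_renum _ _ _ _)) // !compA.
rewrite [in RHS]renum_comp // (compKl3 _ (esym (tcat_asc r _ _ _))) !compA.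
(* The transport is itself a renumbering: both bracketings number a triple sum alike, by
   associativity of addition. *)
have -> : tact (#|A| + #|B| + #|D|) (#|A| + (#|B| + #|D|)) id =
    renum _ _ (csum (#|A| + #|B|) (csum #|A| (@code A) (@code B)) (@code D))
      (csum #|A| (@code A) (csum #|B| (@code B) (@code D)) \o fw (fs_asc A B D)).
  apply/esym/renumE => //.
  by case=> [[a|b]|d] /=; rewrite mk_fbijE //= addnA.
rewrite -[in RHS](renum_bij _ (@code (fsum A (fsum B D))) (fs_asc A B D)) //.
by rewrite !renum_comp.
Qed.

Lemma tpow_mu_lun A :
  tpow_map (fs_lun A) ∘ tpow_mu fvoid A ∘ (tpow_eps ⊗₁ lid _) = λl _.
Proof.
rewrite /tpow_mu /tpow_map /tpow_eps -(renum_id (code_numbering A)) compA -compA.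
rewrite (tcat_renum vnum_numbering (code_numbering fvoid)) // tcat0 !compA.
rewrite renum_comp // renum_comp // (renumE _ (f := id)) //; last first.
  by case=> [[]|a]; rewrite /= mk_fbijE.
by rewrite [tact _ _ _]tact_id // comp1m.
Qed.

Lemma tpow_mu_run A :
  tpow_map (fs_run A) ∘ tpow_mu A fvoid ∘ (lid _ ⊗₁ tpow_eps) = ρr _.
Proof.
rewrite /tpow_mu /tpow_map /tpow_eps -(renum_id (code_numbering A)) compA -compA.
rewrite (tcat_renum (code_numbering A) (code_numbering A) vnum_numbering) // !compA.
rewrite renum_comp // renum_comp // -tcat_run (renumE _ (f := id)) //.
by case=> [a|[]]; rewrite /= mk_fbijE.
Qed.

Lemma tpow_mu_brd A B : tpow_map (fs_brd A B) ∘ tpow_mu A B = tpow_mu B A ∘ β _ _.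
Proof.
rewrite /tpow_mu -(compA _ _ (β _ _)) -tcat_brd !compA; congr (_ ∘ _).
rewrite /tpow_map renum_comp //.
have -> : tact (#|A| + #|B|) (#|B| + #|A|)
      (fun i => if (i < #|A|)%N then (#|B| + i)%N else (i - #|A|)%N) =
    renum _ _ (csum #|A| (@code A) (@code B))
      (csum #|B| (@code B) (@code A) \o fw (fs_brd A B)).
  apply/esym/renumE => //; case=> [a|b]; rewrite /= mk_fbijE /=.
    by case: (code_numbering A) => -> _ _.
  by rewrite ltnNge leq_addr addKn.
by rewrite -[in RHS](renum_bij _ (@code (fsum B A)) (fs_brd A B)) // renum_comp.
Qed.
End Renumbering.

(** * The functor on [kS] given by tensor powers *)

Section LinearExtension.
Variables (k : fieldType) (X : finType) (V : lmodType k).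

Definition linext (G : X -> V) (v : freemod k X) : V := \sum_x (v x : k) *: G x.

Lemma linext_lin G : linear (linext G).
Proof.
move=> c u v; rewrite /linext scaler_sumr -big_split; apply: eq_bigr => x _ /=.
by rewrite !ffunE scalerA -scalerDl.
Qed.

Lemma linext_basis G x : linext G (basis k x) = G x.
Proof.
rewrite /linext (bigD1 x) //= ffunE eqxx scale1r big1 ?addr0 // => y /negbTE yx.
by rewrite ffunE yx scale0r.
Qed.

Lemma linear0_of (W : lmodType k) (f : V -> W) : linear f -> f 0 = 0.
Proof. by move=> h; have := h (-1) 0 0; rewrite !scaleN1r !addNr. Qed.
End LinearExtension.

Section TensorPowerFunctor.
Variables (k : fieldType) (R : linsmc k) (r : R).

Definition lin_tpow_map (A B : kS k) : lhom A B -> lhom (tpow r #|A|) (tpow r #|B|) :=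
  linext (@tpow_map k R r A B).

Lemma lin_tpow_mapL (A B : kS k) c (f g : lhom A B) :
  lin_tpow_map (c *: f + g) = c *: lin_tpow_map f + lin_tpow_map g.
Proof. exact: linext_lin. Qed.

Lemma lin_tpow_map_basis (A B : finType) (f : fbij A B) :
  @lin_tpow_map A B (basis k f) = tpow_map r f.
Proof. exact: linext_basis. Qed.

Definition tensor_power_functor : smfunctor (kS k) R.
Proof.
refine (@SMFunctor k (kS k) R (fun A => tpow r #|A|) lin_tpow_map _ _ _
  (tpow_mu r) (tpow_eps r) (tpow_mu_iso r) (tpow_eps_iso r) _ _ _ _ _).
- by move=> A; rewrite [LHS]lin_tpow_map_basis tpow_map_id.
- move=> A B D g f; elim/free_ind: f => [|f|c f f' IH IH'].
  + by rewrite compm0 /lin_tpow_map !(linear0_of (linext_lin _)) compm0.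
  + elim/free_ind: g => [|g|c g g' IH IH'].
    * by rewrite comp0m /lin_tpow_map !(linear0_of (linext_lin _)) comp0m.
    * rewrite [_ ∘ _]bilin_basis !lin_tpow_map_basis; exact: tpow_map_comp.
    * by rewrite compDl compZl lin_tpow_mapL IH IH' lin_tpow_mapL compDl compZl.
  + by rewrite compDr compZr lin_tpow_mapL IH IH' lin_tpow_mapL compDr compZr.
- by move=> A B; apply: linext_lin.
- move=> A B A' B' f g; elim/free_ind: f => [|f|c f f' IH IH'].
  + by rewrite tens0m /lin_tpow_map !(linear0_of (linext_lin _)) tens0m compm0 comp0m.
  + elim/free_ind: g => [|g|c g g' IH IH'].
    * by rewrite tensm0 /lin_tpow_map !(linear0_of (linext_lin _)) tensm0 compm0 comp0m.
    * have -> : (basis k f : lhom (A : kS k) A') ⊗₁ (basis k g : lhom (B : kS k) B') =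
          basis k (thom fbij_data f g) by exact: bilin_basis.
      rewrite !lin_tpow_map_basis; exact: tpow_mu_nat.
    * by rewrite tensDr tensZr !lin_tpow_mapL tensDr tensZr compDl compZl compDr compZr IH IH'.
  + by rewrite tensDl tensZl !lin_tpow_mapL tensDl tensZl compDl compZl compDr compZr IH IH'.
- by move=> A B D; rewrite [lin_tpow_map _]lin_tpow_map_basis; apply: tpow_mu_asc.
- by move=> A; rewrite [lin_tpow_map _]lin_tpow_map_basis; apply: tpow_mu_lun.
- by move=> A; rewrite [lin_tpow_map _]lin_tpow_map_basis; apply: tpow_mu_run.
- by move=> A B; rewrite [lin_tpow_map _]lin_tpow_map_basis; apply: tpow_mu_brd.
Defined.
End TensorPowerFunctor.

(** * Extension to the Cauchy completion *)

Lemma sum_pair (V : nmodType) (I J : finType) (G : I * J -> V) :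
  \sum_p G p = \sum_i \sum_j G (i, j).
Proof. by rewrite (pair_bigA _ (fun i j => G (i, j))); apply: eq_bigr => -[]. Qed.

Section Decompositions.
Variables (k : fieldType) (R : linsmc k).
Implicit Types X Y Z : R.

(** Weaker than a biproduct: X is a retract of the sum of the [Y i]. This suffices for testing maps
    on the [u i], and it passes to retracts, tensor products and images under k-linear functors. *)
Definition decomposes (I : finType) X (Y : I -> R)
    (u : forall i, lhom (Y i) X) (v : forall i, lhom X (Y i)) : Prop :=
  \sum_i u i ∘ v i = lid X.

Lemma decomposes_epi (I : finType) X (Y : I -> R) (u : forall i, lhom (Y i) X)
    (v : forall i, lhom X (Y i)) Z (g h : lhom X Z) :
  decomposes u v -> (forall i, g ∘ u i = h ∘ u i) -> g = h.
Proof.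
move=> d e; rewrite -[g]compm1 -[h]compm1 -d !comp_sumr.
by apply: eq_bigr => i _; rewrite !compA e.
Qed.

Lemma decomposes_tens (I J : finType) X X' (Y : I -> R) (Y' : J -> R)
    (u : forall i, lhom (Y i) X) (v : forall i, lhom X (Y i))
    (u' : forall j, lhom (Y' j) X') (v' : forall j, lhom X' (Y' j)) :
  decomposes u v -> decomposes u' v' ->
  decomposes (fun p : I * J => u p.1 ⊗₁ u' p.2) (fun p => v p.1 ⊗₁ v' p.2).
Proof.
rewrite /decomposes => d d'.
rewrite -(pair_bigA _ (fun i j => (u i ⊗₁ u' j) ∘ (v i ⊗₁ v' j))) /=.
rewrite -tens1 -d -d' tens_suml; apply: eq_bigr => i _.
by rewrite tens_sumr; apply: eq_bigr => j _; rewrite tensM.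
Qed.

Lemma decomposes_id X : decomposes (fun _ : unit => lid X) (fun _ => lid X).
Proof. by rewrite /decomposes (big_pred1 tt) ?comp1m // => -[]. Qed.
End Decompositions.

(** Induction on an enumeration of [I]; summands not yet treated have zero inclusions and
    projections, so that orthogonality holds for all indices at each stage. *)
Lemma finite_biproduct (k : fieldType) (R : two_rig k) (I : finType) (Y : I -> R) :
  exists (X : R) (u : forall i, lhom (Y i) X) (v : forall i, lhom X (Y i)),
  [/\ forall i, v i ∘ u i = lid (Y i), forall i j, i != j -> v j ∘ u i = 0
    & decomposes u v].
Proof.
suff [X [u [v [h1 h2 h3]]]] : exists (X : R) (u : forall i, lhom (Y i) X)
    (v : forall i, lhom X (Y i)),
    [/\ forall i, i \in enum I -> v i ∘ u i = lid (Y i),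
        forall i j, i != j -> v j ∘ u i = 0
      & \sum_(i <- enum I) u i ∘ v i = lid X].
  exists X, u, v; split=> // [i|]; first by apply: h1; rewrite mem_enum.
  by rewrite /decomposes -big_enum.
have [[z [z1 z2]] bip _] := two_rigP R.
elim: (enum I) (enum_uniq I) => [_|x s IH /= /andP[xs /IH[X [u [v [h1 h2 h3]]]]]].
  exists z, (fun=> 0), (fun=> 0); split=> // [i j _|]; first by rewrite comp0m.
  by rewrite big_nil (z1 _ (lid z)).
have [X' [i1 [i2 [p1 [p2 [e11 e22 e12 e21 e]]]]]] := bip (Y x) X.
exists X', (dfwith (fun i => i2 ∘ u i) i1), (dfwith (fun i => v i ∘ p2) p1); split.
- move=> i; rewrite inE; have [-> _|ne /= is_] := eqVneq i x; first by rewrite !dfwith_in.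
  by rewrite !dfwith_out 1?eq_sym // !compA (compKl _ e22) compm1 h1.
- move=> i j ij; have [xi|xi] := eqVneq x i.
    rewrite -{i}xi in ij *; rewrite dfwith_in dfwith_out //.
    by rewrite -compA e21 compm0.
  rewrite (dfwith_out _ _ xi); have [xj|xj] := eqVneq x j.
    by rewrite -{j}xj in ij *; rewrite dfwith_in compA e12 comp0m.
  by rewrite dfwith_out // !compA (compKl _ e22) compm1 h2.
- rewrite big_cons !dfwith_in -e; congr (_ + _).
  rewrite -[i2 in RHS]compm1 -h3.
  rewrite (big_morph (fun g => i2 ∘ g ∘ p2) (id1 := 0) (op1 := +%R)); first last.
  + by rewrite compm0 comp0m.
  + by move=> f g; rewrite compDr compDl.
  apply: eq_big_seq => i is_; have xi : x != i by apply: contraNneq xs => ->.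
  by rewrite !dfwith_out // !compA.
Qed.

Section CauchyExtension.
Variables (k : fieldType) (C : linsmc k) (R : two_rig k) (F : smfunctor C R).
Local Notation K := (cauchy C).
Implicit Types A B D E : K.

Definition kfam A : fam C := kob A.
Definition kidx A : finType := idx (kfam A).
Definition kmat A B (f : lhom A B) : mat (kfam A) (kfam B) := kval f.
Definition kidm A : mat (kfam A) (kfam A) := kid A.

(* A splitting of the idempotent of [R] that the matrix [kidm A] induces on the
   biproduct of the objects [F (kfam A i)] *)
Record msplit A := MSplit {
  ms_ob : R;
  ms_in : forall i, lhom (F (kfam A i)) ms_ob;
  ms_out : forall i, lhom ms_ob (F (kfam A i));
  ms_outin : forall i j, ms_out j ∘ ms_in i = smap F (ent (kidm A) i j);
  ms_dec : decomposes ms_in ms_out }.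

Lemma kidmK A i l : \sum_j ent (kidm A) j l ∘ ent (kidm A) i j = ent (kidm A) i l.
Proof.
have := kidK A => /(congr1 (fun m : mat (kfam A) (kfam A) => ent m i l)) <-.
by rewrite mat_mkE.
Qed.

Lemma msplit_ex A : exists s : msplit A, True.
Proof.
have [X [u [v [vu1 vu0 uv]]]] := finite_biproduct (fun i => F (kfam A i)).
(* The endomorphism of the biproduct whose matrix is the image of [kidm A]; splitting it gives the
   required object. *)
pose e := \sum_i (\sum_j u j ∘ smap F (ent (kidm A) i j)) ∘ v i.
have eu i : e ∘ u i = \sum_j u j ∘ smap F (ent (kidm A) i j).
  rewrite /e comp_suml (bigD1 i) //= -compA vu1 compm1 [X in _ + X]big1 ?addr0 // => j ji.
  by rewrite -compA vu0 ?compm0 // eq_sym.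
have ve j i : v j ∘ e ∘ u i = smap F (ent (kidm A) i j).
  rewrite -compA eu comp_sumr (bigD1 j) //= compA vu1 comp1m [X in _ + X]big1 ?addr0 // => l lj.
  by rewrite compA vu0 ?comp0m // eq_sym.
have ee : e ∘ e = e.
  apply: (decomposes_epi uv) => i; rewrite -compA eu comp_sumr.
  under eq_bigr => j _ do rewrite compA eu comp_suml.
  rewrite exchange_big; apply: eq_bigr => l _ /=.
  under eq_bigr => j _ do rewrite -compA -smap_comp.
  by rewrite -comp_sumr -smap_sum kidmK.
have [_ _ /(_ X e ee)[Y [i [p [pi ip]]]]] := two_rigP R.
unshelve eexists (@MSplit A Y (fun l => p ∘ u l) (fun l => v l ∘ i) _ _) => //.
- by move=> l m; rewrite -compA (compA i) ip compA ve.
- rewrite /decomposes -pi.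
  under eq_bigr => l _ do rewrite -compA (compA (u l)).
  rewrite -comp_sumr -comp_suml (_ : \sum_l _ = lid X) ?comp1m //.
Qed.

Definition msp A : msplit A := sval (cid (msplit_ex A)).
Definition ext_ob A : R := ms_ob (msp A).
Local Notation X := ext_ob.
Definition ext_in A i : lhom (F (kfam A i)) (X A) := ms_in (msp A) i.
Definition ext_out A i : lhom (X A) (F (kfam A i)) := ms_out (msp A) i.

Arguments ext_in : clear implicits.
Arguments ext_out : clear implicits.

Lemma ext_outin A i j : ext_out A j ∘ ext_in A i = smap F (ent (kidm A) i j).
Proof. exact: ms_outin. Qed.
Lemma ext_dec A : decomposes (ext_in A) (ext_out A).
Proof. exact: ms_dec. Qed.

Lemma ext_in_absorb A i : \sum_j ext_in A j ∘ smap F (ent (kidm A) i j) = ext_in A i.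
Proof.
rewrite -[RHS]comp1m -(ext_dec A) comp_suml; apply: eq_bigr => j _.
by rewrite -compA ext_outin.
Qed.

Definition ext_map A B (f : lhom A B) : lhom (X A) (X B) :=
  \sum_i (\sum_j ext_in B j ∘ smap F (ent (kmat f) i j)) ∘ ext_out A i.

(** Composing [ext_out] with [ext_in] produces [kidm A], which [kmat f] absorbs because f is fixed
    by the idempotents. *)
Lemma ext_map_in A B (f : lhom A B) i :
  ext_map f ∘ ext_in A i = \sum_j ext_in B j ∘ smap F (ent (kmat f) i j).
Proof.
rewrite /ext_map comp_suml.
under eq_bigr => l _ do rewrite -compA ext_outin comp_suml.
rewrite exchange_big; apply: eq_bigr => j _ /=.
under eq_bigr => l _ do rewrite -compA -smap_comp.
rewrite -comp_sumr -smap_sum; congr (_ ∘ smap F _).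
have := kvalr f => /(congr1 (fun m : mat (kfam A) (kfam B) => ent m i j)) <-.
by rewrite mat_mkE.
Qed.

(** The structure maps of the completion have this form: [kmk m] cuts [m] down by the idempotents,
    and these disappear into [ext_in]. *)
Lemma ext_map_kmk A B (m : mat (kfam A) (kfam B)) i : @kcomm _ _ A B m ->
  ext_map (@kmk _ _ A B m) ∘ ext_in A i = \sum_j ext_in B j ∘ smap F (ent m i j).
Proof.
move=> c; rewrite ext_map_in.
have e : kmat (@kmk _ _ A B m) = mat_comp (kidm B) m.
  by rewrite [LHS]kmkE -compA -c compA kidK.
under eq_bigr => j _ do rewrite e mat_mkE smap_sum comp_sumr.
rewrite exchange_big; apply: eq_bigr => j' _ /=.
rewrite -[in RHS]ext_in_absorb comp_suml; apply: eq_bigr => j _.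
by rewrite smap_comp compA.
Qed.

Lemma ext_map_mono A B (phi : kidx B -> kidx A)
    (s : forall j, lhom (kfam A (phi j)) (kfam B j)) j :
  injective phi -> @kcomm _ _ A B (mono s) ->
  ext_map (@kmk _ _ A B (mono s)) ∘ ext_in A (phi j) = ext_in B j ∘ smap F (s j).
Proof.
move=> inj c; rewrite ext_map_kmk // (bigD1 j) //= mono_hit big1 ?addr0 // => l lj.
by rewrite mono_miss ?(inj_eq inj) // smap0 compm0.
Qed.

Definition ext_mu A B : lhom (X A ⊗ X B) (X (A ⊗ B)) :=
  \sum_(p : kidx A * kidx B)
    ext_in (A ⊗ B) p ∘ smu F (kfam A p.1) (kfam B p.2) ∘ (ext_out A p.1 ⊗₁ ext_out B p.2).

Lemma kidm_tens A B (p q : kidx A * kidx B) :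
  ent (kidm (A ⊗ B)) p q = ent (kidm A) p.1 q.1 ⊗₁ ent (kidm B) p.2 q.2.
Proof. by case: p q => [i i'] [j j']; apply: mat_thomE. Qed.

Lemma ext_mu_in A B i j :
  ext_mu A B ∘ (ext_in A i ⊗₁ ext_in B j) = ext_in (A ⊗ B) (i, j) ∘ smu F (kfam A i) (kfam B j).
Proof.
rewrite /ext_mu comp_suml -[in RHS]ext_in_absorb comp_suml; apply: eq_bigr => p _.
by rewrite -compA -tensM !ext_outin -compA smu_nat compA kidm_tens.
Qed.

Lemma ext_mu_iso A B : liso (ext_mu A B).
Proof.
pose nu i j := sval (cid (smu_iso F (kfam A i) (kfam B j))).
have nuK i j : nu i j ∘ smu F _ _ = lid _ by rewrite /nu; case: cid => ? [].
have Knu i j : smu F _ _ ∘ nu i j = lid _ by rewrite /nu; case: cid => ? [].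
pose N := \sum_(p : kidx A * kidx B)
  (ext_in A p.1 ⊗₁ ext_in B p.2) ∘ nu p.1 p.2 ∘ ext_out (A ⊗ B) p.
have Nin p : N ∘ ext_in (A ⊗ B) p = (ext_in A p.1 ⊗₁ ext_in B p.2) ∘ nu p.1 p.2.
  rewrite /N comp_suml.
  rewrite -[in RHS](ext_in_absorb p.1) -[in RHS](ext_in_absorb p.2) tens_suml comp_suml.
  rewrite sum_pair /=.
  apply: eq_bigr => i _; rewrite tens_sumr comp_suml; apply: eq_bigr => j _.
  rewrite -compA (ext_outin (A := A ⊗ B) p (i, j)) tensM -!compA; congr (_ ∘ _).
  rewrite -[RHS]comp1m -(nuK i j) -!compA; congr (_ ∘ _).
  rewrite (compA (smu F _ _)) smu_nat -compA Knu compm1 /=.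
  by rewrite (kidm_tens p (i, j)).
exists N; split.
  apply: (decomposes_epi (decomposes_tens (ext_dec A) (ext_dec B))) => -[i j].
  by rewrite -compA ext_mu_in compA Nin -compA nuK compm1 comp1m.
apply: (decomposes_epi (ext_dec (A ⊗ B))) => -[i j].
by rewrite -compA Nin compA ext_mu_in -compA Knu compm1 comp1m.
Qed.

Definition ext_eps : lhom 𝟙 (X (𝟙 : K)) := ext_in (𝟙 : K) tt ∘ seps F.

Lemma ext_eps_iso : liso ext_eps.
Proof.
apply: liso_comp; last exact: seps_iso.
exists (ext_out (𝟙 : K) tt); split.
  by rewrite ext_outin [ent _ _ _](@mono_hit _ _ _ (mat_one C) id) smap_id.
by rewrite -[RHS](ext_dec (𝟙 : K)) (big_pred1 tt) // => -[].
Qed.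

Lemma ext_asc_in A B D i j l :
  ext_map (α A B D) ∘ ext_in ((A ⊗ B) ⊗ D) ((i, j), l) =
  ext_in (A ⊗ (B ⊗ D)) (i, (j, l)) ∘ smap F (α (kfam A i) (kfam B j) (kfam D l)).
Proof.
apply: (@ext_map_mono ((A ⊗ B) ⊗ D) (A ⊗ (B ⊗ D))
  (fun p => ((p.1, p.2.1), p.2.2)) _ (i, (j, l)) _ (kasc A B D)).
by move=> [? [? ?]] [? [? ?]] [-> -> ->].
Qed.

Lemma ext_lun_in A i :
  ext_map (λl A) ∘ ext_in (𝟙 ⊗ A) (tt, i) = ext_in A i ∘ smap F (λl (kfam A i)).
Proof.
by apply: (@ext_map_mono (𝟙 ⊗ A) A (fun i => (tt, i)) _ i _ (klun A)) => ? ? [].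
Qed.

Lemma ext_run_in A i :
  ext_map (ρr A) ∘ ext_in (A ⊗ 𝟙) (i, tt) = ext_in A i ∘ smap F (ρr (kfam A i)).
Proof.
by apply: (@ext_map_mono (A ⊗ 𝟙) A (fun i => (i, tt)) _ i _ (krun A)) => ? ? [].
Qed.

Lemma ext_brd_in A B i j :
  ext_map (β A B) ∘ ext_in (A ⊗ B) (i, j) =
  ext_in (B ⊗ A) (j, i) ∘ smap F (β (kfam A i) (kfam B j)).
Proof.
apply: (@ext_map_mono (A ⊗ B) (B ⊗ A) (fun p => (p.2, p.1)) _ (j, i) _ (kbrd A B)).
by move=> [? ?] [? ?] [-> ->].
Qed.

(** Each law is checked after precomposition with the [ext_in], where it follows from the laws of
    [F] and of matrices. *)
Definition cauchy_ext : smfunctor K R.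
Proof.
refine (@SMFunctor k K R X ext_map _ _ _ ext_mu ext_eps ext_mu_iso ext_eps_iso _ _ _ _ _).
- move=> A; apply: (decomposes_epi (ext_dec A)) => i.
  by rewrite ext_map_in [kmat _]k_idE ext_in_absorb comp1m.
- move=> A B D g f; apply: (decomposes_epi (ext_dec A)) => i.
  rewrite -compA !ext_map_in comp_sumr.
  under [RHS]eq_bigr => j _ do rewrite compA ext_map_in comp_suml.
  rewrite exchange_big; apply: eq_bigr => l _ /=.
  under [RHS]eq_bigr => j _ do rewrite -compA -smap_comp.
  rewrite -comp_sumr -smap_sum; congr (_ ∘ smap F _).
  have -> : kmat (g ∘ f) = mat_comp (kmat g) (kmat f) by exact: (k_compE g f).
  by rewrite mat_mkE.
- move=> A B c f g; apply: (decomposes_epi (ext_dec A)) => i.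
  rewrite compDl compZl !ext_map_in scaler_sumr -big_split; apply: eq_bigr => j _ /=.
  have -> : kmat (c *: f + g) = c *: kmat f + kmat g by exact: (kval_lin c f g).
  by rewrite ent_lin smapD smapZ compDr compZr.
- move=> A B A' B' f g.
  apply: (decomposes_epi (decomposes_tens (ext_dec A) (ext_dec B))) => -[i j] /=.
  rewrite -[LHS]compA -tensM !ext_map_in tens_suml comp_sumr.
  rewrite -[RHS]compA ext_mu_in compA ext_map_in comp_suml.
  rewrite [RHS](sum_pair (I := kidx A') (J := kidx B')).
  apply: eq_bigr => i' _; rewrite tens_sumr comp_sumr; apply: eq_bigr => j' _.
  rewrite tensM compA ext_mu_in -!compA smu_nat; congr (_ ∘ (smap F _ ∘ _)).
  have -> : kmat (f ⊗₁ g) = mat_thom (kmat f) (kmat g) by exact: (k_thomE f g).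
  by rewrite mat_thomE.
- move=> A B D.
  apply: (decomposes_epi (decomposes_tens (decomposes_tens (ext_dec A) (ext_dec B)) (ext_dec D))).
  move=> [[i j] l] /=.
  rewrite -[LHS]compA -tensM comp1m ext_mu_in -[ext_in D l in LHS]compm1 tensM compA.
  rewrite (compKl _ (@ext_mu_in (A ⊗ B) D (i, j) l)) !compA ext_asc_in.
  rewrite -2!(compA (ext_in _ _)) smu_asc -[RHS]compA αnat !compA.
  rewrite -(compA (ext_mu _ _)) -tensM comp1m ext_mu_in -[ext_in A i in RHS]compm1 tensM.
  by rewrite !compA (@ext_mu_in A (B ⊗ D) i (j, l)).
- move=> A; apply: (decomposes_epi (decomposes_tens (decomposes_id _) (ext_dec A))).
  move=> [[] i] /=.
  rewrite λnat -compA -tensM comp1m compm1 -[ext_in A i in LHS]compm1 tensM compA.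
  by rewrite (compKl _ (@ext_mu_in 𝟙 A tt i)) !compA ext_lun_in -2!compA (compA (smap _ _)) smu_lun.
- move=> A; apply: (decomposes_epi (decomposes_tens (ext_dec A) (decomposes_id _))).
  move=> [i []] /=.
  rewrite ρnat -compA -tensM comp1m compm1 -[ext_in A i in LHS]compm1 tensM compA.
  by rewrite (compKl _ (@ext_mu_in A 𝟙 i tt)) !compA ext_run_in -2!compA (compA (smap _ _)) smu_run.
- move=> A B; apply: (decomposes_epi (decomposes_tens (ext_dec A) (ext_dec B))) => -[i j] /=.
  rewrite -compA ext_mu_in compA ext_brd_in -[LHS]compA smu_brd.
  by rewrite -[RHS]compA βnat !compA ext_mu_in.
Defined.
End CauchyExtension.

(** * Transport, kernels and quotients *)

Section Transport.
Variables (k : fieldType) (C D : linsmc k) (F : smfunctor C D).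

Section TransportData.
Variables (ob' : C -> D) (th : forall a, lhom (F a) (ob' a)) (ti : forall a, lhom (ob' a) (F a)).
Hypotheses (thK : forall a, ti a ∘ th a = lid _) (tiK : forall a, th a ∘ ti a = lid _).

Let th_iso a : liso (th a). Proof. by exists (ti a). Qed.
Let ti_iso a : liso (ti a). Proof. by exists (th a). Qed.

Definition transport : smfunctor C D.
Proof.
refine (@SMFunctor k C D ob' (fun a b f => th b ∘ smap F f ∘ ti a) _ _ _
  (fun a b => th (a ⊗ b) ∘ smu F a b ∘ (ti a ⊗₁ ti b)) (th 𝟙 ∘ seps F) _ _ _ _ _ _ _).
- by move=> a; rewrite smap_id compm1 tiK.
- by move=> a b c g f; rewrite !compA (compKl _ (thK _)) compm1 smap_comp !compA.
- by move=> a b c f g; rewrite smapD smapZ compDr compZr compDl compZl.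
- move=> a b; apply: liso_comp; first by apply: liso_comp; last exact: smu_iso.
  exact: liso_tens.
- by apply: liso_comp; last exact: seps_iso.
- move=> a b a' b' f g; rewrite !compA (compKl _ (thK _)) compm1.
  rewrite -(compA _ (_ ⊗₁ _) (_ ⊗₁ _)) -tensM !compA !thK !comp1m tensM compA.
  by rewrite (compKl _ (smu_nat _ _ _)) !compA.
- move=> a b c; rewrite !compA (compKl _ (thK _)) compm1.
  rewrite -(compA _ (_ ⊗₁ _) (_ ⊗₁ _)) -tensM !compA thK !comp1m.
  rewrite -[in RHS](compA _ (_ ⊗₁ _) (_ ⊗₁ _)) -tensM.
  rewrite !compA thK comp1m compm1 -[ti a in RHS]comp1m -[ti c in LHS]comp1m.
  rewrite [in LHS]tensM [in RHS]tensM !compA (compKl3 _ (smu_asc F a b c)) !compA.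
  by rewrite (compKl _ (αnat _ _ _)) !compA; congr (_ ∘ _); rewrite -!compA -!tensM !comp1m compm1.
- move=> a; rewrite !compA (compKl _ (thK _)) compm1.
  rewrite -(compA _ (_ ⊗₁ _) (_ ⊗₁ _)) -tensM !compA thK comp1m compm1.
  rewrite -[ti a]comp1m -[seps F]compm1 tensM !compA (compKl3 _ (smu_lun F a)).
  by rewrite -compA λnat compA tiK comp1m.
- move=> a; rewrite !compA (compKl _ (thK _)) compm1.
  rewrite -(compA _ (_ ⊗₁ _) (_ ⊗₁ _)) -tensM !compA thK comp1m compm1.
  rewrite -[ti a]comp1m -[seps F]compm1 tensM !compA (compKl3 _ (smu_run F a)).
  by rewrite -compA ρnat compA tiK comp1m.
- move=> a b; rewrite !compA (compKl _ (thK _)) compm1 (compKl _ (smu_brd F a b)).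
  by rewrite !compA (compKl _ (βnat _ _)) !compA.
Defined.
End TransportData.

(** The value at x is replaced by r along [f], and the other values stay; this yields an equality of
    objects where only an isomorphism was at hand. *)
Lemma smfunctor_at (x : C) (r : D) (f : lhom (F x) r) : liso f ->
  exists G : smfunctor C D, G x = r.
Proof.
move=> [g [gf fg]].
pose T (a : C) := {b : D & {p : lhom (F a) b * lhom b (F a) |
  p.2 ∘ p.1 = lid _ /\ p.1 ∘ p.2 = lid _}}.
pose t0 a : T a := existT _ (F a) (exist _ (lid _, lid _) (conj (comp1m _) (comp1m _))).
pose t1 : T x := existT _ r (exist _ (f, g) (conj gf fg)).
(* Whether [a] is x is decided classically. [T a] packs the new value with its isomorphism, so that
   one dependent match transports both. *)
pose t a : T a := match pselect (x = a) with
  | left e => match e in _ = b return T b with erefl => t1 end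
  | right _ => t0 a end.
have tx : tag (t x) = r.
  by rewrite /t; case: pselect => // e; rewrite (Prop_irrelevance e erefl).
pose th a := (sval (tagged (t a))).1; pose ti a := (sval (tagged (t a))).2.
have thK a : ti a ∘ th a = lid _ by case: (svalP (tagged (t a))).
have tiK a : th a ∘ ti a = lid _ by case: (svalP (tagged (t a))).
by exists (transport thK tiK); exact: tx.
Qed.
End Transport.

Section ZeroObjects.
Variables (k : fieldType).

Lemma zero_obP (C : linsmc k) (a : C) : is_zero_ob a <-> lid a = 0.
Proof.
split=> [[h _]|e]; first exact: h.
split=> b f; first by rewrite -[f]compm1 e compm0.
by rewrite -[f]comp1m e comp0m.
Qed.

Lemma zero_factor (C : linsmc k) (a b : C) (v : lhom b a) (u : lhom a b) :
  is_zero_ob b -> v ∘ u = lid a -> is_zero_ob a.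
Proof. by move=> [_ b0] e; apply/zero_obP; rewrite -e (b0 _ u) compm0. Qed.

Variables (S : two_rig k) (R : linsmc k) (F : smfunctor S R).

Definition kernel_ideal : two_ideal S.
Proof.
exists (fun a => is_zero_ob (F a)).
- move=> a b f [g [gf fg]] a0; apply: (zero_factor (v := smap F f) (u := smap F g) a0).
  by rewrite -smap_comp fg smap_id.
- by move=> z z0; apply: smap_zero_ob.
- move=> a b c [i1 [i2 [p1 [p2 [_ _ _ _ e]]]]] [_ a0] [_ b0]; apply/zero_obP.
  by rewrite -smap_id -e smapD !smap_comp (a0 _ (smap F p1)) (b0 _ (smap F p2)) !compm0 addr0.
- move=> a b [i [p pi]] b0; apply: (zero_factor (v := smap F p) (u := smap F i) b0).
  by rewrite -smap_comp pi smap_id.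
- move=> a b /zero_obP a0; apply/zero_obP; apply: (comp_epi (smu_iso F b a)).
  by rewrite comp1m -[LHS]compm1 -tens1 a0 tensm0 compm0 comp0m.
- move=> a b /zero_obP a0; apply/zero_obP; apply: (comp_epi (smu_iso F a b)).
  by rewrite comp1m -[LHS]compm1 -tens1 a0 tens0m compm0 comp0m.
Defined.
End ZeroObjects.

Section QuotientFunctors.
Variables (k : fieldType) (S : two_rig k) (I : two_ideal S).

Lemma qcompE (a b c : S) (g : lhom b c) (f : lhom a b) :
  (qp I g : @lhom k (quotient I) b c) ∘ (qp I f : @lhom k (quotient I) a b) = qp I (g ∘ f).
Proof. exact: q_compE. Qed.
Lemma qtensE (a b c d : S) (f : lhom a b) (g : lhom c d) :
  (qp I f : @lhom k (quotient I) a b) ⊗₁ (qp I g : @lhom k (quotient I) c d) = qp I (f ⊗₁ g).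
Proof. exact: q_thomE. Qed.

Definition quotient_functor : smfunctor S (quotient I).
Proof.
refine (@SMFunctor k S (quotient I) id (fun a b f => qp I f) _ _ _
  (fun a b => lid _) (lid _) _ _ _ _ _ _ _) => //.
- by move=> a b c g f; rewrite qcompE.
- exact: qp_lin.
- by move=> *; apply: liso_id.
- exact: liso_id.
- by move=> a b a' b' f g; rewrite comp1m compm1 qtensE.
- by move=> a b c; rewrite !tens1 !compm1 comp1m.
- by move=> a; rewrite !tens1 !compm1.
- by move=> a; rewrite !tens1 !compm1.
- by move=> a b; rewrite comp1m compm1.
Defined.

Variables (R : linsmc k) (F : smfunctor S R).
Hypothesis F0 : forall a, I a -> is_zero_ob (F a).

Lemma smap_factors (a b : S) (f : lhom a b) : factors I f -> smap F f = 0.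
Proof.
move=> [c [v [u [/F0[_ c0] ->]]]].
by rewrite smap_comp (c0 _ (smap F u)) compm0.
Qed.

Lemma smap_qr (a b : S) (f : lhom a b) : smap F (qr (qp I f)) = smap F f.
Proof.
apply/eqP; rewrite -subr_eq0 -scaleN1r -smapZ -smapD scaleN1r; apply/eqP.
exact/smap_factors/qr_qp.
Qed.

(** Classes act through their chosen representatives. By [smap_qr] any other representative gives
    the same map, since the difference factors through a zero object of [R]. *)
Definition descend : smfunctor (quotient I) R.
Proof.
refine (@SMFunctor k (quotient I) R (sob F) (fun a b f => smap F (qr f)) _ _ _
  (smu F) (seps F) (smu_iso F) (seps_iso F) _ _ _ _ _).
- by move=> a; rewrite smap_qr smap_id.
- move=> a b c g f; have [g' ->] := qr_ex g; have [f' ->] := qr_ex f.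
  by rewrite qcompE !smap_qr smap_comp.
- move=> a b c f g; have [g' ->] := qr_ex g; have [f' ->] := qr_ex f.
  by rewrite -[_ *: _ + _](qp_lin I c f' g') !smap_qr smapD smapZ.
- move=> a b a' b' f g; have [g' ->] := qr_ex g; have [f' ->] := qr_ex f.
  by rewrite qtensE !smap_qr smu_nat.
- by move=> a b c; rewrite smap_qr smu_asc.
- by move=> a; rewrite smap_qr smu_lun.
- by move=> a; rewrite smap_qr smu_run.
- by move=> a b; rewrite smap_qr smu_brd.
Defined.
End QuotientFunctors.

(** * Transformations determined by a generating object *)

Section SmfunctorTensorPowers.
Variables (k : fieldType) (C D : linsmc k) (F : smfunctor C D) (x : C).

Lemma smap_decomposes (I : finType) X (Y : I -> C) (u : forall i, lhom (Y i) X)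
    (v : forall i, lhom X (Y i)) :
  decomposes u v -> decomposes (fun i => smap F (u i)) (fun i => smap F (v i)).
Proof.
rewrite /decomposes => d; rewrite -smap_id -d smap_sum; apply: eq_bigr => i _.
by rewrite smap_comp.
Qed.

Lemma tpow_cmpS m :
  tpow_cmp F x m.+1 = smu F x (tpow x m) ∘ (lid (F x) ⊗₁ tpow_cmp F x m).
Proof. by []. Qed.

Lemma smap_tact m n g :
  smap F (tact x m n g) ∘ tpow_cmp F x m = tpow_cmp F x n ∘ tact (F x) m n g.
Proof.
elim: m n g => [|m IH] [|n] g; try by rewrite !tact_neq // smap0 compm0 comp0m.
  by rewrite !tact00 smap_id comp1m compm1.
rewrite !tactSS smap_comp tpow_cmpS compA (compKl _ (smap_tensr F x _)) compA.
rewrite -(compA _ (_ ⊗₁ _) (_ ⊗₁ _)) -tensr_comp IH tensr_comp !compA.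
by rewrite -(compA _ (smu F _ _)) -tpow_cmpS /tinsert -!lock smap_tmove.
Qed.

Lemma smap_tcat m n :
  smap F (tcat x m n) ∘ smu F _ _ ∘ (tpow_cmp F x m ⊗₁ tpow_cmp F x n) =
  tpow_cmp F x (m + n) ∘ tcat (F x) m n.
Proof.
elim: m => [|m IH].
  rewrite !tcat0 -(tens_lr (tpow_cmp F x 0)) compA -/(tpow_cmp F x 0) smu_lun.
  by rewrite λnat.
rewrite !tcatS smap_comp [tpow_cmp F x (m.+1 + n)]tpow_cmpS tpow_cmpS.
rewrite -[tpow_cmp F x n in LHS]comp1m tensM !compA (compKl3 _ (smu_asc F _ _ _)) !compA.
rewrite (compKl _ (αnat _ _ _)) compA; congr (_ ∘ _).
rewrite (compKl _ (esym (tensr_comp _ _ _))) smap_tensr.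
rewrite -!compA; congr (_ ∘ _).
by rewrite -!tensr_comp !compA IH.
Qed.
End SmfunctorTensorPowers.

Section MorphismPowers.
Variables (k : fieldType) (C : linsmc k) (a b : C) (f : lhom a b).

Fixpoint fpow m : lhom (tpow a m) (tpow b m) :=
  match m with 0 => lid 𝟙 | m'.+1 => f ⊗₁ fpow m' end.

Lemma fpow_tinsert m j : fpow m.+1 ∘ tinsert a m j = tinsert b m j ∘ fpow m.+1.
Proof.
elim: m j => [|m IH] [|j]; rewrite ?tinsert0 ?comp1m ?compm1 //.
  have tm1 c : tinsert c 0 j.+1 = lid _ by rewrite /tinsert -lock.
  by rewrite !tm1 compm1 comp1m.
rewrite !tinsertS -[fpow m.+2]/(f ⊗₁ fpow m.+1) compA -tensM compm1 IH.
rewrite -[f in LHS]comp1m tensM -!compA; congr (_ ∘ _).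
by rewrite -[fpow m.+1]/(f ⊗₁ fpow m) sw_nat.
Qed.

Lemma fpow_tact m n g : fpow n ∘ tact a m n g = tact b m n g ∘ fpow m.
Proof.
elim: m n g => [|m IH] [|n] g; try by rewrite !tact_neq // compm0 comp0m.
  by rewrite !tact00 [LHS]compm1 [RHS]comp1m.
rewrite !tactSS compA fpow_tinsert -!compA; congr (_ ∘ _).
by rewrite -!tensM IH comp1m compm1.
Qed.

Lemma fpow_tcat m n : fpow (m + n) ∘ tcat a m n = tcat b m n ∘ (fpow m ⊗₁ fpow n).
Proof.
elim: m => [|m IH]; first by rewrite !tcat0 λnat.
rewrite !tcatS -[fpow (m.+1 + n)]/(f ⊗₁ fpow (m + n)) compA -tensM compm1 IH.
by rewrite -compA αnat compA -tensM comp1m.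
Qed.
End MorphismPowers.

Definition dense_via (k : fieldType) (C : linsmc k) (A : Type) (O : A -> C) : Prop :=
  forall X : C, exists (I : finType) (a : I -> A)
    (u : forall i, lhom (O (a i)) X) (v : forall i, lhom X (O (a i))), decomposes u v.

Section Generation.
Variables (k : fieldType) (D : linsmc k) (x : D).

Definition tensor_dense : Prop := dense_via (tpow x).

(* Every map between tensor powers of x is a combination of permutations, stated
   as an induction principle *)
Definition tensor_spanned : Prop :=
  forall m n (P : lhom (tpow x m) (tpow x n) -> Prop), P 0 ->
    (forall g, P (tact x m n g)) ->
    (forall c f h, P f -> P h -> P (c *: f + h)) -> forall h, P h.

Hypotheses (dense : tensor_dense) (spanned : tensor_spanned).
Variables (E : linsmc k) (F G : smfunctor D E).

Section Existence.
Variable f : lhom (F x) (G x).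

Definition cmpi m : lhom (F (tpow x m)) (tpow (F x) m) := sval (cid (tpow_cmp_iso F x m)).
Lemma cmpK m : cmpi m ∘ tpow_cmp F x m = lid _.
Proof. by rewrite /cmpi; case: cid => ? []. Qed.

(** The tensor power of [f], read between the images of [tpow x m] through the comparison
    isomorphisms. *)
Definition qpow m : lhom (F (tpow x m)) (G (tpow x m)) :=
  locked (tpow_cmp G x m ∘ fpow f m ∘ cmpi m).

Lemma qpow_cmp m : qpow m ∘ tpow_cmp F x m = tpow_cmp G x m ∘ fpow f m.
Proof. by rewrite /qpow -lock (compKl _ (cmpK m)) compm1. Qed.

Lemma qpow_nat m n (h : lhom (tpow x m) (tpow x n)) :
  qpow n ∘ smap F h = smap G h ∘ qpow m.
Proof.
refine (@spanned m n (fun h => qpow n ∘ smap F h = smap G h ∘ qpow m) _ _ _ h)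
  => [|g|c h1 h2 IH IH'].
- by rewrite !smap0 compm0 comp0m.
- apply: (comp_epi (tpow_cmp_iso F x m)).
  rewrite -compA smap_tact compA qpow_cmp -compA fpow_tact.
  by rewrite compA -smap_tact -!compA qpow_cmp.
- by rewrite !smapD !smapZ compDl compDr compZl compZr IH IH'.
Qed.

Lemma qpow_mu m n : qpow (m + n) ∘ smap F (tcat x m n) ∘ smu F _ _ =
  smap G (tcat x m n) ∘ smu G _ _ ∘ (qpow m ⊗₁ qpow n).
Proof.
apply: (comp_epi (liso_tens (tpow_cmp_iso F x m) (tpow_cmp_iso F x n))).
rewrite -2!compA (compA (smap F _)) smap_tcat compA qpow_cmp -compA fpow_tcat.
by rewrite compA -smap_tcat -!compA -!tensM !qpow_cmp.
Qed.

Lemma qpow_eps : qpow 0 ∘ seps F = seps G.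
Proof. by have := qpow_cmp 0; rewrite /= compm1. Qed.

(** The component is assembled from a decomposition of Y. Since [qpow] is natural for all maps
    between powers, it is compatible with every map from a power to Y, and not only with the chosen
    [u i]. *)
Lemma ext_ex (Y : D) : exists t : lhom (F Y) (G Y),
  forall m (h : lhom (tpow x m) Y), t ∘ smap F h = smap G h ∘ qpow m.
Proof.
have [I [m [u [v d]]]] := dense Y.
exists (\sum_i smap G (u i) ∘ qpow (m i) ∘ smap F (v i)) => n h.
rewrite comp_suml -[smap G h]comp1m -(smap_decomposes G d) comp_suml comp_suml.
apply: eq_bigr => i _; rewrite -!compA -!smap_comp; congr (_ ∘ _).
by rewrite (compA (smap G _)) -smap_comp qpow_nat.
Qed.

Definition ext_comp (Y : D) : lhom (F Y) (G Y) := sval (cid (ext_ex Y)).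
Lemma ext_compE (Y : D) m (h : lhom (tpow x m) Y) :
  ext_comp Y ∘ smap F h = smap G h ∘ qpow m.
Proof. by rewrite /ext_comp; case: cid. Qed.

Definition monnat_ext : monnat F G.
Proof.
exists ext_comp.
- move=> Y Z h; have [I [m [u [v d]]]] := dense Y.
  apply: (decomposes_epi (smap_decomposes F d)) => i.
  rewrite -!compA -smap_comp !ext_compE smap_comp.
  by rewrite -compA.
- move=> Y Z; have [I [m [u [v d]]]] := dense Y; have [J [n [u' [v' d']]]] := dense Z.
  apply: (decomposes_epi (decomposes_tens (smap_decomposes F d) (smap_decomposes F d'))).
  move=> [i j] /=; rewrite -!compA -tensM smu_nat !ext_compE tensM.
  (* The tensor product is rewritten through the single power of degree [m i + n j], to which
     [ext_compE] applies. *)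
  have [w [wk kw]] := tcat_iso x (m i) (n j).
  have -> : u i ⊗₁ u' j = ((u i ⊗₁ u' j) ∘ w) ∘ tcat x (m i) (n j).
    by rewrite -compA wk compm1.
  rewrite [in LHS]smap_comp !compA ext_compE -!compA (compA (qpow _)) qpow_mu !compA.
  by rewrite -smap_comp (compKl _ wk) compm1 smu_nat.
- have e : smap F (lid (𝟙 : D)) = lid _ := smap_id F 𝟙.
  by rewrite -[ext_comp 𝟙]compm1 -e (@ext_compE 𝟙 0 (lid 𝟙)) smap_id comp1m qpow_eps.
Defined.

Lemma monnat_extE : monnat_ext x = f.
Proof.
(* The right unitor is a map from [tpow x 1] to x, so that it relates the component at x to
   [qpow 1]. *)
have h := congr1 (fun h => h ∘ tpow_cmp F x 1) (@ext_compE x 1 (ρr x)).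
rewrite -2!compA qpow_cmp /= !compA in h.
rewrite (compKl3 _ (smu_run F x)) smu_run ρnat in h.
exact: comp_epi (ρ_iso _) h.
Qed.
End Existence.

(** Monoidality forces the components at the powers of x, and naturality along a decomposition
    forces the others. *)
Lemma monnat_unique (s t : monnat F G) : s x = t x -> s = t.
Proof.
move=> e; have pw (r : monnat F G) m :
    r (tpow x m) ∘ tpow_cmp F x m = tpow_cmp G x m ∘ fpow (r x) m.
  elim: m => [|m IH]; first by rewrite /= mcomp_eps compm1.
  rewrite !tpow_cmpS compA mcomp_mu -!compA; congr (_ ∘ _).
  by rewrite -!tensM IH compm1 comp1m.
apply: monnat_eq => Y; have [I [m [u [v d]]]] := dense Y.
apply: (decomposes_epi (smap_decomposes F d)) => i.
rewrite !mcomp_nat; congr (_ ∘ _); apply: (comp_epi (tpow_cmp_iso F x (m i))).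
by rewrite !pw e.
Qed.
End Generation.

(** * Maps between powers of the one-point type *)

Section GenerationOfS.
Variable k : fieldType.
Local Notation pt := (funit : kS k).
Local Notation T := (fun m => tpow pt m : finType).

Fixpoint pos m : T m -> nat :=
  match m return T m -> nat with
  | 0 => fun v : fvoid => match v with end
  | m'.+1 => fun s : fsum funit (T m') =>
    match s with inl _ => 0%N | inr t => (pos t).+1 end
  end.

Lemma pos_numbering m : numbering m (@pos m).
Proof.
elim: m => [|m [p1 p2 p3]]; first by split=> [[]|[]|[]].
split=> [[[]|t]|[[]|t] [[]|t']|[|i]] //=.
- by rewrite ltnS; apply: p1.
- by case=> /p2 ->.
- by exists (inl tt).
- by rewrite ltnS => /p3[t <-]; exists (inr t).
Qed.

(** Following positions identifies the action on powers of the point, which is composed of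
    braidings, with honest bijections. *)
Definition is_pos_map m n (f : nat -> nat) (h : lhom (tpow pt m) (tpow pt n)) : Prop :=
  exists2 phi : fbij (T m) (T n), h = basis k phi & forall t, pos (fw phi t) = f (pos t).

Lemma is_pos_map_id m : is_pos_map id (lid (tpow pt m)).
Proof. by exists (fbij_id (T m)) => // t; rewrite mk_fbijE. Qed.

Lemma is_pos_map_comp m n p f g (h : lhom (tpow pt n) (tpow pt p))
    (h' : lhom (tpow pt m) (tpow pt n)) :
  is_pos_map f h -> is_pos_map g h' -> is_pos_map (f \o g) (h ∘ h').
Proof.
move=> [phi -> e] [psi -> e']; exists (fbij_comp phi psi); first exact: bilin_basis.
by move=> t; rewrite mk_fbijE /= e e'.
Qed.

Lemma is_pos_map_ext m n f g (h : lhom (tpow pt m) (tpow pt n)) :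
  is_pos_map f h -> (forall i, (i < m)%N -> f i = g i) -> is_pos_map g h.
Proof.
move=> [phi -> e] fg; exists phi => // t; rewrite e fg //.
by have [] := pos_numbering m.
Qed.

Lemma is_pos_map_tens m n f (h : lhom (tpow pt m) (tpow pt n)) :
  is_pos_map f h ->
  @is_pos_map m.+1 n.+1 (fun i => if i is i'.+1 then (f i').+1 else 0%N) (lid pt ⊗₁ h).
Proof.
move=> [phi -> e]; exists (fs_map (fbij_id funit) phi); first exact: bilin_basis.
by case=> [[]|t]; rewrite mk_fbijE //= e.
Qed.

Lemma is_pos_map_sw m : @is_pos_map m.+2 m.+2
  (fun i => match i with 0 => 1%N | 1 => 0%N | _ => i end) (sw pt pt (tpow pt m)).
Proof.
rewrite -swap12E.
pose c := fbij_comp (fbij_comp (asc fbij_data funit funit (T m))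
  (thom fbij_data (brd fbij_data funit funit) (fbij_id (T m))))
  (asci fbij_data funit funit (T m)).
exists (c : fbij (T m.+2) (T m.+2)).
  rewrite /swap12 [_ ⊗₁ _]bilin_basis.
  by rewrite [X in X ∘ _]bilin_basis [LHS]bilin_basis.
by case=> [[]|[[]|t]]; rewrite /c /= ?mk_fbijE /= ?mk_fbijE /= ?mk_fbijE /= ?mk_fbijE /= ?mk_fbijE.
Qed.

Lemma is_pos_map_tinsert m j : (j <= m)%N ->
  @is_pos_map m.+1 m.+1 (fun i => if i is i'.+1 then bump j i' else j) (tinsert pt m j).
Proof.
elim: m j => [|m IH] [|j] // jm; try
  by rewrite tinsert0; apply: is_pos_map_ext (is_pos_map_id _) _ => -[].
rewrite tinsertS; apply: is_pos_map_ext.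
  exact: is_pos_map_comp (is_pos_map_tens (IH j jm)) (is_pos_map_sw m).
by move=> [|[|i]] //= _; rewrite /bump; lia.
Qed.

Lemma is_pos_map_tact m f : perm_lt m f -> is_pos_map f (tact pt m m f).
Proof.
elim: m f => [|m IH] f pf.
  by rewrite tact00; apply: is_pos_map_ext (is_pos_map_id _) _.
rewrite tactSS; apply: is_pos_map_ext.
  apply: is_pos_map_comp; last exact: is_pos_map_tens (IH _ (perm_lt_tail pf)).
  by apply: is_pos_map_tinsert; have [+ _] := pf; apply.
move=> [|i] //= im; have := @perm_lt_neq _ _ i.+1 0 pf im isT.
by rewrite /tail_fun /unbump /bump => /(_ _); lia.
Qed.

(** A bijection is determined by its effect [f] on positions, and by [is_pos_map_tact] the action of
    [f] has this same effect. *)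
Lemma basis_tact m n (phi : fbij (T m) (T n)) : exists f, basis k phi = tact pt m n f.
Proof.
have pm := pos_numbering m; have pn := pos_numbering n.
have mn : m = n.
  rewrite (numbering_card pm) (numbering_card pn).
  exact: bij_eq_card (Bijective (fwK phi) (bwK phi)).
subst n; have [f fe _] := renum_fun pt m (@pos m \o fw phi) pm.
exists f; have pf := numbering_perm pm (numbering_bij phi pm) fe.
have [psi -> pe] := is_pos_map_tact pf; congr basis; apply: fbij_eq => t.
by case: pm => _ inj _; apply: inj; rewrite pe fe.
Qed.

Lemma kS_spanned : tensor_spanned pt.
Proof.
move=> m n P P0 Pt Pl h; elim/free_ind: h => [//|phi|c f g Pf Pg]; last exact: Pl.
by have [g e] := basis_tact phi; have := Pt g; rewrite -e.
Qed.

Lemma card_fbij (A B : finType) : #|A| = #|B| -> exists phi : fbij A B, exists psi : fbij B A,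
  fbij_comp phi psi = fbij_id B.
Proof.
move=> AB; pose f (a : A) : B := enum_val (cast_ord AB (enum_rank a)).
pose g (b : B) : A := enum_val (cast_ord (esym AB) (enum_rank b)).
have fK : cancel f g by move=> a; rewrite /f /g enum_valK cast_ordK enum_rankK.
have gK : cancel g f by move=> b; rewrite /f /g enum_valK cast_ordKV enum_rankK.
exists (mk_fbij fK gK), (mk_fbij gK fK); apply: fbij_eq => b.
by rewrite !mk_fbijE /= !mk_fbijE gK.
Qed.

Lemma kS_dense : tensor_dense pt.
Proof.
move=> A; have [phi [psi e]] := card_fbij (esym (numbering_card (pos_numbering #|A|))).
exists (unit : finType), (fun=> #|A|), (fun=> basis k phi), (fun=> basis k psi).
rewrite /decomposes (big_pred1 tt); last by case.
by rewrite [LHS]bilin_basis e.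
Qed.
End GenerationOfS.

(** * Generation of the free 2-rig and its quotient *)

Lemma decomposes_sig (k : fieldType) (C : linsmc k) (I : finType) (J : I -> finType)
    (X : C) (Y : I -> C) (Z : forall i, J i -> C)
    (u : forall i, lhom (Y i) X) (v : forall i, lhom X (Y i))
    (u' : forall i l, lhom (Z i l) (Y i)) (v' : forall i l, lhom (Y i) (Z i l)) :
  decomposes u v -> (forall i, decomposes (u' i) (v' i)) ->
  @decomposes _ _ {i : I & J i} X (fun p => Z (tag p) (tagged p))
    (fun p => u (tag p) ∘ u' (tag p) (tagged p)) (fun p => v' (tag p) (tagged p) ∘ v (tag p)).
Proof.
rewrite /decomposes => d d'; rewrite -d.
pose G i l := u i ∘ u' i l ∘ (v' i l ∘ v i).
rewrite -(@sig_big_dep _ _ _ I J xpredT (fun i => xpredT) G) /=.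
apply: eq_bigr => i _; rewrite -[u i in RHS]compm1 -d' comp_sumr comp_suml.
by apply: eq_bigr => l _; rewrite /G !compA.
Qed.

Section FullDense.
Variables (k : fieldType).

Definition smfull (C D : linsmc k) (j : smfunctor C D) : Prop :=
  forall a b (h : lhom (j a) (j b)), exists f, smap j f = h.

Lemma smfull_comp (C D E : linsmc k) (j : smfunctor C D) (l : smfunctor D E) :
  smfull j -> smfull l -> smfull (smcomp l j).
Proof. by move=> hj hl a b h; have [g <-] := hl _ _ h; have [f <-] := hj _ _ g; exists f. Qed.

(** Packs the data of [dense_via], so that a single choice per object selects all of it. *)
Record via_dec (C : linsmc k) (A : Type) (O : A -> C) (X : C) := ViaDec {
  vd_idx : finType;
  vd_ob : vd_idx -> A;
  vd_in : forall i, lhom (O (vd_ob i)) X;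
  vd_out : forall i, lhom X (O (vd_ob i));
  vd_dec : decomposes vd_in vd_out }.

Lemma dense_via_comp (C D : linsmc k) (A : Type) (O : A -> C) (j : smfunctor C D) :
  dense_via O -> dense_via j -> dense_via (fun a => j (O a)).
Proof.
move=> hO hj X; have [I [c [u [v d]]]] := hj X.
have hd Y : exists s : via_dec O Y, True.
  by have [J [a [u' [v' d']]]] := hO Y; exists (ViaDec d').
pose s i : via_dec O (c i) := sval (cid (hd (c i))).
have := decomposes_sig d (fun i => smap_decomposes j (vd_dec (s i))).
by move=> d'; exists {i : I & vd_idx (s i)}, (fun p => vd_ob (tagged p)); eexists _, _; exact: d'.
Qed.

Lemma dense_via_iso (C : linsmc k) (A : Type) (O O' : A -> C)
    (f : forall a, lhom (O a) (O' a)) :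
  (forall a, liso (f a)) -> dense_via O -> dense_via O'.
Proof.
move=> fiso hO X; have [I [a [u [v d]]]] := hO X.
pose g b : lhom (O' b) (O b) := sval (cid (fiso b)).
have gf b : g b ∘ f b = lid _ by rewrite /g; case: cid => ? [].
exists I, a, (fun i => u i ∘ g (a i)), (fun i => f (a i) ∘ v i).
by rewrite /decomposes -d; apply: eq_bigr => i _; rewrite compA (compKl _ (gf _)) compm1.
Qed.

Section Transfer.
Variables (C D : linsmc k) (j : smfunctor C D) (x : C).

Lemma tensor_dense_transfer : dense_via j -> tensor_dense x -> tensor_dense (j x).
Proof.
move=> hj hx; pose g m := sval (cid (tpow_cmp_iso j x m)).
apply: (@dense_via_iso _ _ (fun m => j (tpow x m)) _ g) (dense_via_comp hx hj) => m.
by rewrite /g; case: cid => h [hc ch] /=; exists (tpow_cmp j x m).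
Qed.

(** By fullness, [h] conjugated by the comparison isomorphisms is the image of a map [h0], on which
    the induction runs. *)
Lemma tensor_spanned_transfer : smfull j -> tensor_spanned x -> tensor_spanned (j x).
Proof.
move=> fullj sp m n P P0 Pt Pl h.
have [a [am ma]] := tpow_cmp_iso j x m; have [b [bn nb]] := tpow_cmp_iso j x n.
have [h0 e] := fullj _ _ (tpow_cmp j x n ∘ h ∘ a).
have -> : h = b ∘ smap j h0 ∘ tpow_cmp j x m.
  by rewrite e !compA bn comp1m -compA am compm1.
refine (@sp m n (fun h => P (b ∘ smap j h ∘ tpow_cmp j x m)) _ _ _ h0).
- by rewrite smap0 compm0 comp0m.
- by move=> g; rewrite -compA smap_tact compA bn comp1m.
- by move=> c f g Pf Pg; rewrite smapD smapZ compDr compDl compZr compZl; apply: Pl.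
Qed.
End Transfer.
End FullDense.

(** * Inclusions into the additive and idempotent completions *)

Section AdditiveInclusion.
Variables (k : fieldType) (C : linsmc k).
Local Notation M := (additive_completion C).

Definition single (a : C) : M := @Fam k C funit (fun=> a).
Definition smat (a b : C) (f : lhom a b) : @lhom k M (single a) (single b) :=
  @mono k C (single a) (single b) (fun=> tt) (fun=> f).

Lemma additive_comp_mono (A B D : M) phi s psi t :
  (@mono k C B D psi t : @lhom k M B D) ∘ (@mono k C A B phi s : @lhom k M A B) =
  @mono k C A D (fun j => phi (psi j)) (fun j => t j ∘ s (psi j)).
Proof. exact: mono_comp. Qed.

Lemma additive_tens_mono (A B D E : M) phi s psi t :
  (@mono k C A B phi s : @lhom k M A B) ⊗₁ (@mono k C D E psi t : @lhom k M D E) =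
  @mono k C (mat_tob A D) (mat_tob B E) (fun p => (phi p.1, psi p.2))
    (fun p => s p.1 ⊗₁ t p.2).
Proof. exact: mono_tens. Qed.

Lemma smatE (a b : C) (f : lhom a b) : ent (smat f) tt tt = f.
Proof. exact: (@mono_hit _ _ (single a) (single b) (fun=> tt)). Qed.

Lemma smat_inj (a b : C) (f g : @lhom k M (single a) (single b)) :
  ent (f : mat (single a) (single b)) tt tt = ent (g : mat (single a) (single b)) tt tt -> f = g.
Proof. by move=> e; apply: (@matP _ _ (single a) (single b)) => -[] []. Qed.

Definition additive_mu (a b : C) : @lhom k M (single a ⊗ single b) (single (a ⊗ b)) :=
  @mono k C (mat_tob (single a) (single b)) (single (a ⊗ b))
     (fun=> (tt, tt)) (fun=> lid (a ⊗ b)).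

Definition additive_incl : smfunctor C M.
Proof.
refine (@SMFunctor k C M single smat _ _ _ additive_mu (lid _) _ (liso_id _) _ _ _ _ _).
- by move=> a; apply: (@mono_eq _ _ (single a) (single a)) => -[].
- by move=> a b c g f; rewrite additive_comp_mono.
- move=> a b c f g; apply: smat_inj; rewrite ent_lin.
  by rewrite -![X in _ = X]/(_ + _) !smatE.
- move=> a b.
  exists (@mono k C (single (a ⊗ b)) (mat_tob (single a) (single b))
     (fun=> tt) (fun=> lid (a ⊗ b))).
  split; rewrite additive_comp_mono.
    apply: (@mono_eq _ _ (mat_tob (single a) (single b)) (mat_tob (single a) (single b))).
    by move=> [[] []]; rewrite comp1m.
  by apply: (@mono_eq _ _ (single (a ⊗ b)) (single (a ⊗ b))) => -[]; rewrite comp1m.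
- move=> a b a' b' f g; rewrite additive_tens_mono !additive_comp_mono.
  apply: (@mono_eq _ _ (mat_tob (single a) (single b)) (single (a' ⊗ b'))).
  by move=> [] /=; rewrite comp1m compm1.
- move=> a b c; rewrite !additive_tens_mono !additive_comp_mono.
  apply: (@mono_eq _ _ (mat_tob (mat_tob (single a) (single b)) (single c))
    (single (a ⊗ (b ⊗ c)))).
  by move=> [] /=; rewrite !tens1 !compm1 !comp1m.
- move=> a; rewrite !additive_tens_mono !additive_comp_mono.
  apply: (@mono_eq _ _ (mat_tob (mat_one C) (single a)) (single a)).
  by move=> [] /=; rewrite !tens1 !compm1.
- move=> a; rewrite !additive_tens_mono !additive_comp_mono.
  apply: (@mono_eq _ _ (mat_tob (single a) (mat_one C)) (single a)).
  by move=> [] /=; rewrite !tens1 !compm1.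
- move=> a b; rewrite !additive_comp_mono.
  apply: (@mono_eq _ _ (mat_tob (single a) (single b)) (single (b ⊗ a))).
  by move=> [] /=; rewrite comp1m compm1.
Defined.

Lemma additive_incl_full : smfull additive_incl.
Proof.
move=> a b h; exists (ent (h : mat (single a) (single b)) tt tt).
by apply: smat_inj; rewrite smatE.
Qed.

Lemma ent_sum (A B : fam C) (I : finType) (f : I -> mat A B) i j :
  ent (\sum_l f l) i j = \sum_l ent (f l) i j.
Proof. by apply: (big_morph (fun m => ent m i j)) => [m m'|]; rewrite ?entD ?ent0. Qed.

Lemma additive_incl_dense : dense_via additive_incl.
Proof.
move=> A; exists (idx A), (fun i => A i).
exists (fun i => @mat_mk k C (single (A i)) A (fun _ j => ent (mat_id A) i j)).
exists (fun i => @mat_mk k C A (single (A i)) (fun j _ => ent (mat_id A) j i)).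
(* The identity matrix, written as its own square, splits as a sum over the intermediate index. *)
have [_ + _] := mat_laws C => /(_ A A (mat_id A)) e; rewrite /decomposes -[RHS]e.
apply: matP => i j; rewrite ent_sum [RHS]mat_mkE; apply: eq_bigr => l _.
by rewrite mat_mkE (big_pred1 tt) ?mat_mkE // => -[].
Qed.
End AdditiveInclusion.

Section IdempotentInclusion.
Variables (k : fieldType) (C : linsmc k).
Local Notation K := (idempotent_completion C).

Definition kar_obj (a : C) : K := Kar (comp1m (lid a)).
Definition kar_map (a b : C) (f : lhom a b) : @lhom k K (kar_obj a) (kar_obj b) :=
  @kmk k C (kar_obj a) (kar_obj b) f.

Lemma kar_mapE (a b : C) (f : lhom a b) : kval (kar_map f) = f.
Proof. by rewrite /kar_map kmkE comp1m compm1. Qed.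

(** The idempotent of [kar_obj a ⊗ kar_obj b] is [lid a ⊗₁ lid b], equal but not convertible to that
    of [kar_obj (a ⊗ b)]; hence a comparison with underlying identity. *)
Definition kar_mu (a b : C) : @lhom k K (kar_obj a ⊗ kar_obj b) (kar_obj (a ⊗ b)) :=
  @kmk k C (k_tob (kar_obj a) (kar_obj b)) (kar_obj (a ⊗ b)) (lid _).
Definition kar_mui (a b : C) : @lhom k K (kar_obj (a ⊗ b)) (kar_obj a ⊗ kar_obj b) :=
  @kmk k C (kar_obj (a ⊗ b)) (k_tob (kar_obj a) (kar_obj b)) (lid _).

Lemma kar_muE (a b : C) : kval (kar_mu a b) = lid (a ⊗ b).
Proof. by rewrite /kar_mu kmkE /= tens1 !compm1. Qed.
Lemma kar_muiE (a b : C) : kval (kar_mui a b) = lid (a ⊗ b).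
Proof. by rewrite /kar_mui kmkE /= tens1 !compm1. Qed.
Lemma kcompE (A B D : K) (g : lhom B D) (f : lhom A B) : kval (g ∘ f) = kval g ∘ kval f.
Proof. exact: k_compE. Qed.
Lemma ktensE (A B D E : K) (f : lhom A B) (g : lhom D E) :
  kval (f ⊗₁ g) = kval f ⊗₁ kval g.
Proof. exact: k_thomE. Qed.
Lemma kidE (A : K) : @kval k C A A (lid A) = kid A.
Proof. exact: k_idE. Qed.

Definition idem_incl : smfunctor C K.
Proof.
refine (@SMFunctor k C K kar_obj kar_map _ _ _ kar_mu (lid _) _ (liso_id _) _ _ _ _ _).
- by move=> a; apply: kval_inj; rewrite [LHS]kar_mapE [RHS]kidE.
- by move=> a b c g f; apply: kval_inj; rewrite kcompE !kar_mapE.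
- by move=> a b c f g; apply: kval_inj; rewrite kval_lin !kar_mapE.
- move=> a b; exists (kar_mui a b).
  by split; apply: kval_inj; rewrite kcompE kar_muE kar_muiE compm1 [RHS]kidE //= tens1.
- move=> a b a' b' f g; apply: kval_inj.
  by rewrite !kcompE !kar_muE ktensE !kar_mapE comp1m compm1.
- move=> a b c; apply: kval_inj.
  rewrite !kcompE !ktensE !kar_muE !kidE !kar_mapE /= !tens1 !compm1 comp1m.
  by rewrite [kval _]kmkE /= !tens1 compm1 comp1m.
- move=> a; apply: kval_inj.
  rewrite !kcompE !ktensE !kar_muE !kidE !kar_mapE /= !tens1 !compm1.
  by rewrite [kval _]kmkE /= !tens1 compm1 comp1m.
- move=> a; apply: kval_inj.
  rewrite !kcompE !ktensE !kar_muE !kidE !kar_mapE /= !tens1 !compm1.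
  by rewrite [kval _]kmkE /= !tens1 compm1 comp1m.
- move=> a b; apply: kval_inj; rewrite !kcompE !kar_muE !kar_mapE compm1 comp1m.
  by rewrite [kval _]kmkE /= !tens1 compm1 comp1m.
Defined.

Lemma idem_incl_full : smfull idem_incl.
Proof. by move=> a b h; exists (kval h); apply: kval_inj; rewrite kar_mapE. Qed.

Lemma idem_incl_dense : dense_via idem_incl.
Proof.
move=> A; exists (unit : finType), (fun=> kob A).
exists (fun=> @kmk k C (kar_obj (kob A)) A (kid A)).
exists (fun=> @kmk k C A (kar_obj (kob A)) (kid A)).
rewrite /decomposes (big_pred1 tt); last by case.
apply: kval_inj; rewrite kcompE [RHS]kidE !kmkE /= compm1 comp1m.
by rewrite !kidK.
Qed.
End IdempotentInclusion.

Lemma quotient_functor_full (k : fieldType) (S : two_rig k) (I : two_ideal S) :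
  smfull (quotient_functor I).
Proof. by move=> a b h; have [f ->] := qr_ex h; exists f. Qed.

Lemma quotient_functor_dense (k : fieldType)
    (S : two_rig k) (I : two_ideal S) :
  dense_via (quotient_functor I).
Proof.
move=> X; exists (unit : finType), (fun=> X : S), (fun=> lid _), (fun=> lid _).
by rewrite /decomposes (big_pred1 tt) ?comp1m // => -[].
Qed.

(** * The universal property *)

Section Equivalences.
Variables (C D : category) (F : functor C D).

(** The counit is the chosen isomorphism [f d], and the unit at [a] is the map that [F] sends to the
    inverse of [f (F a)]. *)
Lemma ff_es_equivalence :
  (forall d, exists c (f : hom (F c) d), is_iso f) ->
  (forall a b (h : hom (F a) (F b)), exists! s : hom a b, fmap F s = h) ->
  is_equivalence F.
Proof.
move=> es ff; have [A1 L1 R1] := cat_lawsP C; have [A L R] := cat_lawsP D.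
pose c d := sval (cid (es d)).
pose f d : hom (F (c d)) d := sval (cid (svalP (cid (es d)))).
have fiso d : is_iso (f d) := svalP (cid (svalP (cid (es d)))).
pose g d := sval (cid (fiso d)).
have gf d : ccomp (g d) (f d) = idm _ := (svalP (cid (fiso d))).1.
have fg d : ccomp (f d) (g d) = idm _ := (svalP (cid (fiso d))).2.
pose lift a b (h : hom (F a) (F b)) := sval (cid (ff a b h)).
have liftE a b h : fmap F (lift a b h) = h := (svalP (cid (ff a b h))).1.
have faith a b (s t : hom a b) : fmap F s = fmap F t -> s = t.
  by move=> e; have [u [_ uu]] := ff _ _ (fmap F t); rewrite -(uu s e) (uu t erefl).
have Gid d : lift _ _ (ccomp (g d) (ccomp (idm d) (f d))) = idm (c d).
  by apply: faith; rewrite liftE L gf fmap_id.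
have Gcomp d1 d2 d3 (h : hom d2 d3) (h' : hom d1 d2) :
    lift _ _ (ccomp (g d3) (ccomp (ccomp h h') (f d1))) =
    ccomp (lift _ _ (ccomp (g d3) (ccomp h (f d2))))
      (lift _ _ (ccomp (g d2) (ccomp h' (f d1)))).
  apply: faith; rewrite fmap_comp !liftE -!A; congr (ccomp _ _); congr (ccomp _ _).
  by rewrite (A _ _ _ _ (f d2)) fg L.
pose G : functor D C := Functor Gid Gcomp.
have eta_nat a b (s : hom a b) :
    ccomp (lift _ _ (g (F b))) (fmap (fid C) s) = ccomp (fmap (fcomp G F) s) (lift _ _ (g (F a))).
  apply: faith; rewrite !fmap_comp !liftE /=.
  by rewrite -!A fg R.
have eps_nat a b (s : hom a b) :
    ccomp (f b) (fmap (fcomp F G) s) = ccomp (fmap (fid D) s) (f a).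
  by rewrite /= liftE A fg L.
exists G, (@NatTrans _ _ (fid C) (fcomp G F) (fun a => lift _ _ (g (F a))) eta_nat).
exists (@NatTrans _ _ (fcomp F G) (fid D) f eps_nat); split=> [a|//].
exists (lift _ _ (f (F a))); by split; apply: faith; rewrite fmap_comp !liftE fmap_id ?fg ?gf.
Qed.
End Equivalences.

Section FreeSubdim.
Variables (k : fieldType) (n : nat).
Local Notation Q := (free_subdim k n).
Local Notation x := (free_subdim_x k n).

(** The one-point type goes to the generator by conversion, so that density and spanning carry over
    from [kS]. *)
Definition gen_incl : smfunctor (kS k) Q :=
  smcomp (quotient_functor (ext_ideal k n))
    (smcomp (idem_incl (additive_completion (kS k))) (additive_incl (kS k))).

Lemma free_subdim_dense : tensor_dense x.
Proof.
apply: (@tensor_dense_transfer _ _ _ gen_incl (funit : kS k)); last exact: kS_dense.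
apply: (@dense_via_comp _ (kSbar k)); last exact: quotient_functor_dense.
exact: (dense_via_comp (@additive_incl_dense _ _) (@idem_incl_dense _ _)).
Qed.

Lemma free_subdim_spanned : tensor_spanned x.
Proof.
apply: (@tensor_spanned_transfer _ _ _ gen_incl (funit : kS k)); last exact: kS_spanned.
apply: smfull_comp; last exact: quotient_functor_full.
exact: smfull_comp (@additive_incl_full _ _) (@idem_incl_full _ _).
Qed.

(** If one splitting of the antisymmetrizer is zero, then so is the antisymmetrizer, and hence every
    splitting of it. *)
Lemma subdim_ext_power (R : linsmc k) (y L : R) :
  subdim n y -> is_ext_power n.+1 y L -> is_zero_ob L.
Proof.
move=> [Z [[i [p [_ ip]]] [z0 _]]] [i' [p' [pi' ip']]]; apply/zero_obP.
rewrite -[LHS]compm1 -pi' -!compA (compA i') ip' -ip (z0 _ i).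
by rewrite !(comp0m, compm0).
Qed.

Lemma free_subdim_gen : [pchar k] =i pred0 -> subdim n x.
Proof.
move=> char0.
have e : antisym (kSbar_x k) n.+1 ∘ antisym (kSbar_x k) n.+1 = antisym (kSbar_x k) n.+1.
  apply: antisym_idem; have /pcharf0P -> := char0.
  by rewrite -lt0n fact_gt0.
have [_ _ /(_ _ _ e)[L hL]] := two_rigP (kSbar k).
exists (quotient_functor (ext_ideal k n) L); split.
  exact: (smap_ext_power (quotient_functor (ext_ideal k n)) hL).
apply/zero_obP; apply/(qpE (ext_ideal k n)); rewrite subr0.
(* The identity of [L] vanishes in the quotient because it factors through [L] itself, which lies in
   the ideal. *)
exists L, (lid L), (lid L); split; last by rewrite comp1m.
by move=> I; apply.
Qed.

Lemma kSbar_functor_ex (R : two_rig k) (r : R) :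
  exists F : smfunctor (kSbar k) R, F (kSbar_x k) = r.
Proof.
pose F := tensor_power_functor r; pose G : smfunctor (kSbar k) R := cauchy_ext F.
(* As x is a one-member family with the identity idempotent, [ext_out] identifies [G x] with the
   power of degree [#|funit|]; [tact] brings it to degree 1, and the unitor to r. *)
pose f : lhom (G (kSbar_x k)) r := ρr r ∘ tact r #|funit| 1 id ∘ @ext_out _ _ _ F (kSbar_x k) tt.
suff : liso f by apply: smfunctor_at.
apply: liso_comp; first by apply: liso_comp (ρ_iso r) (tact_iso r card_unit).
exists (@ext_in _ _ _ F (kSbar_x k) tt); split.
  by rewrite -[RHS](ext_dec F (kSbar_x k)) (big_pred1 tt) // => -[].
rewrite [LHS](@ext_outin _ _ _ F (kSbar_x k) tt tt).
rewrite [ent _ _ _](@mono_hit _ _ _ (@Fam k (kS k) funit (fun=> funit)) id).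
exact: (smap_id F (funit : kS k)).
Qed.

Lemma free_subdim_functor_ex (R : two_rig k) (r : R) :
  subdim n r -> exists F : smfunctor Q R, F x = r.
Proof.
move=> hr; have [F Fx] := kSbar_functor_ex r.
have F0 a : ext_ideal k n a -> is_zero_ob (F a).
  (* Membership in the generated ideal is membership in every 2-ideal containing the exterior powers
     of x, here in that of the objects killed by [F]. *)
  move=> h; apply: (h (kernel_ideal F)) => L hL; apply: subdim_ext_power (smap_ext_power F hL).
  by rewrite Fx.
by exists (descend F0).
Qed.

Lemma free_subdim_ff (R : linsmc k) (F G : smfunctor Q R) (h : lhom (F x) (G x)) :
  exists! s : monnat F G, s x = h.
Proof.
exists (monnat_ext free_subdim_dense free_subdim_spanned h).
split; first exact: monnat_extE.
by move=> s <-; apply: (monnat_unique free_subdim_dense); rewrite monnat_extE.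
Qed.

(** Full faithfulness supplies a transformation with component [g] at x; its composites with s are
    identities because they are so at x. *)
Lemma monnat_iso (R : linsmc k) (F G : smfunctor Q R) (s : monnat F G) :
  liso (s x) -> @is_iso (smcat Q R) F G s.
Proof.
move=> [g [gs sg]]; have [t [tx _]] := free_subdim_ff (F := G) (G := F) g.
exists t; split; apply: (monnat_unique free_subdim_dense) => /=.
  by rewrite tx.
by rewrite tx.
Qed.

Lemma ev_subdim_equivalence (hx : subdim n x) (R : two_rig k) :
  is_equivalence (ev_subdim hx R).
Proof.
apply: ff_es_equivalence => [[r hr]|F G h]; last exact: free_subdim_ff.
have [F e] := free_subdim_functor_ex hr; exists F.
case: r / e hr => hr; exists (lid (F x)).
by exists (lid (F x)); split; apply: comp1m.
Qed.

(** Both functors have the same underlying objects and maps; the proofs of [subdim] and of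
    functoriality that they carry are identified by proof irrelevance. *)
Lemma ev_subdim_natural (hx : subdim n x) (R R' : two_rig k) (G : smfunctor R R') :
  fcomp (ev_subdim hx R') (postcomp Q G) = fcomp (Subdim_map n G) (ev_subdim hx R).
Proof.
pose mk (p : forall F : smfunctor Q R, subdim n (G (F x))) :=
  @Functor (smcat Q R) (Subdim n R') (fun F => exist _ (G (F x)) (p F))
    (fun _ _ s => smap G (mcomp s x)).
have mk_eq p1 p2 h1 h1' h2 h2' : mk p1 h1 h1' = mk p2 h2 h2'.
  move: h1 h1' h2 h2'; rewrite (Prop_irrelevance p1 p2) => *.
  by congr Functor; apply: Prop_irrelevance.
exact: mk_eq.
Qed.
End FreeSubdim.

Lemma id_hom_comp (k : fieldType) (C : linsmc k) (a b : C) (e : a = b) :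
  (@id_hom (cat_of C) a b e : lhom a b) ∘ (@id_hom (cat_of C) b a (esym e) : lhom b a) = lid b.
Proof. by case: b / e => /=; rewrite [LHS]comp1m. Qed.

Lemma id_hom_compV (k : fieldType) (C : linsmc k) (a b : C) (e : a = b) :
  (@id_hom (cat_of C) b a (esym e) : lhom b a) ∘ (@id_hom (cat_of C) a b e : lhom a b) = lid a.
Proof. by case: b / e => /=; rewrite [LHS]comp1m. Qed.

Theorem lemma32 (k : fieldType) (char0 : [pchar k] =i pred0) (n : nat) :
  exists hx : subdim n (free_subdim_x k n),
  [/\ forall R : two_rig k, is_equivalence (ev_subdim hx R),
      forall (R R' : two_rig k) (G : smfunctor R R'),
        fcomp (ev_subdim hx R') (postcomp (free_subdim k n) G) =
        fcomp (Subdim_map n G) (ev_subdim hx R),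
      forall (R R' : two_rig k) (G G' : smfunctor R R') (s : monnat G G')
          (F : smfunctor (free_subdim k n) R),
        fmap (ev_subdim hx R') (whisker_pre s F) =
        Subdim_map2 n s (ev_subdim hx R F),
      forall (R : two_rig k) (r : R), subdim n r ->
        exists F : smfunctor (free_subdim k n) R, F (free_subdim_x k n) = r
    & forall (R : two_rig k) (r : R) (F G : smfunctor (free_subdim k n) R)
          (hF : F (free_subdim_x k n) = r) (hG : G (free_subdim_x k n) = r),
        exists! s : monnat F G,
          @is_iso (smcat (free_subdim k n) R) F G s /\
          @id_hom (cat_of R) _ _ hG ∘ s (free_subdim_x k n) =
          @id_hom (cat_of R) _ _ hF ].
Proof.
exists (free_subdim_gen n char0); split.
- exact: ev_subdim_equivalence.
- exact: ev_subdim_natural.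
- by [].
- exact: free_subdim_functor_ex.
move=> R r F G hF hG.
(* The condition at x forces the component of s there; full faithfulness then gives existence and
   uniqueness. *)
have [s [sx us]] := free_subdim_ff (F := F) (G := G)
  ((@id_hom (cat_of R) _ _ (esym hG) : lhom r _) ∘ (@id_hom (cat_of R) _ _ hF : lhom _ r)).
exists s; split; first split.
- apply: monnat_iso; rewrite sx; apply: liso_comp.
    by exists (@id_hom (cat_of R) _ _ hG); rewrite id_hom_comp id_hom_compV.
  by exists (@id_hom (cat_of R) _ _ (esym hF)); rewrite id_hom_comp id_hom_compV.
- by rewrite sx compA id_hom_comp comp1m.
- by move=> t [_ tx]; apply: us; rewrite -tx compA id_hom_compV comp1m.
Qed.
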